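(* Let $A(\lambda)$, $B(\lambda)$ be the autoregressive and moving average polynomials of the context, let $F(\lambda)=A(\lambda)^{-1}B(\lambda)$ be irreducible, and let $R_1,\ldots,R_p\in\mathbb{C}^{d\times d}$ be a complete set of regular right solvents of $A(\lambda)$. Suppose $\sigma(A(\cdot))\subset(-\infty,0)+i\mathbb{R}$ and $\mathbb{E}[\log(\max(1,\|L(1)\|))]<\infty$. Define for $k=1,\ldots,p$ the multivariate complex-valued Ornstein-Uhlenbeck processes $$Y_k(t)=\int_{-\infty}^t e^{R_k(t-u)}\,\mathrm{Res}[F,R_k]\,\mathrm{d}L(u),\qquad t\in\mathbb{R}.$$ Then $$Y(t)=\sum_{k=1}^pY_k(t)=\int_{-\infty}^t\sum_{k=1}^pe^{R_k(t-u)}\,\mathrm{Res}[F,R_k]\,\mathrm{d}L(u),\qquad t\in\mathbb{R},$$ is a stationary $\mathbb{R}^d$-valued solution of the state space model $$Y(t)=C^*X(t),\qquad \mathrm{d}X(t)=A^*X(t)\,\mathrm{d}t+B^*\,\mathrm{d}L(t),$$ and hence a MCARMA$(p,q)$ process.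
   Context: Let $d,m\ge 1$ be integers and $p>q$ positive integers. $L=(L(t))_{t\in\mathbb{R}}$ is a two-sided $\mathbb{R}^m$-valued Lévy process: $L(0)=0_m$ a.s., stationary and independent increments, càdlàg paths. Let $$A(\lambda)=I_d\lambda^p+A_1\lambda^{p-1}+\ldots+A_p,\qquad B(\lambda)=B_0\lambda^q+\ldots+B_{q-1}\lambda+B_q,$$ with $A_1,\ldots,A_p\in\mathbb{R}^{d\times d}$, $B_0,\ldots,B_q\in\mathbb{R}^{d\times m}$. State space matrices: $A^*\in\mathbb{R}^{pd\times pd}$ is the block companion matrix whose $i$-th block row, $1\le i\le p-1$, has $I_d$ in block column $i+1$ and zero blocks elsewhere, and whose last block row is $(-A_p,-A_{p-1},\ldots,-A_1)$; $C^*=(I_d,0_{d\times d},\ldots,0_{d\times d})\in\mathbb{R}^{d\times pd}$; $B^*=(\beta_1^\top\cdots\beta_p^\top)^\top\in\mathbb{R}^{pd\times m}$ with $\beta_1=\ldots=\beta_{p-q-1}=0_{d\times m}$ and $\beta_{p-j}=-\sum_{i=1}^{p-j-1}A_i\beta_{p-j-i}+B_{q-j}$ for $j=0,\ldots,q$. An $\mathbb{R}^d$-valued process $Y$ is called a MCARMA$(p,q)$ process (a solution of the state space model) if $Y(t)=C^*X(t)$ for some $\mathbb{R}^{pd}$-valued process $X$ with $\mathrm{d}X(t)=A^*X(t)\,\mathrm{d}t+B^*\,\mathrm{d}L(t)$. Solvents: $\sigma(A(\cdot))=\{\lambda\in\mathbb{C}:\det A(\lambda)=0\}$, and $\sigma(R)$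 is the set of eigenvalues of a matrix $R$. A matrix $R\in\mathbb{C}^{d\times d}$ is a right solvent of $A(\lambda)$ if $R^p+A_1R^{p-1}+\ldots+A_{p-1}R+A_p=0_{d\times d}$. It is regular if $\sigma(R)\cap\sigma(A^{(1)}(\cdot))=\emptyset$, where $A^{(1)}(\lambda)$ is the monic matrix polynomial of degree $p-1$ with $A(\lambda)=A^{(1)}(\lambda)(\lambda I_d-R)$. A set of right solvents $R_1,\ldots,R_p$ is complete if $\sigma(A(\cdot))=\bigcup_{k=1}^p\sigma(R_k)$. $F(\lambda)=A(\lambda)^{-1}B(\lambda)$ is irreducible if $A(\lambda)$ and $B(\lambda)$ are left coprime. For a regular right solvent $R$, the residue is $\mathrm{Res}[F,R]=\frac{1}{2\pi i}\oint_{\Gamma_R}F(\lambda)\,\mathrm{d}\lambda\in\mathbb{C}^{d\times m}$, where $\Gamma_R$ is a simple closed (positively oriented) contour with $\sigma(R)$ in its interior and $\sigma(A(\cdot))\setminus\sigma(R)$ in its exterior. *)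

(* Defs.v *)
From HB Require Import structures.
From mathcomp Require Import all_boot all_order all_algebra.
From mathcomp Require Import complex.
From mathcomp Require Import all_classical all_reals all_analysis.

Set Implicit Arguments.
Unset Strict Implicit.
Unset Printing Implicit Defensive.

Import Order.TTheory GRing.Theory Num.Theory.
Import numFieldNormedType.Exports.

Local Open Scope classical_set_scope.
Local Open Scope ring_scope.
Local Open Scope complex_scope.

Definition cplx_mx (R : realType) (m n : nat) (M : 'M[R]_(m, n)) :
  'M[R[i]]_(m, n) := map_mx (real_complex R) M.

Definition cplx_coefs (R : realType) (m n : nat) (A : nat -> 'M[R]_(m, n)) :
  nat -> 'M[R[i]]_(m, n) := fun k => cplx_mx (A k).

Definition Re_mx (R : realType) (m n : nat) (M : 'M[R[i]]_(m, n)) :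
  'M[R]_(m, n) := map_mx (@complex.Re R) M.

Definition Im_mx (R : realType) (m n : nat) (M : 'M[R[i]]_(m, n)) :
  'M[R]_(m, n) := map_mx (@complex.Im R) M.

(* Euclidean norms; the library norm on matrices is the sup norm. *)
Definition enorm (R : realType) (n : nat) (v : 'cV[R]_n) : R :=
  Num.sqrt (\sum_i v i 0 ^+ 2).

Definition cnorm (R : realType) (n : nat) (v : 'cV[R[i]]_n) : R :=
  Num.sqrt (enorm (Re_mx v) ^+ 2 + enorm (Im_mx v) ^+ 2).

(* [R[i]^o] is [R[i]] with its usual topology, which induces the entrywise
   topology on matrices. *)
Definition mexp (R : realType) (n : nat) (M : 'M[R[i]]_n) : 'M[R[i]]_n :=
  limn (series (fun k => (k`!%:R : R[i])^-1 *: M ^+ k : 'M[R[i]^o]_n)).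

(* A family [A : nat -> 'M_d] stands for [A_1, ..., A_n]; the other values are
   never used. *)
Definition ar_poly (K : nzRingType) (d n : nat) (A : nat -> 'M[K]_d) :
  'M[{poly K}]_d :=
  ('X^n)%:M + \sum_(1 <= i < n.+1) 'X^(n - i) *: map_mx polyC (A i).

Definition ma_poly (K : nzRingType) (d m q : nat) (B : nat -> 'M[K]_(d, m)) :
  'M[{poly K}]_(d, m) :=
  \sum_(0 <= j < q.+1) 'X^(q - j) *: map_mx polyC (B j).

Definition mxpoly_eval (K : nzRingType) (d m : nat) (M : 'M[{poly K}]_(d, m))
  (x : K) : 'M[K]_(d, m) := map_mx (fun f : {poly K} => f.[x]) M.

Definition mxpoly_spectrum (K : fieldType) (d : nat) (M : 'M[{poly K}]_d) :
  set K := [set x | \det (mxpoly_eval M x) = 0].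

Definition spectrum (K : fieldType) (d : nat) (S : 'M[K]_d) : set K :=
  [set x | eigenvalue S x].

Definition left_coprime (K : fieldType) (d m : nat) (M : 'M[{poly K}]_d)
  (N : 'M[{poly K}]_(d, m)) : Prop :=
  forall (D M' : 'M[{poly K}]_d) (N' : 'M[{poly K}]_(d, m)),
    M = D *m M' -> N = D *m N' -> D \in unitmx.

Definition right_solvent (K : fieldType) (d p : nat) (A : nat -> 'M[K]_d)
  (S : 'M[K]_d) : Prop :=
  S ^+ p + \sum_(1 <= i < p.+1) A i *m S ^+ (p - i) = 0.

Definition regular_solvent (K : fieldType) (d p : nat) (A : nat -> 'M[K]_d)
  (S : 'M[K]_d) : Prop :=
  right_solvent p A S /\
  exists A1 : nat -> 'M[K]_d,
    ar_poly p A = ar_poly p.-1 A1 *m ('X%:M - map_mx polyC S) /\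
    spectrum S `&` mxpoly_spectrum (ar_poly p.-1 A1) = set0.

Definition complete_solvents (K : fieldType) (d p : nat) (A : nat -> 'M[K]_d)
  (S : 'I_p -> 'M[K]_d) : Prop :=
  (forall k, right_solvent p A (S k)) /\
  mxpoly_spectrum (ar_poly p A) = \bigcup_(k in [set: 'I_p]) spectrum (S k).

(* The rational matrix function [A(x)^-1 B(x)]; a junk value when [A(x)] is
   singular. *)
Definition mfd (K : fieldType) (d m : nat) (M : 'M[{poly K}]_d)
  (N : 'M[{poly K}]_(d, m)) (x : K) : 'M[K]_(d, m) :=
  invmx (mxpoly_eval M x) *m mxpoly_eval N x.

Definition C1 (R : realType) (g : R -> R) : Prop :=
  (forall s, derivable g s 1) /\ continuous (derive1 g).

(* Being C^1 on a closed interval is stated as having a C^1 extension. *)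
Definition piecewise_C1 (R : realType) (g : R -> R[i]) : Prop :=
  exists (n : nat) (s : nat -> R), [/\ s 0%N = 0, s n = 1 &
    forall i, (i < n)%N -> s i < s i.+1 /\
      exists x y : R -> R, [/\ C1 x, C1 y &
        {in `[s i, s i.+1], forall u, g u = x u +i* y u}]].

(* Simple closed curve, parametrized by [0, 1]. *)
Definition simple_closed_contour (R : realType) (g : R -> R[i]) : Prop :=
  [/\ piecewise_C1 g, g 0 = g 1 & {in `[0, 1[ &, injective g}].

Definition velocity (R : realType) (g : R -> R[i]) (s : R) : R[i] :=
  derive1 (fun u => complex.Re (g u)) s +i* derive1 (fun u => complex.Im (g u)) s.

Definition contour_int (R : realType) (g : R -> R[i]) (h : R[i] -> R[i]) :
  R[i] :=
  (\int[@lebesgue_measure R]_(s in `[0, 1])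
      complex.Re (h (g s) * velocity g s)) +i*
  (\int[@lebesgue_measure R]_(s in `[0, 1])
      complex.Im (h (g s) * velocity g s)).

Definition two_i_pi (R : realType) : R[i] := 0 +i* (2 * pi).

Definition curve (R : realType) (g : R -> R[i]) : set R[i] := g @` `[0, 1].

(* The interior and exterior are the points off the curve lying in a bounded,
   resp. unbounded, connected component of its complement; the orientation is
   positive when the curve winds once around each interior point. *)
Definition contour_component (R : realType) (g : R -> R[i]) (z : R[i]) :
  set R[i]^o := connected_component (~` curve g : set R[i]^o) z.

Definition contour_interior (R : realType) (g : R -> R[i]) : set R[i] :=
  [set z | ~ curve g z /\ bounded_set (contour_component g z)].

Definition contour_exterior (R : realType) (g : R -> R[i]) : set R[i] :=
  [set z | ~ curve g z /\ ~ bounded_set (contour_component g z)].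

Definition positively_oriented (R : realType) (g : R -> R[i]) : Prop :=
  forall z, contour_interior g z ->
    (two_i_pi R)^-1 * contour_int g (fun x => (x - z)^-1) = 1.

Definition solvent_contour (R : realType) (d : nat) (M : 'M[{poly R[i]}]_d)
  (S : 'M[R[i]]_d) (g : R -> R[i]) : Prop :=
  [/\ simple_closed_contour g, positively_oriented g,
      spectrum S `<=` contour_interior g &
      mxpoly_spectrum M `\` spectrum S `<=` contour_exterior g].

Definition residue (R : realType) (d m : nat) (F : R[i] -> 'M[R[i]]_(d, m))
  (g : R -> R[i]) : 'M[R[i]]_(d, m) :=
  (two_i_pi R)^-1 *: \matrix_(i, j) contour_int g (fun x => F x i j).

Definition state_A (R : realType) (d p : nat) (A : nat -> 'M[R]_d) :=
  \mxblock_(i < p, j < p)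
    (if (i.+1 == p)%N then - A (p - j)%N
     else if (j == i.+1 :> nat) then 1%:M else 0 : 'M[R]_d).

Definition state_C (R : realType) (d p : nat) :=
  \mxrow_(j < p) (if (j == 0 :> nat) then 1%:M else 0 : 'M[R]_d).

(* [beta_seq n] is the list [beta_1; ...; beta_n]; see [betaE]. *)
Fixpoint beta_seq (R : realType) (d m p q : nat) (A : nat -> 'M[R]_d)
  (B : nat -> 'M[R]_(d, m)) (n : nat) : seq 'M[R]_(d, m) :=
  if n is n'.+1 then
    let s := beta_seq p q A B n' in
    rcons s (if (n < p - q)%N then 0
             else - (\sum_(1 <= i < n) A i *m s`_(n - i).-1)
                  + B (n - (p - q))%N)
  else [::].

Definition beta (R : realType) (d m p q : nat) (A : nat -> 'M[R]_d)
  (B : nat -> 'M[R]_(d, m)) (n : nat) : 'M[R]_(d, m) :=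
  (beta_seq p q A B n)`_n.-1.

Lemma size_beta_seq (R : realType) (d m p q : nat) (A : nat -> 'M[R]_d)
  (B : nat -> 'M[R]_(d, m)) (n : nat) : size (beta_seq p q A B n) = n.
Proof. by elim: n => //= n IHn; rewrite size_rcons IHn. Qed.

Lemma nth_beta_seq (R : realType) (d m p q : nat) (A : nat -> 'M[R]_d)
  (B : nat -> 'M[R]_(d, m)) (n k : nat) : (0 < k <= n)%N ->
  (beta_seq p q A B n)`_k.-1 = beta p q A B k.
Proof.
elim: n k => [|n IHn] [|k] // Hk.
have [->//|ne] := eqVneq k n.
have lt_kn : (k < n)%N by rewrite ltn_neqAle ne.
by rewrite [LHS]/= nth_rcons size_beta_seq lt_kn -(IHn k.+1).
Qed.

Lemma beta0E (R : realType) (d m p q : nat) (A : nat -> 'M[R]_d)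
  (B : nat -> 'M[R]_(d, m)) (k : nat) : (0 < k < p - q)%N ->
  beta p q A B k = 0.
Proof.
case: k => // k /= Hk.
by rewrite /beta /= nth_rcons size_beta_seq ltnn eqxx Hk.
Qed.

Lemma betaE (R : realType) (d m p q : nat) (A : nat -> 'M[R]_d)
  (B : nat -> 'M[R]_(d, m)) (j : nat) : (q < p)%N -> (j <= q)%N ->
  beta p q A B (p - j) =
  - (\sum_(1 <= i < p - j) A i *m beta p q A B (p - j - i)) + B (q - j)%N.
Proof.
move=> qp jq; have pj : (0 < p - j)%N by rewrite subn_gt0 (leq_ltn_trans jq).
have -> : (q - j = p - j - (p - q))%N.
  by rewrite subnAC subKn // ltnW.
have : (p - q <= p - j)%N by rewrite leq_sub2l.
case: (p - j)%N pj => // k _ Hk.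
rewrite {1}/beta /= nth_rcons size_beta_seq ltnn eqxx ltnNge Hk /=.
congr (- _ + _); apply: eq_big_nat => i /andP[i1 ik]; congr (_ *m _).
apply: nth_beta_seq; rewrite subn_gt0 ik /=.
by rewrite leq_subLR -addn1 addnC leq_add2r.
Qed.

Definition state_B (R : realType) (d m p q : nat) (A : nat -> 'M[R]_d)
  (B : nat -> 'M[R]_(d, m)) := \mxcol_(i < p) beta p q A B i.+1.

Definition borel (T : topologicalType) : set (set T) := <<s [set U | open U] >>.

Definition random_vector (dO : measure_display) (O : measurableType dO)
  (R : realType) (n : nat) (X : O -> 'cV[R]_n) : Prop :=
  forall U, borel U -> measurable (X @^-1` U).

Definition complex_random_vector (dO : measure_display) (O : measurableType dO)
  (R : realType) (n : nat) (X : O -> 'cV[R[i]]_n) : Prop :=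
  random_vector (fun w => Re_mx (X w)) /\ random_vector (fun w => Im_mx (X w)).

Definition cadlag (R : realType) (n : nat) (f : R -> 'cV[R]_n) : Prop :=
  forall t, f x @[x --> t^'+] --> f t /\ cvg (f x @[x --> t^'-]).

Record levy_process (dO : measure_display) (O : measurableType dO)
  (R : realType) (P : probability O R) (m : nat) (L : R -> O -> 'cV[R]_m) :
  Prop := {
  levy_measurable : forall t, random_vector (L t) ;
  levy_start : {ae P, forall w, L 0 w = 0} ;
  levy_stationary : forall (s t h : R) (U : set 'cV[R]_m), s <= t -> borel U ->
    P [set w | U (L (t + h) w - L (s + h) w)] = P [set w | U (L t w - L s w)] ;
  levy_independent : forall (n : nat) (t : nat -> R) (U : nat -> set 'cV[R]_m),
    (forall i, (i < n)%N -> t i <= t i.+1) -> (forall i, borel (U i)) ->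
    P [set w | forall i, (i < n)%N -> U i (L (t i.+1) w - L (t i) w)] =
    (\prod_(i < n) P [set w | U i (L (t i.+1) w - L (t i) w)%R])%E ;
  levy_cadlag : forall w, cadlag (fun t => L t w) }.

Definition stationary (dO : measure_display) (O : measurableType dO)
  (R : realType) (P : probability O R) (d : nat) (Y : R -> O -> 'cV[R]_d) :
  Prop :=
  forall (n : nat) (t : 'I_n -> R) (h : R) (U : set 'M[R]_(d, n)), borel U ->
    P [set w | U (\matrix_(i, j) Y (t j + h) w i 0)] =
    P [set w | U (\matrix_(i, j) Y (t j) w i 0)].

(* The integrand of [Y_k(t)], for a solvent [S] and a residue [K]. *)
Definition ou_kernel (R : realType) (d m : nat) (S : 'M[R[i]]_d)
  (K : 'M[R[i]]_(d, m)) (t u : R) : 'M[R[i]]_(d, m) :=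
  mexp ((t - u)%:C *: S) *m K.

Definition partition_of (R : realType) (a b : R) (n : nat) (s : nat -> R) :
  Prop :=
  [/\ s 0%N = a, s n = b & forall i, (i < n)%N -> s i <= s i.+1].

(* The integral over [(a, b]] of the step function equal to [f (s i)] on
   [(s i, s i.+1]]. *)
Definition step_integral (O : Type) (R : realType) (d m : nat)
  (L : R -> O -> 'cV[R]_m) (f : R -> 'M[R[i]]_(d, m)) (n : nat)
  (s : nat -> R) (w : O) : 'cV[R[i]]_d :=
  \sum_(i < n) f (s i) *m cplx_mx (L (s i.+1) w - L (s i) w).

(* [Z] is a version of the integral of the (continuous) function [f] over
   [(a, b]]: the limit in probability of the step function integrals as the
   mesh of the partition tends to 0. *)
Definition levy_integral (dO : measure_display) (O : measurableType dO)
  (R : realType) (P : probability O R) (d m : nat) (L : R -> O -> 'cV[R]_m)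
  (f : R -> 'M[R[i]]_(d, m)) (a b : R) (Z : O -> 'cV[R[i]]_d) : Prop :=
  complex_random_vector Z /\
  forall e eta : R, 0 < e -> 0 < eta -> exists2 delta : R, 0 < delta &
    forall (n : nat) (s : nat -> R), partition_of a b n s ->
      (forall i, (i < n)%N -> s i.+1 - s i < delta) ->
      (P [set w | (e < cnorm (step_integral L f n s w - Z w))%R] < eta%:E)%E.

(* The integral over [(-oo, t]] is the limit in probability of the integrals
   over [(a, t]] as [a] tends to [-oo]. *)
Definition levy_integral_ninfty (dO : measure_display) (O : measurableType dO)
  (R : realType) (P : probability O R) (d m : nat) (L : R -> O -> 'cV[R]_m)
  (f : R -> 'M[R[i]]_(d, m)) (t : R) (Z : O -> 'cV[R[i]]_d) : Prop :=
  complex_random_vector Z /\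
  exists J : R -> O -> 'cV[R[i]]_d,
    (forall a, a <= t -> levy_integral P L f a t (J a)) /\
    (forall e : R, 0 < e ->
       P [set w | e < cnorm (J a w - Z w)] @[a --> -oo] --> 0%E).

(* [dX(t) = M X(t) dt + K dL(t)], in integrated form. *)
Definition solves_sde (dO : measure_display) (O : measurableType dO)
  (R : realType) (P : probability O R) (N m : nat) (M : 'M[R]_N)
  (K : 'M[R]_(N, m)) (L : R -> O -> 'cV[R]_m) (X : R -> O -> 'cV[R]_N) :
  Prop :=
  [/\ forall t, random_vector (X t), forall w, cadlag (fun t => X t w) &
      {ae P, forall w, forall s t : R, s <= t ->
         X t w - X s w =
         \col_i (\int[@lebesgue_measure R]_(u in `[s, t]) (M *m X u w) i 0)
         + K *m (L t w - L s w)}].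

(* [Y] is determined up to modification only, being built from stochastic
   integrals: the observation equation holds almost surely at each time. *)
Definition MCARMA (dO : measure_display) (O : measurableType dO)
  (R : realType) (P : probability O R) (d m p q : nat) (A : nat -> 'M[R]_d)
  (B : nat -> 'M[R]_(d, m)) (L : R -> O -> 'cV[R]_m) (Y : R -> O -> 'cV[R]_d) :
  Prop :=
  exists X, solves_sde P (state_A p A) (state_B p q A B) L X /\
    forall t, {ae P, forall w, Y t w = state_C R d p *m X t w}.

(* Main.v *)
Require Import Defs.
From HB Require Import structures.
From mathcomp Require Import all_boot all_order all_algebra.
From mathcomp Require Import fingroup perm complex.
From mathcomp Require Import all_classical all_reals all_analysis.
From mathcomp Require Import measurable_realfun.
From mathcomp Require Import zify ring lra.

Set Implicit Arguments.
Unset Strict Implicit.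
Unset Printing Implicit Defensive.

Import Order.TTheory GRing.Theory Num.Theory.
Import numFieldNormedType.Exports.

Local Open Scope classical_set_scope.
Local Open Scope ring_scope.
Local Open Scope complex_scope.


Lemma triangular_sum (V : zmodType) (F : nat -> nat -> V) (p : nat) :
  \sum_(1 <= i < p.+1) \sum_(0 <= k < p - i) F i k =
  \sum_(0 <= k < p) \sum_(1 <= i < k.+1) F i (k - i)%N.
Proof.
elim: p => [|p IH]; first by rewrite !big_geq.
rewrite [RHS]big_nat_recr //= -IH big_nat_recr //= subnn [X in _ + X]big_geq //.
rewrite addr0 -big_split /=; apply: eq_big_nat => i /andP[_ ip].
by rewrite subSn // big_nat_recr.
Qed.

Section Companion.
Variables (K : fieldType) (d m p : nat) (A : nat -> 'M[K]_d).
Implicit Types (z : K).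

Definition companion : 'M[K]_(\sum_(i < p) d) :=
  \mxblock_(i < p, j < p)
    (if (i.+1 == p)%N then - A (p - j)%N
     else if (j == i.+1 :> nat) then 1%:M else 0 : 'M[K]_d).

Definition first_block : 'M[K]_(d, \sum_(i < p) d) :=
  \mxrow_(j < p) (if (j == 0 :> nat) then 1%:M else 0 : 'M[K]_d).

Definition block (x : 'M[K]_(\sum_(i < p) d, m)) (i : nat) : 'M[K]_(d, m) :=
  if insub i is Some k then submxcol x k else 0.

Lemma blockE x (k : 'I_p) : block x k = submxcol x k.
Proof. by rewrite /block insubT //= => H; congr submxcol; apply/val_inj. Qed.

Lemma submxcol_companion x (k : 'I_p) :
  submxcol (companion *m x) k =
  if (k.+1 == p)%N then - \sum_(1 <= i < p.+1) A i *m block x (p - i)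
  else block x k.+1.
Proof.
rewrite -[x in LHS]submxcolK /companion mul_mxblock_mxrow mxcolK.
case: eqP => [kp|/eqP kp].
  rewrite -sumrN big_add1 /= big_nat_rev big_mkord /=.
  apply: eq_bigr => j _; rewrite add0n mulNmx.
  have -> : ((p - j.+1).+1 = p - j)%N by have := ltn_ord j; lia.
  by rewrite subKn ?blockE // ltnW.
have kp' : (k.+1 < p)%N by have := ltn_ord k; rewrite leq_eqVlt (negPf kp).
rewrite (bigD1 (Ordinal kp')) //= eqxx mul1mx big1 ?addr0.
  by rewrite -blockE.
by move=> j; rewrite -val_eqE /= => /negPf ->; rewrite mul0mx.
Qed.

Lemma mul_first_block x : first_block *m x = block x 0.
Proof.
rewrite -[x in LHS]submxcolK /first_block mul_mxrow_mxcol.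
rewrite /block; case: insubP => [k _ k0|np].
  rewrite (bigD1 k) //= k0 eqxx mul1mx big1 ?addr0 // => j.
  by rewrite -val_eqE /= k0 => /negPf ->; rewrite mul0mx.
by rewrite big1 // => j; move: np; have := ltn_ord j; lia.
Qed.

Lemma mxpoly_eval_ar z : mxpoly_eval (ar_poly p A) z =
  (z ^+ p)%:M + \sum_(1 <= i < p.+1) z ^+ (p - i) *: A i.
Proof.
apply/matrixP => i j; rewrite !mxE hornerD; congr (_ + _).
  by case: eqP => _; rewrite ?mulr1n ?mulr0n ?hornerXn ?horner0.
rewrite !summxE horner_sum; apply: eq_bigr => k _.
by rewrite !mxE hornerM hornerXn hornerC.
Qed.

Lemma companion_step z (x b : 'M[K]_(\sum_(i < p) d, m)) k :
  z *: x - companion *m x = b -> (k.+1 < p)%N ->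
  block x k.+1 = z *: block x k - block b k.
Proof.
move=> xb kp; pose o := Ordinal (ltnW kp).
have := congr1 (fun y => submxcol y o) xb.
rewrite submxcolB submxcol_companion /= ltn_eqF // => h.
have -> : block b k = submxcol b o by rewrite -blockE.
rewrite -h (_ : submxcol (z *: x) o = z *: block x k).
  by rewrite opprB addrC subrK.
have -> : block x k = submxcol x o by rewrite -blockE.
by apply/matrixP => i j; rewrite !mxE.
Qed.

(** The blocks of the solution [x] of [(z - M) x = b], [M] the companion matrix, are obtained from the first one by
    Horner recursion, and the last block row closes the recursion into
    [A(z) x_1]. *)
Lemma companion_resolvent z (x b : 'M[K]_(\sum_(i < p) d, m)) : (0 < p)%N ->
  z *: x - companion *m x = b ->
  mxpoly_eval (ar_poly p A) z *m block x 0 =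
  \sum_(0 <= k < p) z ^+ (p - k.+1) *:
    (block b k + \sum_(1 <= i < k.+1) A i *m block b (k - i)).
Proof.
move=> p0 xb.
have rec := companion_step xb.
have xk k : (k < p)%N -> z ^+ k *: block x 0 =
    block x k + \sum_(0 <= j < k) z ^+ (k - j.+1) *: block b j.
  elim: k => [|k IH] kp; first by rewrite big_nil expr0 scale1r addr0.
  rewrite exprS -scalerA IH ?(ltnW kp) // scalerDr big_nat_recr //=.
  rewrite subnn expr0 scale1r rec // [_ + block b k]addrC addrA subrK.
  congr (_ + _); rewrite scaler_sumr; apply: eq_big_nat => j /andP[_ jk].
  by rewrite scalerA -exprS; congr (_ ^+ _ *: _); lia.
have last : z *: block x p.-1 + \sum_(1 <= i < p.+1) A i *m block x (p - i) =
    block b p.-1.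
  have pp : (p.-1 < p)%N by rewrite prednK.
  pose o := Ordinal pp.
  have := congr1 (fun y => submxcol y o) xb.
  rewrite submxcolB submxcol_companion /= prednK // eqxx opprK => h.
  have -> : block b p.-1 = submxcol b o by rewrite -blockE.
  rewrite -h; congr (_ + _).
  have -> : block x p.-1 = submxcol x o by rewrite -blockE.
  by apply/matrixP => i j; rewrite !mxE.
rewrite mxpoly_eval_ar mulmxDl mul_scalar_mx mulmx_suml.
under eq_big_nat => i /andP[i1 ip].
  rewrite -scalemxAl scalemxAr xk; last by lia.
  rewrite mulmxDr; over.
rewrite big_split /=.
have -> : z ^+ p *: block x 0 = z *: block x p.-1 +
    \sum_(0 <= j < p.-1) z ^+ (p - j.+1) *: block b j.
  rewrite -{1}(prednK p0) exprS -scalerA xk ?prednK // scalerDr.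
  congr (_ + _); rewrite scaler_sumr; apply: eq_big_nat => j /andP[_ jp].
  by rewrite scalerA -exprS; congr (_ ^+ _ *: _); lia.
rewrite addrACA last addrA.
have -> : block b p.-1 + \sum_(0 <= j < p.-1) z ^+ (p - j.+1) *: block b j =
    \sum_(0 <= k < p) z ^+ (p - k.+1) *: block b k.
  have E : (p = p.-1.+1)%N by rewrite prednK.
  rewrite [X in _ = \sum_(0 <= k < X) _]E big_nat_recr //= addrC.
  by rewrite prednK // subnn expr0 scale1r.
under [RHS]eq_bigr do rewrite scalerDr.
rewrite [RHS]big_split /=; congr (_ + _).
under eq_bigr do rewrite mulmx_sumr.
under [RHS]eq_bigr do rewrite scaler_sumr.
rewrite triangular_sum; apply: eq_big_nat => k /andP[_ kp].
apply: eq_big_nat => i /andP[i1 ik].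
by rewrite -scalemxAr; congr (_ ^+ _ *: _); lia.
Qed.
End Companion.

Lemma mxpoly_eval_ma (K : fieldType) (d m q : nat) (B : nat -> 'M[K]_(d, m)) z :
  mxpoly_eval (ma_poly q B) z = \sum_(0 <= j < q.+1) z ^+ (q - j) *: B j.
Proof.
apply/matrixP => i j; rewrite !mxE !summxE horner_sum; apply: eq_bigr => k _.
by rewrite !mxE hornerM hornerXn hornerC.
Qed.

Lemma det_mxpoly_eval (K : fieldType) (d : nat) (M : 'M[{poly K}]_d) x :
  \det (mxpoly_eval M x) = (\det M).[x].
Proof. by rewrite -/(horner_eval x _) -det_map_mx. Qed.

Lemma mxpoly_evalM (K : fieldType) (d m n : nat) (M : 'M[{poly K}]_(d, m))
    (N : 'M[{poly K}]_(m, n)) x :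
  mxpoly_eval (M *m N) x = mxpoly_eval M x *m mxpoly_eval N x.
Proof. exact: (map_mxM (horner_eval x)). Qed.

(** An eigenvector of the companion matrix is a geometric progression of
    blocks, hence its first block is nonzero and is killed by [A(z)]. *)
Lemma companion_singular (K : fieldType) (d p : nat) (A : nat -> 'M[K]_d) z :
  (0 < p)%N -> \det (z%:M - companion p A) = 0 ->
  mxpoly_spectrum (ar_poly p A) z.
Proof.
move=> p0; rewrite -det_tr => /eqP/det0P[v v0 vM].
have xb : z *: v^T - companion p A *m v^T = 0.
  by rewrite -mul_scalar_mx -mulmxBl -[LHS]trmxK trmx_mul trmxK vM trmx0.
have b0 k : @block K d 1 p 0 k = 0.
  by rewrite /block; case: insubP => // *; rewrite submxcol0.
have := companion_resolvent p0 xb.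
rewrite [X in _ = X]big1; last first.
  move=> k _; rewrite b0 add0r big1 ?scaler0 // => i _.
  by rewrite b0 mulmx0.
move=> Av; rewrite /mxpoly_spectrum /= -det_tr; apply/eqP/det0P.
exists (block v^T 0)^T; last by rewrite -trmx_mul Av trmx0.
apply: contra_neq v0 => bv0; rewrite -[v]trmxK.
suff h k : (k < p)%N -> block v^T k = 0.
  rewrite (_ : v^T = 0) ?trmx0 //; apply/mxcolP => i.
  by rewrite -blockE submxcol0 h.
elim: k => [_|k IH kp]; first by rewrite -[LHS]trmxK bv0 trmx0.
by rewrite (companion_step xb) // IH ?(ltnW kp) // b0 scaler0 subr0.
Qed.

Section StateSpace.
Variables (R : realType) (d m p q : nat).
Variables (A : nat -> 'M[R]_d) (B : nat -> 'M[R]_(d, m)).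

Lemma cplx_state_A : cplx_mx (state_A p A) = companion p (cplx_coefs A).
Proof.
apply/matrixP => i j; rewrite !mxE; case: ifP => _; first by rewrite !mxE rmorphN.
by case: ifP => _; rewrite !mxE ?rmorph0 // rmorph_nat.
Qed.

Lemma cplx_state_C : cplx_mx (state_C R d p) = first_block R[i] d p.
Proof.
apply/matrixP => i j; rewrite !mxE.
by case: ifP => _; rewrite !mxE ?rmorph0 // rmorph_nat.
Qed.

Lemma block_state_B k : (k < p)%N ->
  block (cplx_mx (state_B p q A B)) k = cplx_mx (beta p q A B k.+1).
Proof.
move=> kp; rewrite (blockE _ (Ordinal kp)).
rewrite -[in RHS](_ : submxcol (state_B p q A B) (Ordinal kp) = beta p q A B k.+1).
  by apply/matrixP => i j; rewrite !mxE.
by rewrite mxcolK.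
Qed.

(** The coefficients [beta] are defined so that the state space model has
    transfer function [A(z)^-1 B(z)]. *)
Lemma transfer_function z : (q < p)%N ->
  ~ mxpoly_spectrum (ar_poly p (cplx_coefs A)) z ->
  mfd (ar_poly p (cplx_coefs A)) (ma_poly q (cplx_coefs B)) z =
  cplx_mx (state_C R d p) *m invmx (z%:M - cplx_mx (state_A p A))
    *m cplx_mx (state_B p q A B).
Proof.
move=> qp zA; have p0 : (0 < p)%N by apply: leq_ltn_trans qp.
have uM : z%:M - cplx_mx (state_A p A) \in unitmx.
  rewrite unitmxE unitfE cplx_state_A; apply/negP => /eqP.
  by move/(companion_singular p0).
have uA : mxpoly_eval (ar_poly p (cplx_coefs A)) z \in unitmx.
  by rewrite unitmxE unitfE; apply/negP => /eqP.
rewrite -mulmxA; set x := invmx (_ - _) *m cplx_mx (state_B p q A B).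
have xb : z *: x - companion p (cplx_coefs A) *m x = cplx_mx (state_B p q A B).
  by rewrite -mul_scalar_mx -mulmxBl -cplx_state_A mulKVmx.
rewrite cplx_state_C mul_first_block /mfd -/x.
rewrite -[RHS](mulKmx uA); congr (_ *m _).
rewrite (companion_resolvent p0 xb) mxpoly_eval_ma.
have pq1 : ((p - q).-1 <= p)%N by lia.
rewrite (big_cat_nat (leq0n _) pq1) /=.
rewrite [X in _ = X + _]big_nat [X in _ = X + _]big1 ?add0r; last first.
  move=> k /andP[_ kpq]; rewrite block_state_B ?beta0E; try lia.
  rewrite big_nat big1; first by rewrite /cplx_mx map_mx0 addr0 scaler0.
  move=> i /andP[i1 ik]; rewrite block_state_B ?beta0E; try lia.
  by rewrite /cplx_mx map_mx0 mulmx0.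
rewrite -{1}[(p - q).-1]add0n [RHS]big_addn.
have -> : (p - (p - q).-1 = q.+1)%N by lia.
apply: eq_big_nat => j /andP[_ jq].
congr (_ ^+ _ *: _); first by lia.
rewrite block_state_B; last by lia.
have E : ((j + (p - q).-1).+1 = p - (q - j))%N by lia.
rewrite {1}E betaE //; last by lia.
rewrite (_ : q - (q - j) = j)%N; last by lia.
rewrite /cplx_mx map_mxD map_mxN map_mx_sum -E addrAC [X in X + _](_ : _ = 0) ?add0r //.
apply/eqP; rewrite addrC subr_eq0; apply/eqP.
apply: eq_big_nat => i /andP[i1 ij].
rewrite block_state_B /cplx_mx; last by lia.
by rewrite map_mxM (_ : (_ - i).+1 = (j + (p - q).-1).+1 - i)%N //; lia.
Qed.

End StateSpace.

Section Disjoint.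

Lemma size_perturbed_det (K : fieldType) (d p : nat) (N : 'M[{poly K}]_d) :
  (0 < p)%N -> (forall i j, size (N i j) <= p)%N ->
  size (\det (('X^p)%:M + N)) = (d * p).+1 /\ \det (('X^p)%:M + N) \is monic.
Proof.
move=> p0 sN; set M := _ + _.
have sd i : size (M i i) = p.+1.
  by rewrite !mxE eqxx mulr1n size_polyDl size_polyXn ?ltnS.
have md i : M i i \is monic.
  by rewrite !mxE eqxx mulr1n monicE lead_coefDl ?size_polyXn ?ltnS ?lead_coefXn. 
have so i j : i != j -> (size (M i j) <= p)%N.
  by move=> ij; rewrite !mxE (negPf ij) mulr0n add0r.
have mP : \prod_i M i i \is monic by apply: monic_prod.
have sP : size (\prod_i M i i) = (d * p).+1.
  rewrite size_prod; last by move=> i _; rewrite monic_neq0.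
  under eq_bigr do rewrite sd.
  by rewrite sum_nat_const !card_ord mulnS subSn ?leq_addr // addnC addnK.
rewrite /determinant (bigD1 (1%g : {perm 'I_d})) //= odd_perm1 expr0 mul1r.
under eq_bigr do rewrite perm1.
set T := (X in _ + X).
have lt : (size T < (d * p).+1)%N.
  rewrite ltnS (leq_trans (size_sum _ _ _)) //.
  apply/bigmax_leqP => s s1.
  rewrite -(rmorph_sign (@polyC K)) size_Cmul ?signr_eq0 //.
  have [i si] : exists i, s i != i.
    apply/existsP; apply: contraR s1 => /existsPn h; apply/eqP/permP => i.
    by rewrite perm1; have /negPn/eqP := h i.
  rewrite (leq_trans (size_poly_prod_leq _ _)) // card_ord.
  rewrite (bigD1 i) //= leq_subLR.
  have : (\sum_(j < d | j != i) size (M j (s j)) <= \sum_(j < d | j != i) p.+1)%N.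
    apply: leq_sum => j _; have [->|h] := eqVneq (s j) j; first by rewrite sd.
    by rewrite (leq_trans (so _ _ _)) // eq_sym.
  have := so i (s i); rewrite eq_sym => /(_ si).
  rewrite sum_nat_const cardC1 card_ord.
  have d0 : (0 < d)%N by apply: leq_ltn_trans (ltn_ord i).
  have -> : (d * p = d.-1 * p + p)%N by rewrite -mulSnr prednK.
  rewrite mulnS; move: (d.-1 * p)%N d0 => e d0.
  move: (\sum_(j < d | j != i) _)%N (size (M i _)) => y x.
  by lia.
split; first by rewrite size_polyDl sP.
by rewrite monicE lead_coefDl ?sP // -monicE.
Qed.

Variables (K : closedFieldType) (d p : nat) (A : nat -> 'M[K]_d).

Lemma size_det_ar : (0 < p)%N ->
  size (\det (ar_poly p A)) = (d * p).+1 /\ \det (ar_poly p A) \is monic.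
Proof.
move=> p0; apply: size_perturbed_det => // i j.
rewrite summxE (leq_trans (size_sum _ _ _)) //.
apply/bigmax_leqP_seq => k; rewrite mem_index_iota => /andP[k1 kp] _.
rewrite !mxE mulrC mul_polyC (leq_trans (size_scale_leq _ _)) // size_polyXn.
by lia.
Qed.

(** Counting degrees: a regular solvent carries the whole multiplicity of its
    eigenvalues in [det A], so [det A] divides the product of the [p]
    characteristic polynomials of the solvents.  Both are monic of degree
    [d p], so they are equal, and no eigenvalue can be shared. *)
Lemma solvent_spectra_disjoint (S : 'I_p -> 'M[K]_d) (j k : 'I_p) z :
  complete_solvents A S -> (forall k, regular_solvent p A (S k)) ->
  j != k -> spectrum (S j) z -> ~ spectrum (S k) z.
Proof.
move=> [_ cS] rS jk zj zk.
have p0 : (0 < p)%N by apply: leq_ltn_trans (ltn_ord j).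
pose c l := char_poly (S l); set a := \det (ar_poly p A).
have [sa ma] := size_det_ar p0; rewrite -/a in sa ma.
have fac l : exists2 b, a = b * c l &
    forall x, root (c l) x -> ~~ root b x.
  have [_ [A1 [e dis]]] := rS l; exists (\det (ar_poly p.-1 A1)).
    by rewrite /a e det_mulmx.
  move=> x cx; apply/negP => /eqP bx.
  suff : (spectrum (S l) `&` mxpoly_spectrum (ar_poly p.-1 A1)) x by rewrite dis.
  split; first by rewrite /spectrum /= eigenvalue_root_char.
  by rewrite /mxpoly_spectrum /= det_mxpoly_eval.
have ax x : root a x -> exists l, root (c l) x.
  move=> /eqP rx; have : mxpoly_spectrum (ar_poly p A) x.
    by rewrite /mxpoly_spectrum /= det_mxpoly_eval.
  by rewrite cS => -[l _]; rewrite /spectrum /= eigenvalue_root_char; exists l.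
pose P := \prod_l c l.
have mP : P \is monic by apply: monic_prod => l _; apply: char_poly_monic.
have sP : size P = (d * p).+1.
  rewrite /P size_prod; last by move=> l _; rewrite monic_neq0 ?char_poly_monic.
  under eq_bigr do rewrite size_char_poly.
  by rewrite sum_nat_const !card_ord mulnS subSn ?leq_addr // addnC addnK mulnC.
have aP : a %| P.
  set g := gcdp a P; have /dvdpP[e ae] : g %| a by apply: dvdp_gcdl.
  have a0 : a != 0 by rewrite monic_neq0.
  have e0 : e != 0 by apply: contraNneq a0 => e0; rewrite ae e0 mul0r.
  have [se|/closed_rootP[x ex]] := eqVneq (size e) 1.
    have /size_poly1P[u u0 eu] : size e == 1 by rewrite se.
    by rewrite ae eu mul_polyC dvdpZl // dvdp_gcdr.
  have [l cx] : exists l, root (c l) x by apply: ax; rewrite ae rootM ex.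
  have [b ab nb] := fac l; have /dvdpP[g' gg] : c l %| g.
    by rewrite dvdp_gcd {1}ab dvdp_mull //= /P (bigD1 l) //= dvdp_mulr.
  have c0 : c l != 0 by rewrite monic_neq0 ?char_poly_monic.
  have /(mulIf c0) be : b * c l = e * g' * c l by rewrite -ab -mulrA -gg.
  by have := nb _ cx; rewrite be rootM ex.
have eaP : a = P.
  apply/eqP; rewrite -eqp_monic // -dvdp_size_eqp //; last by rewrite sa sP.
have [b ab nb] := fac k.
have zck : root (c k) z by rewrite -eigenvalue_root_char.
have zcj : root (c j) z by rewrite -eigenvalue_root_char.
have c0 : c k != 0 by rewrite monic_neq0 ?char_poly_monic.
have /(mulIf c0) bE : b * c k = (\prod_(l | l != k) c l) * c k.
  by rewrite -ab eaP /P (bigD1 k) //= mulrC.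
by have := nb _ zck; rewrite bE (bigD1 j) //= rootM zcj.
Qed.

End Disjoint.


Section Segment.
Variable R : realType.
Local Notation mu := (@lebesgue_measure R).
Implicit Types (a b c : R) (f g : R -> R).

Definition intg a b f := mu.-integrable `]a, b] (EFin \o f).
Definition Int a b f : R := (\int[mu]_(x in `]a, b]) f x)%R.

Lemma intg_cc a b f : a <= b ->
  mu.-integrable `[a, b] (EFin \o f) <-> intg a b f.
Proof.
move=> ab; split; first by apply: integrableS => //; apply: subset_itv_oc_cc.
move=> h; have mf : measurable_fun `[a, b] f.
  rewrite -(@setU1itv _ R (BRight b) a false) ?bnd_simp //=; apply/measurable_funU => //.
  split; first exact: measurable_fun_set1.
  by apply/measurable_EFinP; apply: measurable_int h.
move/measurable_EFinP in mf.
have [//|//|_] := @negligible_integrable _ _ _ mu _ [set a] _ _ _ mf (lebesgue_measure_set1 a).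
by apply; rewrite setDitv1l.
Qed.

Lemma Int_cc a b f : intg a b f ->
  (\int[mu]_(x in `[a, b]) f x)%R = Int a b f.
Proof. by move=> h; rewrite /Int Rintegral_itv_obnd_cbnd. Qed.

Lemma intg_oo a b f : mu.-integrable `]a, b[ (EFin \o f) -> intg a b f.
Proof.
have [ab|ba] := ltP a b; last first.
  by move=> _; rewrite /intg set_itv_ge ?bnd_simp -?leNgt //; exact: integrable_set0.
move=> h; have mf : measurable_fun `]a, b] f.
  rewrite -(@setUitv1 _ R (BRight a) b true) ?bnd_simp //=; apply/measurable_funU => //.
  split; last exact: measurable_fun_set1.
  by apply/measurable_EFinP; apply: measurable_int h.
move/measurable_EFinP in mf.
have [//|//|_] := @negligible_integrable _ _ _ mu _ [set b] _ _ _ mf (lebesgue_measure_set1 b).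
by apply; rewrite setDitv1r.
Qed.

Lemma intg_eq a b f g : (forall u, a < u < b -> f u = g u) ->
  intg a b f -> intg a b g.
Proof.
move=> fg fi; apply: intg_oo.
apply: (@eq_integrable _ _ _ mu _ _ (EFin \o f)) => //.
  by move=> u; rewrite inE /= in_itv /= => h; rewrite fg.
by apply: integrableS fi => //; apply: subset_itvl; rewrite bnd_simp.
Qed.

Lemma Int_eq a b f g : (forall u, a < u < b -> f u = g u) ->
  intg a b f -> Int a b f = Int a b g.
Proof.
move=> fg fi; have gi := intg_eq fg fi.
rewrite /Int -Rintegral_itv_bndo_bndc; last first.
  by apply: integrableS fi => //; apply: subset_itvl; rewrite bnd_simp.
rewrite -[RHS]Rintegral_itv_bndo_bndc; last first.
  by apply: integrableS gi => //; apply: subset_itvl; rewrite bnd_simp.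
by apply: eq_Rintegral => u; rewrite inE /= in_itv /= => h; rewrite fg.
Qed.

Lemma itv_ocU a b c : a <= b -> b <= c ->
  [set` `]a, c]] = [set` `]a, b]] `|` [set` `]b, c]] :> set R.
Proof.
move=> ab bc; apply/seteqP; split => u /=; rewrite !in_itv /=.
  move=> /andP[au uc]; have [ub|bu] := leP u b; [left|right].
    by rewrite au.
  by rewrite uc.
move=> [/andP[au ub]|/andP[bu uc]].
  by rewrite au (le_trans ub).
by rewrite uc (le_lt_trans ab).
Qed.

Lemma itv_oc_disj a b c : [disjoint [set` `]a, b]] & [set` `]b, c]] : set R].
Proof.
apply/disj_setPS => u /= [] ; rewrite !in_itv /= => /andP[_ ub] /andP[bu _].
by move: (lt_le_trans bu ub); rewrite ltxx.
Qed.

Lemma intg_split a b c f : a <= b -> b <= c ->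
  intg a b f -> intg b c f -> intg a c f.
Proof.
move=> ab bc i1 i2; rewrite /intg (itv_ocU ab bc).
have /integrableP[m1 l1] := i1; have /integrableP[m2 l2] := i2.
have mf : measurable_fun ([set` `]a, b]] `|` [set` `]b, c]] : set R) f.
  by apply/measurable_funU => //; split; apply/measurable_EFinP.
move/measurable_EFinP in mf.
apply/integrableP; split => //.
rewrite ge0_integral_setU //; first exact: lte_add_pinfty.
  exact: measurableT_comp.
exact: itv_oc_disj.
Qed.

Lemma intg_sub a b c e f : a <= c -> e <= b -> intg a b f -> intg c e f.
Proof.
move=> ac eb; apply: integrableS => //.
by apply: subset_itv; rewrite bnd_simp.
Qed.

Lemma Int_split a b c f : a <= b -> b <= c -> intg a c f ->
  Int a c f = Int a b f + Int b c f.
Proof.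
move=> ab bc i; rewrite /Int (itv_ocU ab bc) Rintegral_setU //.
  by rewrite -itv_ocU.
exact: itv_oc_disj.
Qed.

Lemma Int_ge a b f : b <= a -> Int a b f = 0.
Proof.
by move=> ba; rewrite /Int set_itv_ge ?bnd_simp -?leNgt // Rintegral_set0.
Qed.

Lemma intg_cont a b f : {in `[a, b], continuous f} -> intg a b f.
Proof.
have [ab|ba] := leP a b; last first.
  by move=> _; rewrite /intg set_itv_ge ?bnd_simp -?leNgt // ?ltW//; exact: integrable_set0.
move=> cf; apply/intg_cc => //; apply: continuous_compact_integrable.
  exact: segment_compact.
apply: continuous_in_subspaceT => u; rewrite inE => h.
exact: cf.
Qed.

Lemma intgD a b f g : intg a b f -> intg a b g -> intg a b (fun u => f u + g u).
Proof. by move=> fi gi; apply: (integrableD _ fi gi). Qed.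

Lemma IntD a b f g : intg a b f -> intg a b g ->
  Int a b (fun u => f u + g u) = Int a b f + Int a b g.
Proof. by move=> fi gi; rewrite /Int RintegralD. Qed.

Lemma intgZ a b k f : intg a b f -> intg a b (fun u => k * f u).
Proof. by move=> fi; apply: (integrableZl _ k fi). Qed.

Lemma IntZ a b k f : intg a b f -> Int a b (fun u => k * f u) = k * Int a b f.
Proof. by move=> fi; rewrite /Int RintegralZl. Qed.

Lemma intgN a b f : intg a b f -> intg a b (fun u => - f u).
Proof.
move=> fi; rewrite (_ : (fun u => - f u) = (fun u => -1 * f u)); first exact: intgZ.
by apply/funext => u; rewrite mulN1r.
Qed.

Lemma IntN a b f : intg a b f -> Int a b (fun u => - f u) = - Int a b f.
Proof.
move=> fi; rewrite -mulN1r -IntZ //.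
by congr Int; apply/funext => u; rewrite mulN1r.
Qed.

Lemma intgB a b f g : intg a b f -> intg a b g -> intg a b (fun u => f u - g u).
Proof. by move=> fi gi; apply: (integrableB _ fi gi). Qed.

Lemma IntB a b f g : intg a b f -> intg a b g ->
  Int a b (fun u => f u - g u) = Int a b f - Int a b g.
Proof. by move=> fi gi; rewrite /Int RintegralB. Qed.

Lemma Int_le a b f g : intg a b f -> intg a b g ->
  (forall u, a < u <= b -> f u <= g u) -> Int a b f <= Int a b g.
Proof.
move=> fi gi fg; by apply: le_Rintegral.
Qed.

Lemma intg_abs a b f : intg a b f -> intg a b (fun u => `|f u|).
Proof. by move=> fi; apply: (integrable_norm fi). Qed.

Lemma Int_abs a b f : intg a b f -> `|Int a b f| <= Int a b (fun u => `|f u|).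
Proof. by move=> fi; apply: le_normr_Rintegral. Qed.

Lemma intg_cst a b k : intg a b (fun=> k).
Proof. by apply: intg_cont => u _; exact: cst_continuous. Qed.

Lemma Int_cst a b k : a <= b -> Int a b (fun=> k) = k * (b - a).
Proof.
move=> ab; rewrite /Int Rintegral_cst //= lebesgue_measure_itv /= lte_fin.
case: ltP => //= ba; rewrite (_ : a = b) ?subrr ?mulr0 //.
by apply/eqP; rewrite eq_le ab ba.
Qed.

Lemma Int_bound a b f M : a <= b -> intg a b f ->
  (forall u, a < u <= b -> `|f u| <= M) -> `|Int a b f| <= M * (b - a).
Proof.
move=> ab fi fM; rewrite (le_trans (Int_abs fi)) // -Int_cst //.
by apply: Int_le => //; [exact: intg_abs|exact: intg_cst].
Qed.

Lemma Int_FTC a b f F : a <= b -> {in `[a, b], continuous f} ->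
  (forall u, a <= u <= b -> is_derive u 1 F (f u)) ->
  Int a b f = F b - F a.
Proof.
rewrite le_eqVlt => /predU1P[->|ab] cf dF.
  by rewrite Int_ge // subrr.
have cF u : a <= u <= b -> {for u, continuous F}.
  move=> uab; apply: differentiable_continuous; apply/derivable1_diffP.
  by have [] := dF u uab.
rewrite -Int_cc; last exact: intg_cont.
rewrite /Rintegral (@continuous_FTC2 _ _ F) //.
- by apply: continuous_in_subspaceT => u; rewrite inE; exact: cf.
- split.
  + by move=> u; rewrite in_itv /= => /andP[/ltW au /ltW ub]; have [] := dF u; rewrite ?au.
  + by apply: cvg_at_right_filter; apply: cF; rewrite lexx ltW.
  + by apply: cvg_at_left_filter; apply: cF; rewrite lexx ltW.
- move=> u; rewrite in_itv /= => /andP[/ltW au /ltW ub].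
  by rewrite derive1E; have [] := dF u; rewrite ?au.
Qed.

Lemma Int_dominated a b (f_ : nat -> R -> R) f M :
  (forall n, intg a b (f_ n)) ->
  (forall n u, a < u <= b -> `|f_ n u| <= M) ->
  (forall u, a < u <= b -> f_ n u @[n --> \oo] --> f u) ->
  intg a b f /\ Int a b (f_ n) @[n --> \oo] --> Int a b f.
Proof.
move=> fi fM ff.
have mf_ n := measurable_int _ (fi n).
have ff' u : `]a, b]%classic u -> (EFin \o f_ n) u @[n --> \oo] --> (f u)%:E.
  rewrite /= in_itv /= => h; apply: cvg_comp (ff u h) _ => //.
have mf : measurable_fun `]a, b] f.
  by apply/measurable_EFinP; apply: (emeasurable_fun_cvg (fun n => EFin \o f_ n)).
move/measurable_EFinP in mf.
have Mi : mu.-integrable `]a, b] (EFin \o cst M) by apply: intg_cst.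
have [] := @dominated_convergence _ _ _ mu _ _ _ (EFin \o f) (EFin \o cst M) mf_ mf _ Mi.
- by [].
- by apply: aeW.
- by apply: aeW => u n; rewrite /= in_itv /= lee_fin => h; apply: fM.
move=> i _ c; split => //.
rewrite /Int /Rintegral; apply: fine_cvg.
by rewrite fineK //; apply: integrable_fin_num.
Qed.

End Segment.


Section ComplexCurves.
Variable R : realType.
Local Notation C := R[i].
Implicit Types (f g : R -> C) (u : R).

Definition cderiv f u (l : C) : Prop :=
  is_derive u 1 (fun s => complex.Re (f s)) (complex.Re l) /\
  is_derive u 1 (fun s => complex.Im (f s)) (complex.Im l).

Definition ccont f u : Prop :=
  {for u, continuous (fun s => complex.Re (f s))} /\
  {for u, continuous (fun s => complex.Im (f s))}.

Lemma is_derive_cont (h : R -> R) u l : is_derive u 1 h l -> {for u, continuous h}.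
Proof.
by case=> dh _; apply: differentiable_continuous; apply/derivable1_diffP.
Qed.

Lemma cderiv_cont f u l : cderiv f u l -> ccont f u.
Proof. by move=> [/is_derive_cont cr /is_derive_cont ci]; split. Qed.

Lemma cReD (x y : C) : complex.Re (x + y) = complex.Re x + complex.Re y.
Proof. by case: x; case: y. Qed.
Lemma cImD (x y : C) : complex.Im (x + y) = complex.Im x + complex.Im y.
Proof. by case: x; case: y. Qed.
Lemma cReN (x : C) : complex.Re (- x) = - complex.Re x.
Proof. by case: x. Qed.
Lemma cImN (x : C) : complex.Im (- x) = - complex.Im x.
Proof. by case: x. Qed.
Lemma cReM (x y : C) : complex.Re (x * y) =
  complex.Re x * complex.Re y - complex.Im x * complex.Im y.
Proof. by case: x; case: y. Qed.
Lemma cImM (x y : C) : complex.Im (x * y) =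
  complex.Re x * complex.Im y + complex.Im x * complex.Re y.
Proof. by case: x => a b; case: y => c d /=. Qed.
Lemma complex_ext (x y : C) : complex.Re x = complex.Re y ->
  complex.Im x = complex.Im y -> x = y.
Proof. by case: x => a b; case: y => c d /= -> ->. Qed.

Lemma cderivD f g u l k : cderiv f u l -> cderiv g u k ->
  cderiv (fun s => f s + g s) u (l + k).
Proof.
move=> [fr fi] [gr gi]; split.
  rewrite (_ : (fun s => _) =
    (fun s => complex.Re (f s)) + (fun s => complex.Re (g s))).
    by apply: is_derive_eq; rewrite cReD.
  by apply/funext => s; rewrite cReD.
rewrite (_ : (fun s => _) =
    (fun s => complex.Im (f s)) + (fun s => complex.Im (g s))).
  by apply: is_derive_eq; rewrite cImD.
by apply/funext => s; rewrite cImD.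
Qed.

Lemma cderivM f g u l k : cderiv f u l -> cderiv g u k ->
  cderiv (fun s => f s * g s) u (l * g u + f u * k).
Proof.
move=> [fr fi] [gr gi]; split.
  rewrite (_ : (fun s => _) =
    (fun s => complex.Re (f s)) * (fun s => complex.Re (g s)) -
    (fun s => complex.Im (f s)) * (fun s => complex.Im (g s))).
    by apply: is_derive_eq; rewrite cReD !cReM /GRing.scale /=; ring.
  by apply/funext => s; rewrite cReM.
rewrite (_ : (fun s => _) =
    (fun s => complex.Re (f s)) * (fun s => complex.Im (g s)) +
    (fun s => complex.Im (f s)) * (fun s => complex.Re (g s))).
  by apply: is_derive_eq; rewrite cImD !cImM /GRing.scale /=; ring.
by apply/funext => s; rewrite cImM.
Qed.

Lemma cderiv_cst (c : C) u : cderiv (fun=> c) u 0.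
Proof. by split; apply: is_derive_cst. Qed.

Lemma ccontM f g u : ccont f u -> ccont g u -> ccont (fun s => f s * g s) u.
Proof.
move=> [fr fi] [gr gi]; split.
  rewrite (_ : (fun s => _) = fun s => complex.Re (f s) * complex.Re (g s) -
    complex.Im (f s) * complex.Im (g s)); last by apply/funext => s; rewrite cReM.
  by apply: cvgB; apply: cvgM.
rewrite (_ : (fun s => _) = fun s => complex.Re (f s) * complex.Im (g s) +
    complex.Im (f s) * complex.Re (g s)); last by apply/funext => s; rewrite cImM.
by apply: cvgD; apply: cvgM.
Qed.

Definition sqnorm (x : C) : R := complex.Re x ^+ 2 + complex.Im x ^+ 2.

Lemma sqnorm_eq0 x : (sqnorm x == 0) = (x == 0).
Proof.
case: x => a b; rewrite /sqnorm /= paddr_eq0 ?sqr_ge0 // !sqrf_eq0.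
by rewrite eq_complex.
Qed.

Lemma invCE (x : C) :
  x^-1 = (complex.Re x / sqnorm x) +i* (- (complex.Im x / sqnorm x)).
Proof. by case: x => a b; rewrite /GRing.inv /= /sqnorm /= -mulNr. Qed.

Lemma cderivV f u l : f u != 0 -> cderiv f u l ->
  cderiv (fun s => (f s)^-1) u (- l / (f u) ^+ 2).
Proof.
move=> f0 [fr fi]; pose N := (fun s => complex.Re (f s)) ^+ 2 +
  (fun s => complex.Im (f s)) ^+ 2 : R -> R.
have NE s : N s = sqnorm (f s) by [].
have N0 : N u != 0 by rewrite NE sqnorm_eq0.
have dN : is_derive u 1 N (complex.Re (f u) * complex.Re l *+ 2 +
                          complex.Im (f u) * complex.Im l *+ 2).
  by apply: is_derive_eq; rewrite /GRing.scale /= !expr1; ring.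
have dV := is_deriveV N0 dN.
have lE : - l / (f u) ^+ 2 = - l * (((f u)^-1) * (f u)^-1).
  by rewrite expr2 invfM.
rewrite lE invCE -NE; clear lE.
have vN : (N u)^-1 * sqnorm (f u) = 1 by rewrite -NE mulVf.
split.
  rewrite (_ : (fun s => _) = (fun s => complex.Re (f s)) * (fun s => (N s)^-1)).
    apply: is_derive_eq; rewrite !(cReM, cImM, cReN, cImN) /GRing.scale /= -exprVn.
    apply/eqP; rewrite -subr_eq0; apply/eqP; move: vN.
    rewrite /sqnorm; move: (N u)^-1 => v vN.
    rewrite [LHS](_ : _ = (1 - v * (complex.Re (f u) ^+ 2 + complex.Im (f u) ^+ 2))
      * (v * complex.Re l)); first by rewrite vN subrr mul0r.
    by ring.
  by apply/funext => s; rewrite invCE.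
rewrite (_ : (fun s => _) = - ((fun s => complex.Im (f s)) * (fun s => (N s)^-1))).
  apply: is_derive_eq; rewrite !(cReM, cImM, cReN, cImN) /GRing.scale /= -exprVn.
  apply/eqP; rewrite -subr_eq0; apply/eqP; move: vN.
  rewrite /sqnorm; move: (N u)^-1 => v vN.
  rewrite [LHS](_ : _ = - (1 - v * (complex.Re (f u) ^+ 2 + complex.Im (f u) ^+ 2))
    * (v * complex.Im l)); first by rewrite vN subrr oppr0 mul0r.
  by ring.
by apply/funext => s; rewrite invCE.
Qed.

End ComplexCurves.


Section Contour.
Variable R : realType.
Local Notation C := R[i].
Local Notation nrm := (@Normc.normc R).
Implicit Types (h k H : C -> C) (w z : C).

Lemma normc_sq (x : C) : nrm x ^+ 2 = sqnorm x.
Proof. by case: x => a b /=; rewrite sqr_sqrtr // addr_ge0 ?sqr_ge0. Qed.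

Lemma normc_ge0 (x : C) : 0 <= nrm x.
Proof. by case: x => a b /=; rewrite sqrtr_ge0. Qed.

Lemma abs_Re_le (x : C) : `|complex.Re x| <= nrm x.
Proof.
rewrite -(ler_pXn2r (n := 2)) ?nnegrE ?normc_ge0 // normc_sq real_normK ?num_real //.
by rewrite lerDl sqr_ge0.
Qed.

Lemma abs_Im_le (x : C) : `|complex.Im x| <= nrm x.
Proof.
rewrite -(ler_pXn2r (n := 2)) ?nnegrE ?normc_ge0 // normc_sq real_normK ?num_real //.
by rewrite lerDr sqr_ge0.
Qed.

Lemma normc_le (x : C) : nrm x <= `|complex.Re x| + `|complex.Im x|.
Proof.
rewrite -(ler_pXn2r (n := 2)) ?nnegrE ?normc_ge0 ?addr_ge0 // normc_sq sqrrD.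
rewrite !real_normK ?num_real // /sqnorm addrAC lerDl mulrn_wge0 ?mulr_ge0 //.
Qed.

Lemma normcX (x : C) n : nrm (x ^+ n) = nrm x ^+ n.
Proof.
by elim: n => [|n IH]; rewrite ?expr0 ?Normc.normc1 // !exprS Normc.normcM IH.
Qed.

Lemma normc_sub (x y : C) : nrm (x - y) = nrm (y - x).
Proof. by rewrite -normcN opprB. Qed.

(** Complex differentiability, expressed through the chain rule along curves:
    the only form in which it is used under a contour integral. *)
Definition cdiff (h : C -> C) (w h' : C) : Prop :=
  forall (f : R -> C) u l, f u = w -> cderiv f u l ->
    cderiv (fun s => h (f s)) u (h' * l).

Lemma cdiff_cst (c : C) w : cdiff (fun=> c) w 0.
Proof. by move=> f u l _ _; rewrite mul0r; apply: cderiv_cst. Qed.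

Lemma cdiff_id w : cdiff id w 1.
Proof. by move=> f u l _ h; rewrite mul1r. Qed.

Lemma cdiffD h k w (h' k' : C) : cdiff h w h' -> cdiff k w k' ->
  cdiff (fun x => h x + k x) w (h' + k').
Proof.
by move=> dh dk f u l fu df; rewrite mulrDl; apply: cderivD; [exact: dh|exact: dk].
Qed.

Lemma cdiffM h k w (h' k' : C) : cdiff h w h' -> cdiff k w k' ->
  cdiff (fun x => h x * k x) w (h' * k w + h w * k').
Proof.
move=> dh dk f u l fu df; have := cderivM (dh _ _ _ fu df) (dk _ _ _ fu df).
by rewrite /= fu mulrDl -!mulrA (mulrC l).
Qed.

Lemma cdiffV h w (h' : C) : h w != 0 -> cdiff h w h' ->
  cdiff (fun x => (h x)^-1) w (- h' / h w ^+ 2).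
Proof.
move=> h0 dh f u l fu df.
have hf0 : h (f u) != 0 by rewrite fu.
have := cderivV hf0 (dh f u l fu df); rewrite fu.
by rewrite (_ : - (h' * l) / _ = - h' / h w ^+ 2 * l) //; ring.
Qed.

Definition cdiffable h w := exists h' : C, cdiff h w h'.

Lemma cdiffableD h k w : cdiffable h w -> cdiffable k w ->
  cdiffable (fun x => h x + k x) w.
Proof. by move=> [? ?] [? ?]; eexists; apply: cdiffD; eassumption. Qed.
Lemma cdiffableM h k w : cdiffable h w -> cdiffable k w ->
  cdiffable (fun x => h x * k x) w.
Proof. by move=> [? ?] [? ?]; eexists; apply: cdiffM; eassumption. Qed.
Lemma cdiffableV h w : h w != 0 -> cdiffable h w ->
  cdiffable (fun x => (h x)^-1) w.
Proof. by move=> ? [? ?]; eexists; apply: cdiffV; eassumption. Qed.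
Lemma cdiffable_cst (c : C) w : cdiffable (fun=> c) w.
Proof. by exists 0; apply: cdiff_cst. Qed.
Lemma cdiffable_id w : cdiffable id w.
Proof. by exists 1; apply: cdiff_id. Qed.

Lemma cdiffX h w (h' : C) n : cdiff h w h' ->
  cdiff (fun x => h x ^+ n.+1) w (n.+1%:R * h w ^+ n * h').
Proof.
move=> dh; elim: n => [|n IH].
  rewrite expr0 mulr1 mul1r.
  by rewrite (_ : (fun x => _) = h) //; apply/funext => x; rewrite expr1.
rewrite (_ : (fun x => _) = (fun x => h x * h x ^+ n.+1)); last first.
  by apply/funext => x; rewrite exprS.
rewrite (_ : _ * h' = h' * h w ^+ n.+1 + h w * (n.+1%:R * h w ^+ n * h')).
  exact: cdiffM.
by rewrite -[n.+2%:R]natr1 exprS; ring.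
Qed.

Lemma cdiffable_sum (I : Type) (r : seq I) (h : I -> C -> C) w :
  (forall i, cdiffable (h i) w) -> cdiffable (fun x => \sum_(i <- r) h i x) w.
Proof.
move=> dh; elim: r => [|i r IH].
  by rewrite (_ : (fun x => _) = fun=> 0); [exact: cdiffable_cst|apply/funext => x; rewrite big_nil].
rewrite (_ : (fun x => _) = fun x => h i x + \sum_(i <- r) h i x).
  exact: cdiffableD.
by apply/funext => x; rewrite big_cons.
Qed.

Lemma cdiffable_prod (I : eqType) (r : seq I) (h : I -> C -> C) w :
  (forall i, i \in r -> cdiffable (h i) w) ->
  cdiffable (fun x => \prod_(i <- r) h i x) w.
Proof.
elim: r => [|i r IH] dh.
  by rewrite (_ : (fun x => _) = fun=> 1); [exact: cdiffable_cst|apply/funext => x; rewrite big_nil].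
rewrite (_ : (fun x => _) = fun x => h i x * \prod_(i <- r) h i x).
  apply: cdiffableM; first by apply: dh; rewrite mem_head.
  by apply: IH => j jr; apply: dh; rewrite inE jr orbT.
by apply/funext => x; rewrite big_cons.
Qed.

Lemma cdiffable_poly (n : {poly C}) w : cdiffable (fun x => n.[x]) w.
Proof.
elim/poly_ind: n => [|n c IH].
  by rewrite (_ : (fun x => _) = fun=> 0); [exact: cdiffable_cst|apply/funext => x; rewrite horner0].
rewrite (_ : (fun x => _) = fun x => n.[x] * x + c).
  apply: cdiffableD; last exact: cdiffable_cst.
  by apply: cdiffableM => //; exact: cdiffable_id.
by apply/funext => x; rewrite !hornerE.
Qed.

(** The pieces are indexed by the parameter intervals, each being the
    restriction of a curve differentiable on the whole line; this is how the
    contour integral gets computed. *)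
Definition smooth_piece (g : R -> C) (a b : R) : Prop :=
  a < b /\ exists f f' : R -> C,
    [/\ forall u, a <= u <= b -> g u = f u,
        forall u, cderiv f u (f' u), forall u, ccont f' u &
        forall u, a < u < b -> velocity g u = f' u].

Lemma piecewise_smooth (g : R -> C) : piecewise_C1 g ->
  exists (n : nat) (s : nat -> R), [/\ s 0%N = 0, s n = 1 &
    forall i, (i < n)%N -> smooth_piece g (s i) (s i.+1)].
Proof.
move=> [n [s [s0 s1 sP]]]; exists n, s; split => // i /sP[lt [x [y [[dx cx] [dy cy] gxy]]]].
split => //; exists (fun u => x u +i* y u), (fun u => derive1 x u +i* derive1 y u).
have gE u : s i <= u <= s i.+1 -> g u = x u +i* y u by move=> h; apply: gxy; rewrite in_itv.
split => //.
- move=> u; split => /=.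
    by apply: DeriveDef => //; rewrite derive1E.
  by apply: DeriveDef => //; rewrite derive1E.
- by move=> u; split; [exact: cx|exact: cy].
- move=> u /andP[su us]; rewrite /velocity !derive1E.
  have nE : \near u, g u = x u +i* y u.
    near=> v; apply: gE; apply/andP; split; apply: ltW; near: v.
      exact: lt_nbhsr.
    exact: lt_nbhsl.
  congr (_ +i* _); apply: near_eq_derive.
    by near=> v; rewrite (near nE v).
  by near=> v; rewrite (near nE v).
Unshelve. all: by end_near. Qed.

Section OneContour.
Variable g : R -> C.
Hypothesis gP : piecewise_C1 g.

Let reg h := forall w, curve g w -> cdiffable h w.
Let fRe h u := complex.Re (h (g u) * velocity g u).
Let fIm h u := complex.Im (h (g u) * velocity g u).

Lemma piece_curve a b u : 0 <= a -> b <= 1 -> a <= u <= b -> curve g (g u).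
Proof.
move=> a0 b1 /andP[au ub]; exists u => //=.
by rewrite in_itv /= (le_trans a0) // (le_trans ub).
Qed.

Lemma pieces_le n (s : nat -> R) : s 0%N = 0 -> s n = 1 ->
  (forall i, (i < n)%N -> smooth_piece g (s i) (s i.+1)) ->
  forall i, (i <= n)%N -> 0 <= s i <= 1.
Proof.
move=> s0 s1 sP.
have le0 i : (i <= n)%N -> 0 <= s i.
  elim: i => [|i IH] h; first by rewrite s0.
  by have [/ltW + _] := sP i h; apply: le_trans; apply: IH; apply: ltnW.
have le1 i : (i <= n)%N -> s (n - i)%N <= 1.
  elim: i => [|i IH] h; first by rewrite subn0 s1.
  have h' : (n - i.+1 < n)%N by rewrite ltn_subrL /= (leq_trans _ h).
  have [/ltW + _] := sP _ h'; rewrite -subSn // subSS => /le_trans; apply.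
  by apply: IH; apply: ltnW.
by move=> i h; rewrite le0 //= -(subKn h) le1 // leq_subr.
Qed.

Lemma piece_integrand h a b : reg h -> 0 <= a -> b <= 1 -> smooth_piece g a b ->
  intg a b (fRe h) /\ intg a b (fIm h).
Proof.
move=> rh a0 b1 [ab [f [f' [gf df cf' vf]]]].
have ch u : u \in `[a, b] -> ccont (fun v => h (f v) * f' v) u.
  rewrite in_itv /= => uab; apply: ccontM => //.
  have [l dl] : cdiffable h (f u) by apply: rh; rewrite -gf //; apply: piece_curve uab.
  exact: (cderiv_cont (dl f u _ (erefl _) (df u))).
have E u : a < u < b -> h (f u) * f' u = h (g u) * velocity g u.
  by move=> uab; rewrite vf // gf //; case/andP: uab => /ltW -> /ltW.
split.
  apply: intg_eq (intg_cont (f := fun v => complex.Re (h (f v) * f' v)) _).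
    by move=> u /E; rewrite /fRe => ->.
  by move=> u /ch[].
apply: intg_eq (intg_cont (f := fun v => complex.Im (h (f v) * f' v)) _).
  by move=> u /E; rewrite /fIm => ->.
by move=> u /ch[].
Qed.

Lemma integrand_intg h : reg h -> intg 0 1 (fRe h) /\ intg 0 1 (fIm h).
Proof.
move=> rh; have [n [s [s0 s1 sP]]] := piecewise_smooth gP.
have s01 := pieces_le s0 s1 sP.
suff K (k : nat) : (k <= n)%N -> intg (s 0%N) (s k) (fRe h) /\ intg (s 0%N) (s k) (fIm h).
  by have := K n; rewrite s0 s1; apply.
elim: k => [_|k IH kn].
  by split; rewrite /intg set_itv_ge ?bnd_simp ?ltxx //; exact: integrable_set0.
have [i1 i2] := IH (ltnW kn).
have /andP[sk0 _] := s01 _ (ltnW kn); have /andP[_ sk1] := s01 _ kn.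
have [j1 j2] := piece_integrand rh sk0 sk1 (sP _ kn).
have [/ltW skk _] := sP _ kn.
by split; apply: intg_split; try eassumption; rewrite s0.
Qed.

Lemma contour_intE h : reg h ->
  contour_int g h = Int 0 1 (fRe h) +i* Int 0 1 (fIm h).
Proof.
move=> /integrand_intg[i1 i2]; rewrite /contour_int.
by congr (_ +i* _); apply: Int_cc.
Qed.

Lemma eq_contour_int h k : (forall w, curve g w -> h w = k w) ->
  contour_int g h = contour_int g k.
Proof.
move=> hk; rewrite /contour_int.
by congr (_ +i* _); apply: eq_Rintegral => u; rewrite inE /= => u01;
  rewrite hk //; exists u.
Qed.

Lemma contour_intD h k : reg h -> reg k ->
  contour_int g (fun x => h x + k x) = contour_int g h + contour_int g k.
Proof.
move=> rh rk; rewrite !contour_intE //; last first.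
  by move=> w gw; apply: cdiffableD; [exact: rh|exact: rk].
have [i1 i2] := integrand_intg rh; have [j1 j2] := integrand_intg rk.
rewrite /GRing.add /=; congr (_ +i* _).
  by rewrite -IntD //; congr Int; apply/funext => u; rewrite /fRe mulrDl cReD.
by rewrite -IntD //; congr Int; apply/funext => u; rewrite /fIm mulrDl cImD.
Qed.

Lemma contour_intZ (a : C) h : reg h ->
  contour_int g (fun x => a * h x) = a * contour_int g h.
Proof.
move=> rh; rewrite !contour_intE //; last first.
  by move=> w gw; apply: cdiffableM; [exact: cdiffable_cst|exact: rh].
have [i1 i2] := integrand_intg rh.
apply: complex_ext; rewrite ?cReM ?cImM /= -!IntZ //.
  rewrite -IntB //; try exact: intgZ.
  by congr Int; apply/funext => u; rewrite /fRe /fIm -mulrA cReM.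
rewrite -IntD //; try exact: intgZ.
by congr Int; apply/funext => u; rewrite /fRe /fIm -mulrA cImM.
Qed.

Lemma contour_int_sum (I : Type) (r : seq I) (a : I -> C) (h : I -> C -> C) :
  (forall i, reg (h i)) ->
  contour_int g (fun x => \sum_(i <- r) a i * h i x) =
  \sum_(i <- r) a i * contour_int g (h i).
Proof.
move=> rh.
have c0 : contour_int g (fun=> 0) = 0.
  rewrite -[LHS](_ : contour_int g (fun=> 0 * 0) = _); last by rewrite mul0r.
  rewrite (contour_intZ 0 (h := fun=> 0)) ?mul0r // => w _.
  exact: cdiffable_cst.
elim: r => [|i r IH].
  rewrite big_nil -[RHS]c0; congr contour_int; apply/funext => x.
  by rewrite big_nil.
rewrite big_cons -IH -contour_intZ // -contour_intD.
- by congr contour_int; apply/funext => x; rewrite big_cons.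
- by move=> w gw; apply: cdiffableM; [exact: cdiffable_cst|exact: rh].
- move=> w gw; apply: cdiffable_sum => j.
  by apply: cdiffableM; [exact: cdiffable_cst|exact: rh].
Qed.

Lemma contour_primitive H h : g 0 = g 1 -> reg h ->
  (forall w, curve g w -> cdiff H w (h w)) -> contour_int g h = 0.
Proof.
move=> g01 rh dH; rewrite contour_intE //.
have [n [s [s0 s1 sP]]] := piecewise_smooth gP.
have s01 := pieces_le s0 s1 sP; have [iR iI] := integrand_intg rh.
suff K (k : nat) : (k <= n)%N ->
    Int (s 0%N) (s k) (fRe h) = complex.Re (H (g (s k))) - complex.Re (H (g 0)) /\
    Int (s 0%N) (s k) (fIm h) = complex.Im (H (g (s k))) - complex.Im (H (g 0)).
  by have := K n (leqnn _); rewrite s0 s1 -g01 !subrr => -[-> ->].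
elim: k => [_|k IH kn]; first by rewrite s0 !Int_ge // !subrr.
have /andP[sk0 _] := s01 _ (ltnW kn); have /andP[_ sk1] := s01 _ kn.
have [skk [f [f' [gf df cf' vf]]]] := sP _ kn.
have ch u : u \in `[s k, s k.+1] -> ccont (fun v => h (f v) * f' v) u.
  rewrite in_itv /= => uab; apply: ccontM => //.
  have [l dl] : cdiffable h (f u) by apply: rh; rewrite -gf //; apply: piece_curve uab.
  exact: (cderiv_cont (dl f u _ (erefl _) (df u))).
have dHf u : s k <= u <= s k.+1 -> cderiv (fun v => H (f v)) u (h (f u) * f' u).
  by move=> uab; apply: dH => //; rewrite -gf //; apply: piece_curve uab.
have E u : s k < u < s k.+1 -> h (f u) * f' u = h (g u) * velocity g u.
  by move=> uab; rewrite vf // gf //; case/andP: uab => /ltW -> /ltW.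
have i1 : intg (s 0%N) (s k.+1) (fRe h) by rewrite s0; apply: intg_sub iR.
have i2 : intg (s 0%N) (s k.+1) (fIm h) by rewrite s0; apply: intg_sub iI.
have [IH1 IH2] := IH (ltnW kn).
have s0k : s 0%N <= s k by rewrite s0.
rewrite !(Int_split s0k (ltW skk)) //.
have F1 : Int (s k) (s k.+1) (fun v => complex.Re (h (f v) * f' v)) =
    complex.Re (H (f (s k.+1))) - complex.Re (H (f (s k))).
  apply: (Int_FTC (F := fun v : R => complex.Re (H (f v)))); first exact: ltW.
    by move=> u /ch[].
  by move=> u /dHf[].
have F2 : Int (s k) (s k.+1) (fun v => complex.Im (h (f v) * f' v)) =
    complex.Im (H (f (s k.+1))) - complex.Im (H (f (s k))).
  apply: (Int_FTC (F := fun v : R => complex.Im (H (f v)))); first exact: ltW.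
    by move=> u /ch[].
  by move=> u /dHf[].
rewrite IH1 IH2 -(@Int_eq _ _ _ (fun v => complex.Re (h (f v) * f' v)) (fRe h)).
- rewrite -(@Int_eq _ _ _ (fun v => complex.Im (h (f v) * f' v)) (fIm h)).
  + rewrite F1 F2 (gf (s k)) ?lexx ?(ltW skk) // (gf (s k.+1)) ?lexx ?(ltW skk) //.
    by split; ring.
  + by move=> u /E; rewrite /fIm => ->.
  + by apply: intg_cont => u /ch[].
- by move=> u /E; rewrite /fRe => ->.
- by apply: intg_cont => u /ch[].
Qed.

Lemma contour_bound : exists2 l : R, 0 <= l & forall h M, 0 <= M -> reg h ->
  (forall w, curve g w -> nrm (h w) <= M) ->
  nrm (contour_int g h) <= M * l.
Proof.
have r1 : reg (fun=> 1) by move=> w _; exact: cdiffable_cst.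
have [i1 i2] := integrand_intg r1.
pose v u := `|fRe (fun=> 1) u| + `|fIm (fun=> 1) u|.
have iv : intg 0 1 v by apply: intgD; apply: intg_abs.
exists (2 * Int 0 1 v).
  have h0 : Int 0 1 (fun=> 0 : R) = 0 by rewrite Int_cst // mul0r.
  rewrite mulr_ge0 // -[leLHS]h0; apply: Int_le => // [|u _]; first exact: intg_cst.
  by rewrite addr_ge0.
move=> h M M0 rh hM; rewrite contour_intE // (le_trans (normc_le _)) //=.
have [j1 j2] := integrand_intg rh.
have vle u : nrm (velocity g u) <= v u.
  by rewrite /v /fRe /fIm !mul1r; apply: normc_le.
have hv u : 0 < u <= 1 -> nrm (h (g u) * velocity g u) <= M * v u.
  move=> /andP[u0 u1]; rewrite Normc.normcM ler_pM ?normc_ge0 // hM //.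
  by exists u => //=; rewrite in_itv /= ltW.
rewrite (_ : M * (2 * _) = M * Int 0 1 v + M * Int 0 1 v); last by ring.
rewrite -IntZ //.
apply: lerD; apply: (le_trans (Int_abs _)) => //; apply: Int_le.
- exact: intg_abs.
- exact: intgZ.
- by move=> u /hv; apply: le_trans; rewrite abs_Re_le.
- exact: intg_abs.
- exact: intgZ.
- by move=> u /hv; apply: le_trans; rewrite abs_Im_le.
Qed.

(* Compactness of the curve, one piece at a time. *)
Lemma curve_min (psi : C -> R) :
  (forall f u l, cderiv f u l -> {for u, continuous (fun v => psi (f v))}) ->
  (forall w, curve g w -> 0 < psi w) ->
  exists2 r, 0 < r & forall w, curve g w -> r <= psi w.
Proof.
move=> cpsi psi0; have [n [s [s0 s1 sP]]] := piecewise_smooth gP.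
have s01 := pieces_le s0 s1 sP.
suff K (k : nat) : (k <= n)%N -> exists2 r, 0 < r & forall u, 0 <= u <= s k -> r <= psi (g u).
  have [r r0 rP] := K n (leqnn _); exists r => // w [u /=]; rewrite in_itv /= => h <-.
  by apply: rP; rewrite s1.
elim: k => [_|k IH kn].
  exists (psi (g 0)); first by apply: psi0; exists 0 => //=; rewrite in_itv /= lexx ler01.
  by move=> u; rewrite s0 -eq_le => /eqP <-.
have [r r0 rP] := IH (ltnW kn).
have /andP[sk0 _] := s01 _ (ltnW kn); have /andP[_ sk1] := s01 _ kn.
have [skk [f [f' [gf df cf' vf]]]] := sP _ kn.
have [c cab cmin] : exists2 c, c \in `[s k, s k.+1] &
    forall t, t \in `[s k, s k.+1] -> psi (f c) <= psi (f t).
  apply: (@EVT_min _ (fun v => psi (f v))); first exact: ltW.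
  by apply: continuous_in_subspaceT => u _; apply: cpsi (df u).
exists (Num.min r (psi (f c))).
  rewrite lt_min r0 -gf; last by rewrite in_itv in cab.
  by apply: psi0; apply: piece_curve cab => //; rewrite in_itv in cab.
move=> u /andP[u0 us]; have [uk|ku] := leP u (s k).
  by rewrite ge_min rP ?u0.
have uab : s k <= u <= s k.+1 by rewrite ltW.
by rewrite ge_min gf // cmin ?orbT // in_itv.
Qed.

Lemma cont_sqnorm_sub f u l (z : C) : cderiv f u l ->
  {for u, continuous (fun v => sqnorm (f v - z))}.
Proof.
move=> /cderiv_cont[cr ci]; rewrite /sqnorm.
have E1 : {for u, continuous (fun v => complex.Re (f v - z))}.
  rewrite (_ : (fun v => _) = fun v => complex.Re (f v) - complex.Re z).
    by apply: cvgB => //; exact: cvg_cst.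
  by apply/funext => v; rewrite cReD cReN.
have E2 : {for u, continuous (fun v => complex.Im (f v - z))}.
  rewrite (_ : (fun v => _) = fun v => complex.Im (f v) - complex.Im z).
    by apply: cvgB => //; exact: cvg_cst.
  by apply/funext => v; rewrite cImD cImN.
by apply: cvgD; apply: cvgM.
Qed.

Lemma curve_away z : ~ curve g z ->
  exists2 r, 0 < r & forall w, curve g w -> r <= nrm (w - z).
Proof.
move=> zg; have [||r r0 rP] := @curve_min (fun w => sqnorm (w - z)).
- by move=> f u l; apply: cont_sqnorm_sub.
- move=> w gw; rewrite lt_def sqnorm_eq0 subr_eq0 addr_ge0 ?sqr_ge0 // andbT.
  by apply: contra_notN zg => /eqP <-.
exists (Num.sqrt r); first by rewrite sqrtr_gt0.
move=> w gw; rewrite -(ler_pXn2r (n := 2)) ?nnegrE ?normc_ge0 ?sqrtr_ge0 //.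
by rewrite sqr_sqrtr ?(ltW r0) // normc_sq rP.
Qed.

Lemma curve_bounded : exists2 M, 0 < M & forall w, curve g w -> nrm w <= M.
Proof.
have N0 w : 0 < 1 + sqnorm (w - 0) by rewrite ltr_pwDl // addr_ge0 ?sqr_ge0.
have [||r r0 rP] := @curve_min (fun w => (1 + sqnorm (w - 0))^-1).
- move=> f u l df; apply: cvgV; first by rewrite gt_eqF.
  by apply: cvgD; [exact: cvg_cst|exact: cont_sqnorm_sub df].
- by move=> w _; rewrite invr_gt0.
exists (r^-1); first by rewrite invr_gt0.
move=> w gw; have h : 1 + sqnorm (w - 0) <= r^-1.
  by rewrite -[leLHS]invrK lef_pV2 ?posrE ?invr_gt0 // rP.
apply: le_trans h; rewrite subr0 -normc_sq.
by have := sqr_ge0 (nrm w - 1); nra.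
Qed.

End OneContour.
End Contour.


Section Winding.
Variable R : realType.
Local Notation C := R[i].
Local Notation nrm := (@Normc.normc R).
Implicit Types (w z : C).

Lemma cdiff_pole z w : w != z -> cdiff (fun x => (x - z)^-1) w (- (w - z)^-1 ^+ 2).
Proof.
move=> wz; have d1 : cdiff (fun x : C => x - z) w 1.
  rewrite -[1]addr0; apply: cdiffD; [exact: cdiff_id|exact: cdiff_cst].
by have := cdiffV (h := fun x : C => x - z) _ d1; rewrite mulN1r exprVn; apply; rewrite subr_eq0.
Qed.

Lemma cdiffable_pole z w n : w != z -> cdiffable (fun x => (x - z)^-1 ^+ n) w.
Proof.
move=> /cdiff_pole d; case: n => [|n].
  rewrite (_ : (fun x => _) = fun=> 1); first exact: cdiffable_cst.
  by apply/funext => x; rewrite expr0.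
by eexists; apply: cdiffX d.
Qed.

Lemma small_eq0 (y K : R) : 0 <= y -> (forall n, y * 2 ^+ n <= K) -> y = 0.
Proof.
move=> y0 yK; apply/eqP; rewrite eq_le y0 andbT leNgt; apply/negP => yp.
have := upper_nthrootP (leqnn (Num.bound (K / y))).
by rewrite ltr_pdivrMr // mulrC ltNge yK.
Qed.

Section OneContour.
Variable g : R -> C.
Hypothesis gP : piecewise_C1 g.
Hypothesis g01 : g 0 = g 1.

Definition winding z : C := contour_int g (fun x => (x - z)^-1).

Lemma contour_int_pole z n : ~ curve g z ->
  contour_int g (fun x => (x - z)^-1 ^+ n.+2) = 0.
Proof.
move=> zg; have ne w : curve g w -> w != z.
  by move=> gw; apply: contra_notN zg => /eqP <-.
apply: (contour_primitive gP (H := fun x => - n.+1%:R^-1 * (x - z)^-1 ^+ n.+1)) => //.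
  by move=> w /ne; apply: cdiffable_pole.
move=> w /ne wz.
have := cdiffM (@cdiff_cst R (- n.+1%:R^-1) w) (cdiffX n (cdiff_pole wz)).
rewrite mul0r add0r (_ : _ * (_ * _ * _) = (w - z)^-1 ^+ n.+2) //.
rewrite -[n.+2]addn2 exprD; set v := (w - z)^-1.
by field; rewrite addrC natr1 pnatr_eq0.
Qed.

Lemma contour_int_poly (n : {poly C}) : contour_int g (fun x => n.[x]) = 0.
Proof.
rewrite (_ : (fun x => _) = fun x => \sum_(i <- iota 0 (size n)) n`_i * x ^+ i).
  rewrite contour_int_sum //; last first.
    move=> i w _; rewrite (_ : (fun x => _) = fun x => ('X^i : {poly C}).[x]).
      exact: cdiffable_poly.
    by apply/funext => x; rewrite hornerXn.
  apply: big1 => i _; rewrite (contour_primitive gP (H := fun x => i.+1%:R^-1 * x ^+ i.+1)) ?mulr0 //.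
    move=> w _; rewrite (_ : (fun x => _) = fun x => ('X^i : {poly C}).[x]).
      exact: cdiffable_poly.
    by apply/funext => x; rewrite hornerXn.
  move=> w _; have := cdiffM (@cdiff_cst R (i.+1%:R^-1) w) (cdiffX i (@cdiff_id R w)).
  rewrite mul0r add0r mulr1 mulrA mulVf ?mul1r //.
by apply/funext => x; rewrite horner_coef -(big_mkord xpredT (fun i => n`_i * x ^+ i)) /index_iota subn0.
Qed.

(** Expanding [1/(x - z)] in powers of [z - z0], only the constant term
    contributes, and the remainder is geometrically small. *)
Lemma winding_local z0 : ~ curve g z0 -> exists2 r : R, 0 < r &
  forall z, nrm (z - z0) < r -> ~ curve g z /\ winding z = winding z0.
Proof.
move=> z0g; have [r r0 rP] := curve_away gP z0g.
have [l l0 lP] := contour_bound gP.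
exists (r / 2) => [|z zr]; first by rewrite divr_gt0.
have far w : curve g w -> r / 2 <= nrm (w - z).
  move=> gw; have := le_normcD (w - z) (z - z0); have := rP w gw.
  by rewrite addrA subrK; lra.
have zg : ~ curve g z.
  by move=> /far; rewrite subrr Normc.normc0; lra.
split => //; have ne w : curve g w -> (w != z) * (w != z0).
  by move=> gw; split; [apply: contra_notN zg|apply: contra_notN z0g] => /eqP <-.
pose T n := contour_int g (fun x => (x - z)^-1 * (x - z0)^-1 ^+ n).
have regT n w : curve g w -> cdiffable (fun x => (x - z)^-1 * (x - z0)^-1 ^+ n) w.
  move=> /ne[wz wz0]; apply: cdiffableM; last exact: cdiffable_pole.
  by eexists; apply: cdiff_pole.
have step n : T n = (z - z0) * T n.+1 + contour_int g (fun x => (x - z0)^-1 ^+ n.+1).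
  rewrite -contour_intZ //; last exact: regT.
  rewrite -contour_intD //.
  - apply: eq_contour_int => w /ne[wz wz0]; rewrite exprS.
    have h1 : w - z0 != 0 by rewrite subr_eq0.
    have h2 : w - z != 0 by rewrite subr_eq0.
    set v := _ ^+ n; rewrite (_ : z - z0 = (w - z0) - (w - z)); last by ring.
    by field; rewrite h1 h2.
  - move=> w gw; apply: cdiffableM; [exact: cdiffable_cst|exact: regT].
  - by move=> w /ne[_ wz0]; apply: cdiffable_pole.
have TW : winding z - winding z0 = (z - z0) * T 1%N.
  have -> : winding z = T 0%N.
    by congr (contour_int g _); apply/funext => x; rewrite expr0 mulr1.
  by rewrite step addrK.
have TW' n : winding z - winding z0 = (z - z0) ^+ n.+1 * T n.+1.
  elim: n => [|n ->]; first by rewrite expr1.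
  by rewrite step contour_int_pole // addr0 mulrA -exprSr.
apply/eqP; rewrite -subr_eq0; apply/eqP; apply: Normc.eq0_normc.
apply: (@small_eq0 _ (l / r)); first exact: normc_ge0.
move=> n; rewrite (TW' n). rewrite Normc.normcM normcX.
have Tn : nrm (T n.+1) <= (2 / r) * r^-1 ^+ n.+1 * l.
  apply: lP; first by rewrite mulr_ge0 ?exprn_ge0 ?divr_ge0 ?invr_ge0 // ltW.
  exact: regT.
  move=> w gw; rewrite Normc.normcM normcX !Normc.normcV.
  have h1 := far w gw; have h2 := rP w gw.
  apply: ler_pM; rewrite ?exprn_ge0 ?invr_ge0 ?normc_ge0 //.
    rewrite -[2 / r]invrK invf_div lef_pV2 ?posrE ?divr_gt0 //.
    by apply: lt_le_trans h1; rewrite divr_gt0.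
  apply: lerXn2r; rewrite ?nnegrE ?invr_ge0 ?normc_ge0 ?(ltW r0) //.
  by rewrite lef_pV2 ?posrE // (lt_le_trans r0).
have zn : nrm (z - z0) ^+ n.+1 <= (r / 2) ^+ n.+1.
  by apply: lerXn2r; rewrite ?nnegrE ?normc_ge0 ?divr_ge0 // ltW.
apply: (@le_trans _ _ ((r / 2) ^+ n.+1 * ((2 / r) * r^-1 ^+ n.+1 * l) * 2 ^+ n)).
  rewrite ler_pM2r ?exprn_gt0 //; apply: ler_pM => //; rewrite ?exprn_ge0 ?normc_ge0 //.
rewrite le_eqVlt; apply/orP; left; apply/eqP.
rewrite !expr_div_n !exprS exprVn.
have r_neq0 := lt0r_neq0 r0; have rn0 : r ^+ n != 0 by rewrite expf_neq0.
have n0 : (2 : R) ^+ n != 0 by rewrite expf_neq0 // pnatr_eq0.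
by field; rewrite r_neq0 rn0 n0.
Qed.

Lemma open_of_normc (U : set C^o) :
  (forall w, U w -> exists2 r : R, 0 < r & forall z, nrm (z - w) < r -> U z) ->
  open U.
Proof.
move=> UP; rewrite openE => w /UP[r r0 rP]; apply/nbhs_ballP.
exists r%:C; first by rewrite /= ltcR.
move=> z; rewrite -ball_normE /= => h; apply: rP.
by move: h; rewrite /Num.norm /= ltcR normc_sub.
Qed.

Lemma winding_component z w : contour_component g z w -> winding w = winding z.
Proof.
move=> zw; set K := contour_component g z in zw *.
have Kg : K `<=` ~` curve g by apply: connected_component_sub.
have [zg|zg] := pselect (curve g z).
  by move: zw; rewrite /K /contour_component connected_component_out.
pose U := [set v : C^o | ~ curve g v /\ winding v = winding z].
pose V := [set v : C^o | ~ curve g v /\ winding v <> winding z].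
have oU : open U.
  apply: open_of_normc => v [vg vz]; have [r r0 rP] := winding_local vg.
  by exists r => // u /rP[ug uv]; split; rewrite // uv.
have oV : open V.
  apply: open_of_normc => v [vg vz]; have [r r0 rP] := winding_local vg.
  by exists r => // u /rP[ug uv]; split; rewrite // uv.
suff E : K = K `&` U by move: zw; rewrite E => -[_ []].
apply/esym; apply: (@component_connected _ (~` curve g : set C^o) z).
- by exists z; split; [exact: connected_component_refl|].
- by exists U.
- exists (~` V); first exact: open_closedC.
  apply/seteqP; split => v [Kv].
    by move=> [vg vz]; split => // -[].
  move=> nV; split => //; split; first exact: Kg.
  by apply: contrapT => h; apply: nV; split => //; apply: Kg.
Qed.

Lemma winding_exterior z : contour_exterior g z -> winding z = 0.
Proof.
move=> [zg ub]; apply: Normc.eq0_normc.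
have [M M0 MP] := curve_bounded gP; have [l l0 lP] := contour_bound gP.
apply: (@small_eq0 _ l); first exact: normc_ge0.
move=> n; have [w Kw wM] : exists2 w, contour_component g z w & M + 2 ^+ n < nrm w.
  apply: contrapT => h; apply: ub.
  exists (M + 2 ^+ n)%:C; split; first by rewrite complex_real.
  move=> x xM w Kw; apply: ltW; apply: le_lt_trans xM; rewrite lecR leNgt.
  by apply/negP => wM; apply: h; exists w.
rewrite -(winding_component Kw) -ler_pdivlMr ?exprn_gt0 // mulrC.
have wg : ~ curve g w by have := connected_component_sub Kw.
apply: lP; first by rewrite invr_ge0 exprn_ge0.
  move=> v gv; rewrite (_ : (fun x => _) = fun x => (x - w)^-1 ^+ 1).
    by apply: cdiffable_pole; apply: contra_notN wg => /eqP <-.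
  by apply/funext => x; rewrite expr1.
move=> v gv; rewrite Normc.normcV.
have h : 2 ^+ n <= nrm (v - w).
  have := le_normcD w (v - w); rewrite addrC subrK => h.
  have := le_normcD v (w - v); rewrite addrC subrK normc_sub.
  by have := MP v gv; move: wM; lra.
by rewrite lef_pV2 ?posrE ?exprn_gt0 // (lt_le_trans _ h) ?exprn_gt0.
Qed.

End OneContour.
End Winding.

(** A functional on functions that are complex differentiable off a finite or
    infinite set [D] of poles, with the properties of a normalized sum of
    contour integrals of common winding number [c0] around the points of [D]. *)
Section PoleCalculus.
Variable R : realType.
Local Notation C := R[i].
Variables (D : set C) (c0 : C) (J : (C -> C) -> C).

Definition regular_off (h : C -> C) := forall w, ~ D w -> cdiffable h w.

Record pole_functional : Prop := {
  pole_ext : forall h k, (forall w, ~ D w -> h w = k w) -> J h = J k ;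
  pole_lin : forall (a : C) h k, regular_off h -> regular_off k ->
    J (fun x => a * h x + k x) = a * J h + J k ;
  pole_high : forall z n, D z -> J (fun x => (x - z)^-1 ^+ n.+2) = 0 ;
  pole_simple : forall z, D z -> J (fun x => (x - z)^-1) = c0 ;
  pole_poly : forall n : {poly C}, J (fun x => n.[x]) = 0 }.

Hypothesis JP : pole_functional.

Definition poles (s : seq C) (x : C) : C := \prod_(z <- s) (x - z)^-1.

Lemma regular_poles s : (forall z, z \in s -> D z) -> regular_off (poles s).
Proof.
move=> sD w wD; apply: cdiffable_prod => z /sD zD.
by eexists; apply: cdiff_pole; apply: contra_notN wD => /eqP ->.
Qed.

Lemma poles_cons z s x : poles (z :: s) x = (x - z)^-1 * poles s x.
Proof. by rewrite /poles big_cons. Qed.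

(** Partial fractions: two distinct poles can be traded for a difference of
    terms with one pole less. *)
Lemma pole_functional_poles s : s != [::] -> (forall z, z \in s -> D z) ->
  J (poles s) = c0 * (size s == 1)%:R.
Proof.
have [n] := ubnP (size s); elim: n s => // n IH [//|z s] /= ss _ sD.
have zD : D z by apply: sD; rewrite mem_head.
have [/all_pred1P sz|/allPn[z' z's z'z]] := boolP (all (pred1 z) s).
  have pE x : poles (z :: s) x = (x - z)^-1 ^+ (size s).+1.
    rewrite poles_cons exprS /poles sz big_nseq size_nseq.
    by congr (_ * _); elim: (size s) => //= m ->; rewrite exprS.
  rewrite (_ : poles _ = fun x => (x - z)^-1 ^+ (size s).+1); last exact/funext.
  case: (size s) => [|m]; last by rewrite pole_high // mulr0.
  rewrite mulr1 -(pole_simple JP zD); congr (J _).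
have z'D : D z' by apply: sD; rewrite inE z's orbT.
pose t := rem z' s.
have st : perm_eq s (z' :: t) by apply: perm_to_rem.
have tD u : u \in t -> D u by move=> /mem_rem us; apply: sD; rewrite inE us orbT.
have ssE : size s = (size t).+1 by rewrite (perm_size st).
have D1 u : u \in z :: t -> D u by rewrite inE => /predU1P[->|/tD].
have D2 u : u \in z' :: t -> D u by rewrite inE => /predU1P[->|/tD].
have zz' : z - z' != 0 by rewrite subr_eq0 eq_sym.
have -> : J (poles (z :: s)) =
    J (fun x => (z - z')^-1 * poles (z :: t) x + (- (z - z')^-1 * poles (z' :: t) x + 0)).
  apply: pole_ext => // w wD.
  rewrite poles_cons /poles (perm_big _ st) /= -!/(poles _ _) !poles_cons.
  have h1 : w - z != 0 by rewrite subr_eq0; apply: contra_notN wD => /eqP ->.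
  have h2 : w - z' != 0 by rewrite subr_eq0; apply: contra_notN wD => /eqP ->.
  rewrite (_ : z - z' = (w - z') - (w - z)) in zz' *; last by ring.
  by field; rewrite h1 h2 zz'.
have r0 : regular_off (fun=> 0 : C) by move=> w _; apply: cdiffable_cst.
have J0 : J (fun=> 0) = 0.
  rewrite -[RHS](pole_poly JP 0); congr J; apply/funext => x.
  by rewrite horner0.
rewrite (pole_lin JP); [|exact: regular_poles|]; last first.
  move=> w wD; apply: cdiffableD; last exact: cdiffable_cst.
  by apply: cdiffableM; [exact: cdiffable_cst|exact: regular_poles wD].
rewrite (pole_lin JP) //; last exact: regular_poles.
rewrite J0 addr0 !IH //= ?ssE //; try by rewrite ssE in ss.
by rewrite mulNr subrr mulr0.
Qed.

Lemma pole_functional0 s (n : {poly C}) : c0 = 0 -> (forall z, z \in s -> D z) ->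
  J (fun x => n.[x] * poles s x) = 0.
Proof.
move=> c00; elim: s n => [|z s IH] n sD.
  rewrite -[RHS](pole_poly JP n); congr J; apply/funext => x.
  by rewrite /poles big_nil mulr1.
have zD : D z by apply: sD; rewrite mem_head.
have sD' u : u \in s -> D u by move=> us; apply: sD; rewrite inE us orbT.
have := divp_eq (n - n.[z]%:P) ('X - z%:P).
rewrite modp_XsubC hornerD hornerN hornerC subrr addr0; set q := _ %/ _ => nE.
have -> : J (fun x => n.[x] * poles (z :: s) x) =
    J (fun x => n.[z] * poles (z :: s) x + q.[x] * poles s x).
  apply: pole_ext => // w wD.
  have h1 : w - z != 0 by rewrite subr_eq0; apply: contra_notN wD => /eqP ->.
  rewrite -[n in LHS](subrK n.[z]%:P) nE !hornerE poles_cons.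
  by field.
rewrite (pole_lin JP); last 2 first.
- exact: regular_poles.
- move=> w wD; apply: cdiffableM; first exact: cdiffable_poly.
  exact: regular_poles wD.
by rewrite IH // pole_functional_poles // c00 mul0r mulr0 addr0.
Qed.

End PoleCalculus.


Section Markov.
Variable R : realType.
Local Notation C := R[i].

Lemma pole_functional_sum (D : set C) c0 J (n : {poly C}) (m : nat) (a : nat -> C)
    (s : nat -> seq C) : pole_functional D c0 J ->
  (forall j z, z \in s j -> D z) ->
  J (fun x => n.[x] + \sum_(j < m) a j * poles (s j) x) =
  \sum_(j < m) a j * J (poles (s j)).
Proof.
move=> JP sD; elim: m => [|m IH].
  rewrite big_ord0 -[RHS](pole_poly JP n); congr J; apply/funext => x.
  by rewrite big_ord0 addr0.
rewrite big_ord_recr /= -IH addrC -(pole_lin JP).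
- by congr J; apply/funext => x; rewrite big_ord_recr /= addrA addrC.
- by apply: regular_poles => z; exact: sD.
- move=> w wD; apply: cdiffableD; first exact: cdiffable_poly.
  apply: cdiffable_sum => j; apply: cdiffableM; first exact: cdiffable_cst.
  by apply: regular_poles wD => z; exact: sD.
Qed.

(** Newton's interpolation form of the resolvent: the remainder vanishes by
    the Cayley-Hamilton theorem. *)
Lemma newton_resolvent n (M : 'M[C]_n) : exists (r : seq C) (P : nat -> 'M[C]_n),
  [/\ size r = n, forall z, z \in r -> \det (z%:M - M) = 0, P 0%N = 1%:M &
   forall x, x \notin r ->
     (x%:M - M) *m (\sum_(j < n) poles (take j.+1 r) x *: P j) = 1%:M].
Proof.
case: n M => [|n] M.
  by exists [::], (fun=> 1%:M); split => // x _; apply/matrixP => -[].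
have [r rE] := closed_field_poly_normal (char_poly M).
have mc := char_poly_monic M; rewrite (eqP mc) scale1r in rE.
have sr : size r = n.+1.
  by have := size_char_poly M; rewrite rE size_prod_XsubC => -[].
pose P j := horner_mx M (\prod_(z <- take j r) ('X - z%:P)).
exists r, P; split => //.
- move=> z zr; have : root (char_poly M) z by rewrite rE root_prod_XsubC.
  rewrite /root /char_poly -det_mxpoly_eval => /eqP <-; congr (\det _).
  by apply/matrixP => i j; rewrite !mxE !hornerE; case: eqP => _; rewrite ?mulr1n ?mulr0n !hornerE.
- by rewrite /P take0 big_nil rmorph1.
have PS j : (j < n.+1)%N -> P j.+1 = (M - (r`_j)%:M) *m P j.
  move=> jn; rewrite /P (take_nth 0) ?sr // -cats1 big_cat big_seq1 /= mulrC.
  by rewrite rmorphM rmorphB /= horner_mx_X horner_mx_C.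
have Pn : P n.+1 = 0.
  by rewrite -[RHS](Cayley_Hamilton M) rE /P -sr take_size.
move=> x xr.
suff H j : (j <= n.+1)%N -> (x%:M - M) *m (\sum_(i < j) poles (take i.+1 r) x *: P i) =
    1%:M - poles (take j r) x *: P j.
  by rewrite H // Pn scaler0 subr0.
elim: j => [|j IH] jn.
  rewrite big_ord0 mulmx0 /P /poles take0 !big_nil.
  by rewrite (rmorph1 (horner_mx M)) scale1r; apply/esym/subrr.
rewrite big_ord_recr /= mulmxDr IH ?(ltnW jn) // -scalemxAr PS //.
have -> : x%:M - M = (x - r`_j)%:M - (M - (r`_j)%:M).
  by rewrite opprB addrA raddfB /= subrK.
rewrite mulmxBl mul_scalar_mx scalerBr scalerA.
have -> : poles (take j.+1 r) x * (x - r`_j) = poles (take j r) x.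
  rewrite /poles (take_nth 0) ?sr // -cats1 big_cat big_seq1 /= mulfVK //.
  by rewrite subr_eq0; apply: contraNneq xr => ->; rewrite mem_nth ?sr.
by rewrite addrA subrK.
Qed.

Lemma invmx_rational n (M : 'M[{poly C}]_n) : \det M \is monic ->
  exists2 r : seq C, (forall z, z \in r -> mxpoly_spectrum M z) &
    forall x, invmx (mxpoly_eval M x) =
      (if \det (mxpoly_eval M x) == 0 then mxpoly_eval M x
       else poles r x *: mxpoly_eval (\adj M) x).
Proof.
move=> mM; have [r rE] := closed_field_poly_normal (\det M).
rewrite (eqP mM) scale1r in rE; exists r.
  move=> z zr; have : root (\det M) z by rewrite rE root_prod_XsubC.
  by move=> /eqP; rewrite /mxpoly_spectrum /= det_mxpoly_eval.
move=> x; rewrite /invmx unitmxE unitfE; case: eqP => //= dx.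
congr (_ *: _); last by rewrite -(map_mx_adj (horner_eval x)).
rewrite det_mxpoly_eval rE horner_prod -prodfV.
by apply: eq_bigr => z _; rewrite !hornerE.
Qed.

End Markov.


Lemma pow_sub (K : comNzRingType) n m (M : 'M[K]_n) (W : 'M[K]_(n, m)) x k :
  x ^+ k *: W =
  \sum_(l < k) x ^+ (k - l.+1) *: (M ^+ l *m ((x%:M - M) *m W)) + M ^+ k *m W.
Proof.
elim: k => [|k IH].
  by rewrite expr0 scale1r big_ord0 add0r expr0 mul1mx.
have E : x *: W = (x%:M - M) *m W + M *m W.
  by rewrite mulmxBl mul_scalar_mx subrK.
rewrite exprS -scalerA IH scalerDr scalemxAr E mulmxDr addrA; congr (_ + _).
  rewrite big_ord_recr /= subnn expr0 scale1r; congr (_ + _).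
  rewrite scaler_sumr; apply: eq_bigr => l _; rewrite scalerA -exprS.
  by congr (_ ^+ _ *: _); rewrite subSn.
by rewrite mulmxA exprSr.
Qed.

Lemma two_i_pi_neq0 (R : realType) : two_i_pi R != 0.
Proof.
rewrite /two_i_pi eq_complex /= negb_and; apply/orP; right.
by rewrite gt_eqF // mulr_gt0 // pi_gt0.
Qed.

Section Residues.
Variables (R : realType) (d m p q : nat).
Variables (A : nat -> 'M[R]_d) (B : nat -> 'M[R]_(d, m)).
Variable S : 'I_p -> 'M[R[i]]_d.
Variable Gamma : 'I_p -> R -> R[i].
Hypothesis q_lt_p : (q < p)%N.
Hypothesis q_gt0 : (0 < q)%N.
Hypothesis S_complete : complete_solvents (cplx_coefs A) S.
Hypothesis S_regular : forall k, regular_solvent p (cplx_coefs A) (S k).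
Hypothesis Gamma_contour : forall k,
  solvent_contour (ar_poly p (cplx_coefs A)) (S k) (Gamma k).

Local Notation C := R[i].
Let Ap := ar_poly p (cplx_coefs A).
Let Bp := ma_poly q (cplx_coefs B).
Let D : set C := mxpoly_spectrum Ap.
Let F := mfd Ap Bp.
Let J k (h : C -> C) : C := (two_i_pi R)^-1 * contour_int (Gamma k) h.

Let p_gt0 : (0 < p)%N. Proof. exact: leq_ltn_trans q_lt_p. Qed.

Let gP k : piecewise_C1 (Gamma k). Proof. by have [[? _ _] _ _ _] := Gamma_contour k. Qed.
Let g01 k : Gamma k 0 = Gamma k 1. Proof. by have [[_ ? _] _ _ _] := Gamma_contour k. Qed.

Lemma curve_avoids_spectrum k z : D z -> ~ curve (Gamma k) z.
Proof.
move=> Dz; have [_ _ iS eS] := Gamma_contour k.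
have [/iS[]//|nS] := pselect (spectrum (S k) z).
by have [] := eS z (conj Dz nS).
Qed.

Lemma normalized_winding k z : D z ->
  J k (fun x => (x - z)^-1) = (`[< spectrum (S k) z >])%:R.
Proof.
move=> Dz; have [[_ _ _] po iS eS] := Gamma_contour k.
have [Sz|nS] := asboolP (spectrum (S k) z).
  exact: po (iS _ Sz).
rewrite /J -[contour_int _ _]/(winding (Gamma k) z).
by rewrite (winding_exterior (gP k) (g01 k)) ?mulr0 //; exact: eS.
Qed.

Let curve_off k w : curve (Gamma k) w -> ~ D w.
Proof. by move=> gw Dw; exact: (curve_avoids_spectrum Dw gw). Qed.

Lemma contour_ext k h h' : (forall w, ~ D w -> h w = h' w) -> J k h = J k h'.
Proof. by move=> hh; congr (_ * _); apply: eq_contour_int => w /curve_off/hh. Qed.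

Lemma contour_lin k (a : C) h h' : regular_off D h -> regular_off D h' ->
  J k (fun x => a * h x + h' x) = a * J k h + J k h'.
Proof.
move=> rh rh'; rewrite /J contour_intD //.
- rewrite contour_intZ ?mulrDr 1?mulrCA //; by move=> w /curve_off; exact: rh.
- move=> w /curve_off wD; apply: cdiffableM; first exact: cdiffable_cst.
  exact: rh.
- by move=> w /curve_off; exact: rh'.
Qed.

Lemma contour_lin_sum k (I : Type) (r : seq I) (a : I -> C) (h : I -> C -> C) :
  (forall i, regular_off D (h i)) ->
  J k (fun x => \sum_(i <- r) a i * h i x) = \sum_(i <- r) a i * J k (h i).
Proof.
move=> rh; rewrite /J contour_int_sum // => [|i w /curve_off]; last exact: rh.
by rewrite mulr_sumr; apply: eq_bigr => i _; rewrite mulrCA.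
Qed.

Lemma contour_pole_functional k (E : set C) (c0 : C) : E `<=` D ->
  (forall z, E z -> J k (fun x => (x - z)^-1) = c0) -> pole_functional E c0 (J k).
Proof.
move=> ED Ec; split => //.
- by move=> h h' hh; apply: contour_ext => w wD; apply: hh => /ED.
- move=> a h h' rh rh'; apply: contour_lin => w wD; [apply: rh|apply: rh'];
    by move=> /ED.
- move=> z n Ez; rewrite /J contour_int_pole ?mulr0 //.
  by apply: curve_avoids_spectrum; apply: ED.
- by move=> n; rewrite /J contour_int_poly ?mulr0.
Qed.

(** Every eigenvalue lies inside exactly one of the contours. *)
Lemma total_pole_functional : pole_functional D 1 (fun h => \sum_k J k h).
Proof.
have PF k z : D z -> pole_functional [set z] (`[< spectrum (S k) z >])%:R (J k).
  move=> Dz; apply: contour_pole_functional => [_ ->//|_ ->].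
  exact: normalized_winding.
split.
- by move=> h h' hh; apply: eq_bigr => k _; apply: contour_ext.
- move=> a h h' rh rh'; under eq_bigr do rewrite contour_lin //.
  by rewrite big_split /= mulr_sumr.
- move=> z n Dz; apply: big1 => k _; exact: (pole_high (PF k z Dz)).
- move=> z Dz; under eq_bigr do rewrite normalized_winding //.
  have [k _ kz] : (\bigcup_(k in [set: 'I_p]) spectrum (S k)) z.
    by have [_ <-] := S_complete.
  rewrite (bigD1 k) //= big1 ?addr0; first by rewrite asboolT.
  move=> j jk; rewrite asboolF // => jz.
  have h := solvent_spectra_disjoint S_complete S_regular jk.
  have h2 := h z jz.
  by case: (h2 kz).
- move=> n; apply: big1 => k _; rewrite /J contour_int_poly ?mulr0 //.
Qed.

Let mA : \det Ap \is monic. Proof. by have [] := size_det_ar (cplx_coefs A) p_gt0. Qed.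

Lemma mfd_rational : exists (N : 'M[{poly C}]_(d, m)) (r : seq C),
  (forall z, z \in r -> D z) /\
  forall x, ~ D x -> F x = poles r x *: mxpoly_eval N x.
Proof.
have [r rD rE] := invmx_rational mA.
exists (\adj Ap *m Bp), r; split => // x xD.
rewrite /F /mfd rE; case: eqP => // _.
by rewrite -scalemxAl mxpoly_evalM.
Qed.


Let Mc := cplx_mx (state_A p A).
Let Bc := cplx_mx (state_B p q A B).
Let Cc := cplx_mx (state_C R d p).

Lemma companion_spectrum z : \det (z%:M - Mc) = 0 -> D z.
Proof. by rewrite /Mc cplx_state_A; apply: companion_singular. Qed.


(** On a function carrying only the poles inside the [k]-th contour,
    multiplication by [x] acts as multiplication by the solvent. *)
Lemma solvent_shift k n (N : 'M[{poly C}]_(d, m)) r i j :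
  (forall z, z \in r -> D z) ->
  (forall x, ~ D x -> F x = poles r x *: mxpoly_eval N x) ->
  J k (fun x => \sum_l (S k ^+ n) i l * (poles r x * (N l j).[x])) =
  J k (fun x => x ^+ n * (poles r x * (N i j).[x])).
Proof.
move=> rD FE; have [_ [A1 [e dis]]] := S_regular k.
set M1 := ar_poly p.-1 A1 in e dis.
have rP i' : regular_off D (fun x => poles r x * (N i' j).[x]).
  move=> w wD; apply: cdiffableM; last exact: cdiffable_poly.
  exact: (regular_poles rD).
have p1 : (0 < p.-1)%N by move: q_lt_p q_gt0; lia.
have m1 : \det M1 \is monic by have [] := size_det_ar A1 p1.
have [r1 r1D r1E] := invmx_rational m1.
pose E := mxpoly_spectrum M1.
have detE x : \det (mxpoly_eval Ap x) = \det (mxpoly_eval M1 x) * \det (x%:M - S k).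
  rewrite /Ap e mxpoly_evalM det_mulmx; congr (_ * \det _).
  by apply/matrixP => i' j'; rewrite !mxE !hornerE; case: eqP => _; rewrite ?mulr1n ?mulr0n !hornerE.
have ED : E `<=` D.
  move=> z Ez; have d1 : \det (mxpoly_eval M1 z) = 0 by exact: Ez.
  by have := detE z; rewrite d1 mul0r.
have E0 z : E z -> J k (fun x => (x - z)^-1) = 0.
  move=> Ez; rewrite normalized_winding; last exact: ED.
  rewrite asboolF // => Sz; suff : (spectrum (S k) `&` mxpoly_spectrum M1) z by rewrite dis.
  by split.
have JP := contour_pole_functional ED E0.
pose Nq := \sum_(l < n) 'X^(n - l.+1) *: (map_mx polyC (S k ^+ l) *m (\adj M1 *m Bp)).
have diff x : ~ D x -> (poles r x * (N i j).[x]) * x ^+ n =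
    (Nq i j).[x] * poles r1 x + \sum_l (S k ^+ n) i l * (poles r x * (N l j).[x]).
  move=> xD; have Fx := FE x xD.
  have dA : \det (mxpoly_eval Ap x) != 0 by apply/negP => /eqP.
  move: (dA); rewrite detE mulf_eq0 negb_or => /andP[d1 dS].
  have SF : (x%:M - S k) *m F x = poles r1 x *: mxpoly_eval (\adj M1 *m Bp) x.
    have uA : mxpoly_eval Ap x \in unitmx.
      by rewrite unitmxE unitfE; exact: dA.
    have u1 : mxpoly_eval M1 x \in unitmx.
      by rewrite unitmxE unitfE; exact: d1.
    have Ae : mxpoly_eval Ap x = mxpoly_eval M1 x *m (x%:M - S k).
      rewrite /Ap e mxpoly_evalM; congr (_ *m _).
      by apply/matrixP => i' j'; rewrite !mxE !hornerE; case: eqP => _; rewrite ?mulr1n ?mulr0n !hornerE.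
    rewrite mxpoly_evalM scalemxAl.
    have := r1E x; rewrite (negPf d1) => <-.
    rewrite -[LHS](mulKmx u1); congr (_ *m _).
    by rewrite mulmxA -Ae /F /mfd (mulKVmx uA).
  have h := congr1 (fun Z : 'M[C]_(d, m) => Z i j) (pow_sub (S k) (F x) x n).
  rewrite SF /= [LHS]mxE [RHS]mxE in h.
  have FxE i' : poles r x * (N i' j).[x] = F x i' j by rewrite Fx !mxE.
  rewrite FxE mulrC h; congr (_ + _); last first.
    by rewrite mxE; apply: eq_bigr => l _; rewrite FxE.
  rewrite /Nq !summxE horner_sum mulr_suml; apply: eq_bigr => l _.
  rewrite -scalemxAr !mxE hornerM hornerXn -mulrA; congr (_ * _).
  rewrite mulrC horner_sum; congr (_ * _); apply: eq_bigr => l' _.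
  by rewrite !mxE hornerM hornerC.
rewrite (_ : J k (fun x => x ^+ n * _) = J k (fun x => 1 * ((Nq i j).[x] * poles r1 x) +
   \sum_l (S k ^+ n) i l * (poles r x * (N l j).[x]))); last first.
  by apply: contour_ext => w wD; rewrite mulrC diff // mul1r.
rewrite contour_lin.
- rewrite mul1r [X in _ = X + _](_ : _ = 0) ?add0r //.
  by apply: (pole_functional0 JP) => // z zr; exact: r1D.
- move=> w wD; apply: cdiffableM; first exact: cdiffable_poly.
  by apply: (regular_poles (D := E) r1D) => Ew; apply: wD; exact: ED.
- move=> w wD; apply: cdiffable_sum => l; apply: cdiffableM; first exact: cdiffable_cst.
  exact: rP.
Qed.

(** The Markov parameters of the state space model, as sums over the solvents. *)
Theorem markov_parameters n :
  \sum_k S k ^+ n *m residue F (Gamma k) = Cc *m (Mc ^+ n) *m Bc.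
Proof.
have [N [r [rD FE]]] := mfd_rational.
apply/matrixP => i j; rewrite summxE.
have rP i' : regular_off D (fun x => poles r x * (N i' j).[x]).
  move=> w wD; apply: cdiffableM; last exact: cdiffable_poly.
  exact: (regular_poles rD).
have E1 k : (S k ^+ n *m residue F (Gamma k)) i j =
    J k (fun x => x ^+ n * (poles r x * (N i j).[x])).
  rewrite -(solvent_shift k n i j rD FE) contour_lin_sum //.
  rewrite mxE; apply: eq_bigr => l _; rewrite !mxE; congr (_ * _).
  by apply: (contour_ext k) => w wD; rewrite FE // !mxE.
rewrite (eq_bigr _ (fun k _ => E1 k)).
have [s [P [ss sM P0 PM]]] := newton_resolvent Mc.
pose a l := (Cc *m (Mc ^+ n) *m P l *m Bc) i j.
pose Nq := \sum_(l < n) 'X^(n - l.+1) *: (map_mx polyC (Cc *m (Mc ^+ l) *m Bc)).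
have sD z : z \in s -> D z by move=> /sM; apply: companion_spectrum.
have E x : ~ D x -> x ^+ n * (poles r x * (N i j).[x]) =
    (Nq i j).[x] + \sum_(l < (\sum_(k < p) d)%N) a l * poles (take l.+1 s) x.
  move=> xD.
  have -> : poles r x * (N i j).[x] = F x i j by rewrite FE // !mxE.
  rewrite /F /Ap /Bp transfer_function // -/Mc -/Bc -/Cc.
  have xs : x \notin s by apply/negP => /sD.
  pose W := \sum_(l < (\sum_(k < p) d)%N) poles (take l.+1 s) x *: P l.
  have PMx : (x%:M - Mc) *m W = 1%:M := PM x xs.
  have uM : x%:M - Mc \in unitmx by have [] := mulmx1_unit PMx.
  have -> : invmx (x%:M - Mc) = W by rewrite -[LHS]mulmx1 -PMx mulKmx.
  have := pow_sub Mc W x n; rewrite PMx => h.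
  have -> : x ^+ n * (Cc *m W *m Bc) i j = (Cc *m (x ^+ n *: W) *m Bc) i j.
    by rewrite -scalemxAr -scalemxAl [RHS]mxE.
  rewrite h mulmxDr mulmxDl mxE; congr (_ + _).
    rewrite mulmx_sumr mulmx_suml !summxE horner_sum; apply: eq_bigr => l _.
    by rewrite mulmx1 -scalemxAr -scalemxAl !mxE !hornerE.
  rewrite /W !mulmx_sumr mulmx_suml summxE; apply: eq_bigr => l _.
  by rewrite /a -!scalemxAr -scalemxAl mxE mulrC !mulmxA.
rewrite (eq_bigr _ (fun k _ => contour_ext k E)).
have sD' l z : z \in take l.+1 s -> D z by move=> /mem_take; exact: sD.
etransitivity.
  exact: (pole_functional_sum (Nq i j) (\sum_(k < p) d)%N a total_pole_functional sD').
have pv l : (l < size s)%N -> \sum_k J k (poles (take l.+1 s)) = (l == 0%N)%:R.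
  move=> ls; have st : size (take l.+1 s) = l.+1 by rewrite size_takel.
  have ne : take l.+1 s != [::] by rewrite -size_eq0 st.
  by rewrite (pole_functional_poles total_pole_functional ne (sD' l)) st mul1r eqSS.
transitivity (\sum_(l < (\sum_(k < p) d)%N) a l * (l == 0%N :> nat)%:R).
  by apply: eq_bigr => l _; rewrite pv // ss.
have N0 : (0 < \sum_(k < p) d)%N.
  by rewrite sum_nat_const card_ord muln_gt0 p_gt0 (leq_ltn_trans (leq0n i)).
have -> : (Cc *m (Mc ^+ n) *m Bc) i j = a 0%N by rewrite /a P0 mulmx1.
move: N0; clear; move: (\sum_(k < p) d)%N => [|N] // _.
rewrite big_ord_recl /= mulr1 big1 ?addr0 // => l _.
by rewrite mulr0.
Qed.

End Residues.


Section GeneratingFunctions.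
Variable R : realType.
Implicit Types (a b : nat -> R) (t : R).

Definition geometric_bound a := exists M K : R, [/\ 0 <= M, 0 <= K &
  forall k, `|a k| <= M * K ^+ k].

(** The exponential generating function of [a]. *)
Definition egf a t : R := limn (pseries (fun k => a k / k`!%:R) t).

Definition shift_seq (T : Type) (a : nat -> T) : nat -> T := fun k => a k.+1.

Lemma geometric_bound_shift a : geometric_bound a -> geometric_bound (shift_seq a).
Proof.
move=> [M [K [M0 K0 aP]]]; exists (M * K), K; split => //; first exact: mulr_ge0.
by move=> k; rewrite -mulrA -exprS; apply: aP.
Qed.

Lemma geometric_boundD a b : geometric_bound a -> geometric_bound b ->
  geometric_bound (fun k => a k + b k).
Proof.
move=> [M [K [M0 K0 aP]]] [M' [K' [M0' K0' bP]]].
exists (M + M'), (K + K'); split; rewrite ?addr_ge0 // => k.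
rewrite (le_trans (ler_normD _ _)) // mulrDl; apply: lerD.
  by rewrite (le_trans (aP k)) // ler_wpM2l // lerXn2r ?nnegrE ?addr_ge0 // lerDl.
by rewrite (le_trans (bP k)) // ler_wpM2l // lerXn2r ?nnegrE ?addr_ge0 // lerDr.
Qed.

Lemma geometric_boundZ c a : geometric_bound a -> geometric_bound (fun k => c * a k).
Proof.
move=> [M [K [M0 K0 aP]]]; exists (`|c| * M), K; split => //; first exact: mulr_ge0.
by move=> k; rewrite normrM -mulrA ler_wpM2l.
Qed.

Lemma geometric_bound0 : geometric_bound (fun=> 0).
Proof. by exists 0, 0; split => // k; rewrite normr0 mul0r. Qed.

Lemma egf_cvg a t : geometric_bound a -> cvgn (pseries (fun k => a k / k`!%:R) t).
Proof.
move=> [M [K [M0 K0 aP]]]; apply: normed_cvg.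
have c : cvgn (series (M *: exp_coeff (K * `|t|))).
  by apply: is_cvg_seriesZ; apply: is_cvg_series_exp_coeff.
apply: series_le_cvg c => [n|n|n] /=; first by [].
  by rewrite mulr_ge0 // exp_coeff_ge0 // mulr_ge0.
rewrite !normrM normrX normfV normr_nat.
rewrite [leRHS](_ : _ = (M * K ^+ n) / n`!%:R * `|t| ^+ n); last first.
  rewrite -[LHS]/(M * ((K * `|t|) ^+ n / n`!%:R)) exprMn; ring.
by rewrite ler_wpM2r ?exprn_ge0 // ler_wpM2r ?invr_ge0.
Qed.

Lemma egf_diffs a : pseries_diffs (fun k => a k / k`!%:R) =
  (fun k => shift_seq a k / k`!%:R).
Proof.
apply/funext => k; rewrite /pseries_diffs /shift_seq factS natrM.
by rewrite invfM mulrCA mulVKf ?pnatr_eq0.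
Qed.

Lemma egf_derive a t : geometric_bound a ->
  is_derive t 1 (egf a) (egf (shift_seq a) t).
Proof.
move=> ga; have ga1 := geometric_bound_shift ga.
rewrite /egf -egf_diffs; apply: (@pseries_snd_diffs _ _ (`|t| + 1)).
- exact: egf_cvg.
- by rewrite egf_diffs; apply: egf_cvg.
- by rewrite !egf_diffs; apply: egf_cvg; apply: geometric_bound_shift.
- by rewrite [ltRHS]ger0_norm ?addr_ge0 // ltrDl.
Qed.

Lemma egfD a b t : geometric_bound a -> geometric_bound b ->
  egf (fun k => a k + b k) t = egf a t + egf b t.
Proof.
move=> ga gb; rewrite /egf -lim_seriesD; try exact: egf_cvg.
congr (limn (series _)); apply/funext => k /=.
by rewrite /GRing.add /= mulrDl mulrDl.
Qed.

Lemma egfZ c a t : geometric_bound a -> egf (fun k => c * a k) t = c * egf a t.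
Proof.
move=> ga; rewrite /egf -[RHS]lim_seriesZ; last exact: egf_cvg.
congr (limn (series _)); apply/funext => k /=.
by rewrite -[RHS]/(c * (a k / k`!%:R * t ^+ k)) !mulrA.
Qed.

Lemma egf0 a : egf a 0 = a 0%N.
Proof.
rewrite /egf; apply: cvg_lim => //.
rewrite -(cvg_shiftn 1) /=; apply: cvg_near_cst; near=> n.
rewrite /pseries /series /= addn1 big_nat_recl //= big1 ?addr0.
  by rewrite fact0 expr0 divr1 mulr1.
by move=> i _; rewrite exprS mul0r mulr0.
Unshelve. all: by end_near. Qed.

End GeneratingFunctions.

Section ComplexGeneratingFunctions.
Variable R : realType.
Local Notation C := R[i].
Local Notation nrm := (@Normc.normc R).
Implicit Types (a b : nat -> C).

Definition cgeom a := exists M K : R, [/\ 0 <= M, 0 <= K &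
  forall k, nrm (a k) <= M * K ^+ k].

Definition cegf a (t : R) : C :=
  egf (fun k => complex.Re (a k)) t +i* egf (fun k => complex.Im (a k)) t.

Lemma cgeom_Re a : cgeom a -> geometric_bound (fun k => complex.Re (a k)).
Proof.
by move=> [M [K [M0 K0 aP]]]; exists M, K; split => // k; apply: le_trans (aP k); exact: abs_Re_le.
Qed.

Lemma cgeom_Im a : cgeom a -> geometric_bound (fun k => complex.Im (a k)).
Proof.
by move=> [M [K [M0 K0 aP]]]; exists M, K; split => // k; apply: le_trans (aP k); exact: abs_Im_le.
Qed.

Lemma cgeom_shift a : cgeom a -> cgeom (shift_seq a).
Proof.
move=> [M [K [M0 K0 aP]]]; exists (M * K), K; split => //; first exact: mulr_ge0.
by move=> k; rewrite -mulrA -exprS; apply: aP.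
Qed.

Lemma cgeomD a b : cgeom a -> cgeom b -> cgeom (fun k => a k + b k).
Proof.
move=> [M [K [M0 K0 aP]]] [M' [K' [M0' K0' bP]]].
exists (M + M'), (K + K'); split; rewrite ?addr_ge0 // => k.
rewrite (le_trans (le_normcD _ _)) // mulrDl; apply: lerD.
  by rewrite (le_trans (aP k)) // ler_wpM2l // lerXn2r ?nnegrE ?addr_ge0 // lerDl.
by rewrite (le_trans (bP k)) // ler_wpM2l // lerXn2r ?nnegrE ?addr_ge0 // lerDr.
Qed.

Lemma cgeomZ (c : C) a : cgeom a -> cgeom (fun k => c * a k).
Proof.
move=> [M [K [M0 K0 aP]]]; exists (nrm c * M), K; split => //.
  by rewrite mulr_ge0 // normc_ge0.
by move=> k; rewrite Normc.normcM -mulrA ler_wpM2l // normc_ge0.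
Qed.

Lemma cgeom0 : cgeom (fun=> 0).
Proof. by exists 0, 0; split => // k; rewrite Normc.normc0 mul0r. Qed.

Lemma cgeom_sum (I : Type) (r : seq I) (a : I -> nat -> C) :
  (forall i, cgeom (a i)) -> cgeom (fun k => \sum_(i <- r) a i k).
Proof.
move=> ga; elim: r => [|i r IH].
  by rewrite (_ : (fun k => _) = fun=> 0); [exact: cgeom0|apply/funext => k; rewrite big_nil].
rewrite (_ : (fun k => _) = fun k => a i k + \sum_(i <- r) a i k); first exact: cgeomD.
by apply/funext => k; rewrite big_cons.
Qed.

Lemma cegf_derive a t : cgeom a -> cderiv (cegf a) t (cegf (shift_seq a) t).
Proof.
by move=> ga; split; apply: egf_derive; [exact: cgeom_Re|exact: cgeom_Im].
Qed.

Lemma cegfD a b t : cgeom a -> cgeom b ->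
  cegf (fun k => a k + b k) t = cegf a t + cegf b t.
Proof.
move=> ga gb; apply: complex_ext; rewrite ?cReD ?cImD /= -egfD //;
  try exact: cgeom_Re; try exact: cgeom_Im.
  by congr egf; apply/funext => k; rewrite cReD.
by congr egf; apply/funext => k; rewrite cImD.
Qed.

Lemma cegfZ (c : C) a t : cgeom a -> cegf (fun k => c * a k) t = c * cegf a t.
Proof.
move=> ga; have gR := cgeom_Re ga; have gI := cgeom_Im ga.
apply: complex_ext; rewrite ?cReM ?cImM /=.
  rewrite -!egfZ // -mulN1r -egfZ; last exact: geometric_boundZ.
  rewrite -egfD; [|exact: geometric_boundZ|by do 2 apply: geometric_boundZ].
  by congr egf; apply/funext => k; rewrite cReM mulN1r.
rewrite -!egfZ // -egfD; [|exact: geometric_boundZ|exact: geometric_boundZ].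
by congr egf; apply/funext => k; rewrite cImM.
Qed.

Lemma cegf0 a : cegf a 0 = a 0%N.
Proof. by apply: complex_ext; rewrite /= egf0. Qed.

Lemma cegf_zero t : cegf (fun=> 0) t = 0.
Proof.
rewrite (_ : (fun=> 0) = fun k : nat => 0 * (0 : C)); last by apply/funext => k; rewrite mul0r.
by rewrite cegfZ ?mul0r //; exact: cgeom0.
Qed.

Lemma cegf_sum (I : Type) (r : seq I) (a : I -> nat -> C) t :
  (forall i, cgeom (a i)) ->
  cegf (fun k => \sum_(i <- r) a i k) t = \sum_(i <- r) cegf (a i) t.
Proof.
move=> ga; elim: r => [|i r IH].
  rewrite big_nil -[RHS](cegf_zero t); congr cegf.
  by apply/funext => k; rewrite big_nil.
rewrite big_cons -IH -cegfD //; last exact: cgeom_sum.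
by congr cegf; apply/funext => k; rewrite big_cons.
Qed.

Definition decays (f : R -> C) := exists M c : R, [/\ 0 < c, 0 <= M &
  forall t : R, 0 <= t -> nrm (f t) <= M * expR (- c * t)].

Lemma expR_lin_derive (c t : R) :
  is_derive t 1 (fun s => expR (c * s)) (c * expR (c * t)).
Proof.
have d : is_derive t 1 (fun s : R => c * s) c.
  have := is_deriveZ c (is_derive_id t (1 : R)).
  by rewrite /GRing.scale /= mulr1.
have := is_derive1_comp (f := expR) (is_derive_expR (c * t)) d.
by rewrite /comp mulrC.
Qed.

(** [w = cegf a] solves [w' = z w + g] with [g] decaying.  The squared modulus
    satisfies [(|w|^2)' <= - (k + c) |w|^2 + O(e^(-2ct))] with [k = - Re z]
    and any rate [c < k] of decay of [g], hence decays too. *)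
Lemma decays_step (z : C) a : cgeom a -> complex.Re z < 0 ->
  decays (cegf (fun k => a k.+1 - z * a k)) -> decays (cegf a).
Proof.
move=> ga zneg [M [c0 [c00 M0 gP]]].
pose k := - complex.Re z; have k0 : 0 < k by rewrite oppr_gt0.
pose c := Num.min (c0 / 2) (k / 2).
have c_gt0 : 0 < c by rewrite lt_min !divr_gt0.
have c1 : c <= c0 / 2 by rewrite /c ge_min lexx.
have c2 : c <= k / 2 by rewrite /c ge_min lexx orbT.
have cc0 : c <= c0 by lra.
have ck : c < k by lra.
have dk : 0 < k - c by rewrite subr_gt0.
pose w := cegf a; pose g t := cegf (shift_seq a) t - z * w t.
have gE (t : R) : g t = cegf (fun k => a k.+1 - z * a k) t.
  rewrite (_ : (fun k => _) = fun k => shift_seq a k + (- z) * a k); last first.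
    by apply/funext => j; rewrite mulNr.
  by rewrite cegfD ?cegfZ ?mulNr //; [exact: cgeom_shift|exact: cgeomZ].
have gM (t : R) : 0 <= t -> nrm (g t) <= M * expR (- c * t).
  move=> t0; rewrite gE (le_trans (gP t t0)) // ler_wpM2l // ler_expR.
  by rewrite ler_wpM2r // lerN2.
have dw (t : R) : cderiv w t (z * w t + g t).
  by rewrite /g addrC subrK; apply: cegf_derive.
pose y t := sqnorm (w t).
pose K := M ^+ 2 / (k - c) ^+ 2.
(* h is nonincreasing, so y is bounded by its value at 0 plus K. *)
pose h t := y t * expR ((k + c) * t) - K * expR ((k - c) * t).
have dh (t : R) : is_derive t (1 : R) h
   ((complex.Re (w t) * complex.Re (z * w t + g t) *+ 2 +
     complex.Im (w t) * complex.Im (z * w t + g t) *+ 2 + (k + c) * y t)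
     * expR ((k + c) * t) - K * (k - c) * expR ((k - c) * t)).
  have [d1 d2] := dw t.
  have := expR_lin_derive (k + c) t; have := expR_lin_derive (k - c) t.
  pose e1 := fun s : R => expR ((k + c) * s); pose e2 := fun s : R => expR ((k - c) * s).
  move=> de2 de1.
  rewrite (_ : h = ((fun s => complex.Re (w s)) ^+ 2 + (fun s => complex.Im (w s)) ^+ 2)
    * e1 - (K \*: e2)); last by apply/funext.
  apply: is_derive_eq; rewrite /GRing.scale /= /y /sqnorm !expr1.
  rewrite -[(_ + _ : R -> R) t]/((complex.Re (w t)) ^+ 2 + (complex.Im (w t)) ^+ 2) /e1.
  by ring.
have hle (t : R) : 0 <= t -> h t <= h 0.
  move=> t0; have [|s s0t hE] := MVT_segment t0 (fun s _ => dh s).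
    by apply: continuous_in_subspaceT => s _; apply: is_derive_cont (dh s).
  have s0 : 0 <= s by move: s0t; rewrite in_itv /= => /andP[].
  rewrite -subr_le0 hE subr0 mulr_le0_ge0 //.
  have E : expR ((k - c) * s) = expR (- c * s) ^+ 2 * expR ((k + c) * s).
    by rewrite expr2 -!expRD; congr expR; ring.
  rewrite E mulrA -mulrBl pmulr_lle0 ?expR_gt0 //.
  have := gM s s0; set G := nrm _ => hG.
  have G0 : 0 <= G by apply: normc_ge0.
  have G2 : sqnorm (g s) <= M ^+ 2 * expR (- c * s) ^+ 2.
    by rewrite -normc_sq -exprMn lerXn2r ?nnegrE ?mulr_ge0 ?expR_ge0.
  rewrite cReD cImD cReM cImM /y /sqnorm.
  rewrite (_ : K * (k - c) * _ = (M ^+ 2 * expR (- c * s) ^+ 2) / (k - c)); last first.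
    by rewrite /K; field; rewrite lt0r_neq0.
  rewrite subr_le0; apply: le_trans (_ : sqnorm (g s) / (k - c) <= _); last first.
    by rewrite ler_pM2r ?invr_gt0.
  rewrite ler_pdivlMr // /sqnorm (_ : complex.Re z = - k); last by rewrite opprK.
  move: (complex.Re (w s)) (complex.Im (w s)) (complex.Re (g s)) (complex.Im (g s)) (complex.Im z).
  move=> u v g1 g2 zi.
  have := sqr_ge0 ((k - c) * u - g1); have := sqr_ge0 ((k - c) * v - g2).
  rewrite !sqrrB !expr2; move: dk; set del := k - c.
  rewrite (_ : (_ + _) * (k - c) = 2 * del * (u * g1 + v * g2) - del * del * (u * u + v * v)).
    by move=> *; lra.
  by rewrite /del; ring.
exists (Num.sqrt (y 0 + K)), c; split; [by []|exact: sqrtr_ge0|].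
move=> t t0; have := hle t t0; rewrite /h !mulr0 !expR0 !mulr1 => H.
have y00 : 0 <= y 0 by rewrite /y addr_ge0 ?sqr_ge0.
have K0 : 0 <= K by rewrite divr_ge0 ?sqr_ge0.
have yK : 0 <= y 0 + K by exact: addr_ge0.
have sq0 : 0 <= Num.sqrt (y 0 + K) by exact: sqrtr_ge0.
rewrite -(ler_pXn2r (n := 2)) ?nnegrE ?normc_ge0 ?mulr_ge0 ?sqrtr_ge0 ?expR_ge0 //.
rewrite normc_sq exprMn. rewrite sqr_sqrtr //. rewrite -[sqnorm _]/(y t).
have e0 : 0 < expR ((k + c) * t) by apply: expR_gt0.
rewrite -(ler_pM2r e0).
have -> : (y 0 + K) * expR (- c * t) ^+ 2 * expR ((k + c) * t) = (y 0 + K) * expR ((k - c) * t).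
  by rewrite -mulrA expr2 -!expRD; congr (_ * expR _); ring.
have e1 : 1 <= expR ((k - c) * t) by rewrite -expR0 ler_expR mulr_ge0 // ltW.
have : y 0 * 1 <= y 0 * expR ((k - c) * t) by rewrite ler_wpM2l.
by rewrite mulr1 [(y 0 + K) * _]mulrDl; lra.
Qed.

End ComplexGeneratingFunctions.


Section MatrixExponential.
Variable R : realType.
Local Notation C := R[i].
Local Notation nrm := (@Normc.normc R).

Lemma cvg_complex (u : nat -> C) (z : C) :
  complex.Re (u n) @[n --> \oo] --> complex.Re z ->
  complex.Im (u n) @[n --> \oo] --> complex.Im z ->
  (u : nat -> C^o) n @[n --> \oo] --> (z : C^o).
Proof.
move=> /cvgrPdist_lt cR /cvgrPdist_lt cI; apply/cvgrPdist_lt => e e0.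
have eE : e = (complex.Re e)%:C.
  by move: e0; rewrite ltcE => /andP[/eqP /= e1 _]; apply: complex_ext.
have e1 : 0 < complex.Re e / 2 by move: e0; rewrite eE ltcR => h; rewrite divr_gt0.
near=> n; rewrite eE /Num.norm /= ltcR (le_lt_trans (normc_le _)) //.
rewrite (splitr (complex.Re e)) cReD cImD cReN cImN; apply: ltrD.
  by near: n; apply: cR.
by near: n; apply: cI.
Unshelve. all: by end_near. Qed.

Lemma cvg_complex_unique (u : nat -> C) (z w : C) :
  (u : nat -> C^o) n @[n --> \oo] --> (z : C^o) ->
  complex.Re (u n) @[n --> \oo] --> complex.Re w ->
  complex.Im (u n) @[n --> \oo] --> complex.Im w -> z = w.
Proof.
move=> uz uR uI; have uw := cvg_complex uR uI.
exact: (cvg_unique (@norm_hausdorff _ C^o) uz uw).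
Qed.

Lemma cvg_matrix (n m : nat) (u : nat -> 'M[C^o]_(n, m)) (l : 'M[C^o]_(n, m)) :
  (forall i j, (fun k => u k i j) @ \oo --> l i j) -> u @ \oo --> l.
Proof.
move=> ul A [P lP PA].
have F ij : \forall k \near \oo, P ij.1 ij.2 (u k ij.1 ij.2).
  by case: ij => i j; apply: ul.
have := @filter_forall _ _ _ _ eventually_filter F.
by apply: filterS => k Pk; apply: PA => i j; exact: (Pk (i, j)).
Qed.

Lemma exp_scale n (S : 'M[C]_n) (t : C) k : (t *: S) ^+ k = t ^+ k *: S ^+ k.
Proof.
elim: k => [|k IH]; first by rewrite !expr0 scale1r.
by rewrite !exprS IH -!mulmxE; rewrite -scalemxAl -scalemxAr scalerA.
Qed.

Lemma exp_entry_bound n (S : 'M[C]_n) : exists2 K : R, 0 <= K &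
  forall k i j, nrm ((S ^+ k) i j) <= K ^+ k.
Proof.
exists (\sum_i \sum_j nrm (S i j)).
  by apply: sumr_ge0 => i _; apply: sumr_ge0 => j _; apply: normc_ge0.
set K := \sum_i _.
elim=> [|k IH] i j.
  by rewrite !expr0 mxE; case: eqP; rewrite ?Normc.normc1 // Normc.normc0.
rewrite exprS mxE exprS.
apply: (@le_trans _ _ (\sum_l nrm (S i l) * K ^+ k)).
  apply: (@le_trans _ _ (\sum_l nrm (S i l * (S ^+ k) l j))).
    elim/big_rec2: _ => [|l x y _ h]; first by rewrite Normc.normc0.
    by rewrite (le_trans (le_normcD _ _)) // lerD2l.
  by apply: ler_sum => l _; rewrite Normc.normcM ler_wpM2l ?normc_ge0.
rewrite -mulr_suml ler_wpM2r //.
  by apply: le_trans (IH i j); apply: normc_ge0.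
rewrite /K [leRHS](bigD1 i) //= lerDl; apply: sumr_ge0 => l _.
by apply: sumr_ge0 => l' _; apply: normc_ge0.
Qed.

Lemma cgeom_exp n (S : 'M[C]_n) i j : cgeom (fun k => (S ^+ k) i j).
Proof.
have [K K0 SK] := exp_entry_bound S.
by exists 1, K; split => // k; rewrite mul1r.
Qed.

Lemma cgeom_sandwich d n m (P : 'M[C]_(d, n)) (S : 'M[C]_n) (Q : 'M[C]_(n, m)) i j :
  cgeom (fun k => (P *m S ^+ k *m Q) i j).
Proof.
rewrite (_ : (fun k => _) = fun k => \sum_l Q l j * \sum_l' P i l' * (S ^+ k) l' l).
  apply: cgeom_sum => l; apply: cgeomZ; apply: cgeom_sum => l'; apply: cgeomZ.
  exact: cgeom_exp.
apply/funext => k; rewrite mxE; apply: eq_bigr => l _.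
by rewrite mxE mulrC.
Qed.

Lemma mexpE n (S : 'M[C]_n) (t : R) i j :
  mexp (t%:C *: S) i j = cegf (fun k => (S ^+ k) i j) t.
Proof.
pose s : nat -> 'M[C^o]_n := series (fun k => (k`!%:R : C)^-1 *: (t%:C *: S) ^+ k : 'M[C^o]_n).
pose l : 'M[C^o]_n := \matrix_(i, j) cegf (fun k => (S ^+ k) i j) t.
have sE k i' j' : s k i' j' = \sum_(0 <= r < k) ((r`!%:R : C)^-1 * (t%:C ^+ r * (S ^+ r) i' j')).
  rewrite /s /series /= summxE; apply: eq_bigr => r _.
  by rewrite exp_scale !mxE.
have rE r : (r`!%:R : C)^-1 = ((r`!%:R)^-1)%:C by rewrite fmorphV rmorph_nat.
have tE r : (t%:C ^+ r : C) = (t ^+ r)%:C by rewrite rmorphXn.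
have cR i' j' : complex.Re (s k i' j') @[k --> \oo] --> complex.Re (l i' j').
  have := @egf_cvg _ _ t (cgeom_Re (cgeom_exp S i' j')); rewrite mxE /=.
  rewrite (_ : (fun k => complex.Re (s k i' j')) =
    pseries (fun k => complex.Re ((S ^+ k) i' j') / k`!%:R) t) //.
  apply/funext => k; rewrite sE /pseries /series /=.
  elim/big_rec2: _ => [//|r x y _ <-].
  by rewrite cReD rE tE !cReM /= !mul0r !subr0; congr (_ + _); ring.
have cI i' j' : complex.Im (s k i' j') @[k --> \oo] --> complex.Im (l i' j').
  have := @egf_cvg _ _ t (cgeom_Im (cgeom_exp S i' j')); rewrite mxE /=.
  rewrite (_ : (fun k => complex.Im (s k i' j')) =
    pseries (fun k => complex.Im ((S ^+ k) i' j') / k`!%:R) t) //.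
  apply/funext => k; rewrite sE /pseries /series /=.
  elim/big_rec2: _ => [//|r x y _ <-].
  by rewrite cImD rE tE !cImM /= !mul0r !addr0; congr (_ + _); ring.
have sl : s @ \oo --> l.
  by apply: cvg_matrix => i' j'; apply: cvg_complex; [exact: cR|exact: cI].
have slim : s @ \oo --> limn s by apply/cvg_ex; exists l.
have H : (fun k => (s k i j : C^o)) @ \oo --> (limn s i j : C^o).
  apply: (@cvg_comp _ _ _ s (fun M : 'M[C^o]_n => M i j) \oo (nbhs (limn s))) => //.
  exact: coord_continuous.
have := cvg_complex_unique H (cR i j) (cI i j).
by rewrite /mexp -/s => ->; rewrite mxE.
Qed.

Lemma sandwich_mexp d n m (P : 'M[C]_(d, n)) (S : 'M[C]_n) (Q : 'M[C]_(n, m)) (t : R) i j :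
  (P *m mexp (t%:C *: S) *m Q) i j = cegf (fun k => (P *m S ^+ k *m Q) i j) t.
Proof.
rewrite (_ : (fun k => _) = fun k => \sum_l Q l j * \sum_l' P i l' * (S ^+ k) l' l); last first.
  apply/funext => k; rewrite mxE; apply: eq_bigr => l _.
  by rewrite mxE mulrC.
rewrite cegf_sum; last first.
  move=> l; apply: cgeomZ; apply: cgeom_sum => l'; apply: cgeomZ; exact: cgeom_exp.
rewrite mxE; apply: eq_bigr => l _; rewrite cegfZ; last first.
  by apply: cgeom_sum => l'; apply: cgeomZ; exact: cgeom_exp.
rewrite mulrC mxE cegf_sum; last by move=> l'; apply: cgeomZ; exact: cgeom_exp.
congr (_ * _); apply: eq_bigr => l' _; rewrite cegfZ ?mexpE //; exact: cgeom_exp.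
Qed.

Lemma mexp_mulE n m (S : 'M[C]_n) (Q : 'M[C]_(n, m)) (t : R) i j :
  (mexp (t%:C *: S) *m Q) i j = cegf (fun k => (S ^+ k *m Q) i j) t.
Proof.
rewrite -(mul1mx (mexp _)) sandwich_mexp; congr (cegf _ t); apply/funext => k.
by rewrite mul1mx.
Qed.

Lemma cgeom_mul n m (S : 'M[C]_n) (Q : 'M[C]_(n, m)) i j :
  cgeom (fun k => (S ^+ k *m Q) i j).
Proof.
rewrite (_ : (fun k => _) = fun k => (1%:M *m S ^+ k *m Q) i j).
  exact: cgeom_sandwich.
by apply/funext => k; rewrite mul1mx.
Qed.

(** The exponential of a stable matrix decays: by Cayley-Hamilton the
    sequence of powers is annihilated by the product of the factors
    [X - z] acting by shift, which are removed one at a time. *)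
Lemma mexp_decays n m (S : 'M[C]_n) (Q : 'M[C]_(n, m)) i j :
  (forall z, spectrum S z -> complex.Re z < 0) ->
  decays (cegf (fun k => (S ^+ k *m Q) i j)).
Proof.
case: n S Q i => [|n] S Q i; first by case: i.
move=> Sneg; have [r rE] := closed_field_poly_normal (char_poly S).
rewrite (eqP (char_poly_monic S)) scale1r in rE.
have rneg z : z \in r -> complex.Re z < 0.
  move=> zr; apply: Sneg; rewrite /spectrum /= eigenvalue_root_char rE root_prod_XsubC.
  exact: zr.
pose b s k := (horner_mx S (\prod_(z <- s) ('X - z%:P) * 'X^k) *m Q) i j.
have bE s k : b s k = (horner_mx S (\prod_(z <- s) ('X - z%:P)) *m S ^+ k *m Q) i j.
  by rewrite /b rmorphM /= rmorphXn /= horner_mx_X.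
have gb s : cgeom (b s).
  have -> : b s = fun k => (horner_mx S (\prod_(z <- s) ('X - z%:P)) *m S ^+ k *m Q) i j.
    by apply/funext => k; exact: bE.
  exact: cgeom_sandwich.
have br : decays (cegf (b r)).
  have -> : b r = fun=> 0.
    by apply/funext => k; rewrite bE -rE Cayley_Hamilton !mul0mx mxE.
  exists 0, 1; split => // t _; rewrite cegf_zero Normc.normc0 mul0r //.
suff H s : (forall z, z \in s -> complex.Re z < 0) -> decays (cegf (b s)) -> decays (cegf (b [::])).
  have := H r rneg br; rewrite (_ : b [::] = fun k => (S ^+ k *m Q) i j) //.
  by apply/funext => k; rewrite bE big_nil rmorph1 mul1mx.
elim: s => [//|z s IH] sneg dz; apply: IH => [w ws|].
  by apply: sneg; rewrite inE ws orbT.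
apply: (decays_step (gb s) (z := z)); first by apply: sneg; rewrite mem_head.
have -> : (fun k => b s k.+1 - z * b s k) = b (z :: s); last exact: dz.
apply/funext => k.
have pE : \prod_(w <- z :: s) ('X - w%:P) * 'X^k =
    \prod_(w <- s) ('X - w%:P) * 'X^(k.+1) - z%:P * (\prod_(w <- s) ('X - w%:P) * 'X^k).
  by rewrite big_cons exprS; ring.
rewrite /b pE rmorphB (rmorphM _ z%:P) /= horner_mx_C mulmxBl -[_%:M * _]/(_%:M *m _).
rewrite mul_scalar_mx -scalemxAl.
by rewrite [RHS]mxE; congr (_ + _); rewrite [RHS]mxE; congr (- _); rewrite [RHS]mxE.
Qed.

End MatrixExponential.


Section Paths.
Variable R : realType.
Implicit Types (l g h : R -> R) (a b t u : R) (s : nat -> R).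

Definition rcll l := forall t, l x @[x --> t^'+] --> l t /\ cvg (l x @[x --> t^'-]).

Lemma rcll_right l t e : rcll l -> 0 < e ->
  exists2 d, 0 < d & forall u, t <= u < t + d -> `|l u - l t| < e.
Proof.
move=> lP e0; have [/cvgrPdist_lt/(_ e e0) + _] := lP t.
move=> /nbhs_ballP[d d0 dP]; exists d => // u /andP[tu ud].
have [<-|ne] := eqVneq t u; first by rewrite subrr normr0.
rewrite distrC; apply: dP => /=; last by rewrite lt_neqAle ne.
by rewrite /ball /= ltr_distl; apply/andP; split; lra.
Qed.

Lemma rcll_left l t : rcll l ->
  exists2 d, 0 < d & exists M, forall u, t - d < u < t -> `|l u| <= M.
Proof.
move=> lP; have [_ /cvg_ex[/= z /cvgrPdist_lt/(_ 1 ltr01)]] := lP t.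
move=> /nbhs_ballP[d d0 dP]; exists d => //; exists (`|z| + 1) => u /andP[tu ud].
have : `|z - l u| < 1.
  by apply: dP => //=; rewrite /ball /= ltr_distl; apply/andP; split; lra.
have := ler_normD (l u - z) z; rewrite subrK distrC; lra.
Qed.

Lemma rcll_bounded l a b : rcll l -> exists2 M, 0 <= M & forall u, a <= u <= b -> `|l u| <= M.
Proof.
move=> lP; have := @segment_compact R a b; rewrite compact_near_coveringP => cov.
have := cov R (pinfty_nbhs R) (fun M u => `|l u| <= M) _ _.
case=> [u _|M [Mr MP]].
  have [d1 d10 d1P] := rcll_right u lP ltr01.
  have [d2 d20 [M1 M1P]] := rcll_left u lP.
  exists ([set v | `|u - v| < Num.min d1 d2], [set M | Num.max M1 (`|l u| + 1) < M]).
    split => /=; last by exists (Num.max M1 (`|l u| + 1)); split => //; rewrite num_real.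
    by apply/nbhs_ballP; exists (Num.min d1 d2) => //=; rewrite lt_min d10.
  move=> [v M] /= []; rewrite lt_min gt_max => /andP[v1 v2] /andP[MM1 Ml].
  have [uv|vu] := leP u v.
    have := d1P v; rewrite uv /= => /(_ _).
    have h : v < u + d1 by move: v1; rewrite ltr_distl => /andP[]; lra.
    move=> /(_ h); have := ler_normD (l v - l u) (l u); rewrite subrK; lra.
  have : u - d2 < v < u by rewrite vu andbT; move: v2; rewrite ltr_distl => /andP[]; lra.
  by move=> /M1P; lra.
exists (Num.max 0 (M + 1)); first by rewrite le_max lexx.
move=> u uab; rewrite le_max; apply/orP; right; apply: (MP (M + 1)) => //.
by rewrite ltrDl.
Qed.

Definition monotone_upto n s := forall i, (i < n)%N -> s i <= s i.+1.

Lemma monotone_le n s i j : monotone_upto n s -> (i <= j)%N -> (j <= n)%N -> s i <= s j.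
Proof.
move=> ms; elim: j => [|j IH]; first by rewrite leqn0 => /eqP ->.
rewrite leq_eqVlt => /predU1P[->//|ij jn].
by apply: le_trans (ms _ jn); apply: IH => //; apply: ltnW.
Qed.

(** The left-continuous step function with value [v i] on [(s i, s i.+1]]. *)
Fixpoint step_fun (s : nat -> R) (v : nat -> R) (n : nat) (u : R) : R :=
  if n is n'.+1 then if s n' < u then v n' else step_fun s v n' u else 0.

Lemma step_funE s v n i u : monotone_upto n s -> (i < n)%N -> s i < u <= s i.+1 ->
  step_fun s v n u = v i.
Proof.
elim: n => // n IH ms; rewrite ltnS leq_eqVlt => /predU1P[->|lt_in] /andP[su us] /=.
  by rewrite su.
rewrite ltNge (le_trans us) /=; last exact: (monotone_le ms lt_in).
by apply: IH; rewrite ?su // => k kn; apply: ms; apply: ltnW.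
Qed.

Lemma locate n s u : monotone_upto n s -> s 0%N < u <= s n ->
  exists2 i, (i < n)%N & s i < u <= s i.+1.
Proof.
elim: n => [|n IH] ms /andP[su us].
  by move: (lt_le_trans su us); rewrite ltxx.
have [h|h] := leP u (s n); last by exists n => //; rewrite h.
have [||i lt_in iP] := IH; first by move=> k kn; apply: ms; apply: ltnW.
  by rewrite su.
by exists i => //; apply: ltnW.
Qed.

Lemma intg_steps n s f : monotone_upto n s ->
  (forall i, (i < n)%N -> intg (s i) (s i.+1) f) -> intg (s 0%N) (s n) f.
Proof.
move=> ms; elim: n ms => [|n IH] ms fi.
  by rewrite /intg set_itv_ge ?bnd_simp ?ltxx //; exact: integrable_set0.
apply: (@intg_split _ _ (s n)); [exact: (monotone_le ms)|exact: ms| |exact: fi].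
by apply: IH => i ni; [apply: ms|apply: fi]; apply: ltnW.
Qed.

Lemma Int_steps n s f : monotone_upto n s -> intg (s 0%N) (s n) f ->
  Int (s 0%N) (s n) f = \sum_(i < n) Int (s i) (s i.+1) f.
Proof.
elim: n => [|n IH] ms fi; first by rewrite big_ord0 Int_ge.
have sn : s 0%N <= s n by apply: (monotone_le ms).
rewrite big_ord_recr /= -IH; last by apply: intg_sub fi => //; exact: ms.
  by apply: Int_split => //; exact: ms.
by move=> i ni; apply: ms; apply: ltnW.
Qed.

(* An integrand times a step function. *)
Lemma intg_step n s v f : monotone_upto n s ->
  (forall i, (i < n)%N -> intg (s i) (s i.+1) f) ->
  intg (s 0%N) (s n) (fun u => f u * step_fun s v n u).
Proof.
move=> ms fi; apply: intg_steps => // i ni.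
apply: (@intg_eq _ _ _ (fun u => v i * f u)); last by apply: intgZ; exact: fi.
move=> u /andP[su us]; rewrite (step_funE v ms ni) 1?mulrC //.
by rewrite su ltW.
Qed.

Lemma Int_step n s v f : monotone_upto n s ->
  (forall i, (i < n)%N -> intg (s i) (s i.+1) f) ->
  Int (s 0%N) (s n) (fun u => f u * step_fun s v n u) =
  \sum_(i < n) v i * Int (s i) (s i.+1) f.
Proof.
move=> ms fi; rewrite Int_steps //; last exact: intg_step.
apply: eq_bigr => i _; rewrite -IntZ; last exact: fi.
apply/esym/Int_eq; last by apply: intgZ; exact: fi.
move=> u /andP[su us]; rewrite (step_funE v ms (ltn_ord i)) 1?mulrC //.
by rewrite su ltW.
Qed.

Definition riemann_sum g l n s := \sum_(i < n) g (s i) * (l (s i.+1) - l (s i)).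

Lemma summation_by_parts g l n s : riemann_sum g l n s =
  g (s n) * l (s n) - g (s 0%N) * l (s 0%N)
  - \sum_(i < n) l (s i.+1) * (g (s i.+1) - g (s i)).
Proof.
rewrite /riemann_sum; elim: n => [|n IH]; first by rewrite !big_ord0 subrr subr0.
by rewrite !big_ord_recr /= IH; ring.
Qed.

Definition C1_pair g g' := (forall u, is_derive u 1 g (g' u)) /\ continuous g'.

Lemma C1_cont g g' : C1_pair g g' -> continuous g.
Proof. by move=> [dg _] u; apply: differentiable_continuous; apply/derivable1_diffP; have [] := dg u. Qed.

Lemma cont_bounded h a b : continuous h -> exists2 M, 0 <= M & forall u, a <= u <= b -> `|h u| <= M.
Proof.
move=> ch; apply: rcll_bounded => t; split.
  by apply: cvg_at_right_filter; exact: ch.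
by apply/cvg_ex; exists (h t); apply: cvg_at_left_filter; exact: ch.
Qed.

Definition parts_integral g g' l a b :=
  g b * l b - g a * l a - Int a b (fun u => g' u * l u).

(** Riemann-Stieltjes sums against a path with right-continuous left-limited
    values converge, by summation by parts and dominated convergence: the
    values at the right endpoints converge by right continuity. *)
Lemma riemann_sum_cvg g g' l a b (n : nat -> nat) (s : nat -> nat -> R) (d : nat -> R) :
  a <= b -> C1_pair g g' -> rcll l ->
  (forall k, partition_of a b (n k) (s k)) ->
  (forall k i, (i < n k)%N -> s k i.+1 - s k i < d k) -> d @ \oo --> 0 ->
  intg a b (fun u => g' u * l u) /\
  riemann_sum g l (n k) (s k) @[k --> \oo] --> parts_integral g g' l a b.
Proof.
move=> ab [dg cg'] lP sP sd d0.
have [M1 M10 M1P] := cont_bounded a b cg'.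
have [M2 M20 M2P] := rcll_bounded a b lP.
pose st k := step_fun (s k) (fun i => l (s k i.+1)) (n k).
have ms k : monotone_upto (n k) (s k) by have [] := sP k.
have g'i c e : intg c e g' by apply: intg_cont => u _; exact: cg'.
have fi k : intg a b (fun u => g' u * st k u).
  have [sa sb _] := sP k; rewrite -{1}sa -{1}sb; apply: intg_step => // i _; exact: g'i.
have srange k i : (i <= n k)%N -> a <= s k i <= b.
  move=> ik; have [sa sb _] := sP k; rewrite -sa -sb.
  by rewrite !(monotone_le (ms k)).
have bd k u : a < u <= b -> `|g' u * st k u| <= M1 * M2.
  move=> uab; have [sa sb _] := sP k.
  have [|i ik iP] := @locate (n k) (s k) u (ms k); first by rewrite sa sb.
  rewrite /st (step_funE _ (ms k) ik iP) normrM ler_pM //.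
    by apply: M1P; case/andP: uab => /ltW -> ->.
  by apply: M2P; apply: srange.
have cv u : a < u <= b -> g' u * st k u @[k --> \oo] --> g' u * l u.
  move=> uab; apply: cvgM; first exact: cvg_cst.
  apply/cvgrPdist_lt => e e0; have [de de0 deP] := rcll_right u lP e0.
  have /cvgrPdist_lt/(_ de de0) dde := d0.
  near=> k; have [sa sb _] := sP k.
  have [|i ik iP] := @locate (n k) (s k) u (ms k); first by rewrite sa sb.
  rewrite /st (step_funE _ (ms k) ik iP) distrC; apply: deP.
  case/andP: iP => su us; rewrite us /=.
  have : `|0 - d k| < de by near: k; exact: dde.
  rewrite sub0r normrN => dk; have := sd k i ik; have := ler_norm (d k); lra.
have [gli c] := Int_dominated fi bd cv.
split => //.
have E k : riemann_sum g l (n k) (s k) = g b * l b - g a * l a - Int a b (fun u => g' u * st k u).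
  have [sa sb _] := sP k.
  have := Int_step (fun i => l (s k i.+1)) (ms k) (fun i _ => g'i (s k i) (s k i.+1)).
  rewrite sa sb /st => ->; rewrite summation_by_parts sa sb.
  congr (_ - _); apply: eq_bigr => i _; congr (_ * _).
  apply/esym/Int_FTC; last by move=> u _; exact: cg'.
  exact: ms.
rewrite (_ : (fun k => _) = fun k => g b * l b - g a * l a - Int a b (fun u => g' u * st k u)).
  by apply: cvgB => //; exact: cvg_cst.
by apply/funext => k; rewrite E.
Unshelve. all: by end_near. Qed.

End Paths.


Section Paths2.
Variable R : realType.
Implicit Types (l g h e : R -> R) (a b t u : R).

Definition uniform_part a b (k i : nat) : R := a + (b - a) * i%:R / k.+1%:R.
Definition uniform_mesh a b (k : nat) : R := (`|b - a| + 1) * k.+1%:R^-1.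

Lemma uniform_part_of a b k : a <= b -> partition_of a b k.+1 (uniform_part a b k).
Proof.
move=> ab; split; rewrite /uniform_part.
- by rewrite mulr0 mul0r addr0.
- by rewrite mulfK ?pnatr_eq0 // addrC subrK.
- move=> i _; rewrite lerD2l ler_wpM2r ?invr_ge0 // ler_wpM2l ?subr_ge0 //.
  by rewrite ler_nat.
Qed.

Lemma uniform_part_mesh a b k i : uniform_part a b k i.+1 - uniform_part a b k i < uniform_mesh a b k.
Proof.
rewrite /uniform_part /uniform_mesh -natr1.
rewrite (_ : _ - _ = (b - a) * k.+1%:R^-1); last by ring.
rewrite ltr_pM2r ?invr_gt0 ?ltr0n //.
by rewrite (le_lt_trans (ler_norm _)) // ltrDl.
Qed.

Lemma uniform_mesh_cvg a b : uniform_mesh a b @ \oo --> 0.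
Proof.
rewrite -[0](mulr0 (`|b - a| + 1)); apply: cvgM; first exact: cvg_cst.
exact: cvg_harmonic.
Qed.

Lemma C1_id : C1_pair (id : R -> R) (fun=> 1).
Proof. by split; [move=> u; exact: is_derive_id|move=> u; exact: cst_continuous]. Qed.

Lemma intg_rcll l a b : rcll l -> intg a b l.
Proof.
move=> lP; have [ab|ba] := leP a b; last first.
  by rewrite /intg set_itv_ge ?bnd_simp -?leNgt // ?ltW//; exact: integrable_set0.
have [+ _] := @riemann_sum_cvg R id (fun=> 1) l a b (fun k => k.+1) (uniform_part a b)
  (uniform_mesh a b) ab C1_id lP (fun k => uniform_part_of k ab)
  (fun k i _ => uniform_part_mesh a b k i) (uniform_mesh_cvg a b).
by apply: intg_eq => u _; rewrite mul1r.
Qed.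

Lemma intg_contM h l a b : continuous h -> intg a b l -> intg a b (fun u => h u * l u).
Proof.
move=> ch li; have [M M0 MP] := cont_bounded a b ch.
have := @integrableMr _ _ _ (@lebesgue_measure R) `]a, b]%classic _ h (EFin \o l) _ _ li.
apply => //.
  by apply: measurable_funTS; apply: continuous_measurable_fun.
exists M; split; first by rewrite num_real.
move=> K MK u; rewrite /= in_itv /= => /andP[au ub].
by apply: le_trans (ltW MK); apply: MP; rewrite ltW.
Qed.

(** Integration by parts with an integrand [h] that is merely bounded and
    integrable: the Riemann-Stieltjes sums of [e] against the primitive of
    [h] are integrals of [h] against left step functions of [e]. *)
Lemma integral_by_parts e e' h a t : a <= t -> C1_pair e e' ->
  (forall x y, intg x y h) ->
  (forall x y, exists2 M, 0 <= M & forall u, x <= u <= y -> `|h u| <= M) ->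
  [/\ intg a t (fun r => e' r * Int a r h), intg a t (fun u => e u * h u) &
    e t * Int a t h = Int a t (fun r => e' r * Int a r h) + Int a t (fun u => e u * h u)].
Proof.
move=> at_ eC hi hb; pose H r := Int a r h.
have Hlip x y M : a <= x -> x <= y -> (forall u, x <= u <= y -> `|h u| <= M) ->
    `|H y - H x| <= M * (y - x).
  move=> ax xy MP; rewrite /H (@Int_split _ a x y) // addrAC subrr add0r.
  by apply: Int_bound => // u /andP[xu uy]; apply: MP; rewrite ltW.
have Hneg x : x <= a -> H x = 0 by move=> xa; rewrite /H Int_ge.
have cH : continuous H.
  move=> x; have [M M0 MP] := hb (x - 1) (x + 1).
  have K u v : x - 1 <= u -> u <= v -> v <= x + 1 -> `|H v - H u| <= M * (v - u).
    move=> xu uv vx; have [ua|au] := leP a u.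
      by apply: Hlip => // r /andP[ur rv]; apply: MP; rewrite (le_trans xu) // (le_trans rv).
    rewrite (Hneg u) ?(ltW au) //; have [va|av] := leP a v; last first.
      by rewrite Hneg ?(ltW av) // subrr normr0 mulr_ge0 // subr_ge0.
    rewrite -(Hneg a) //; apply: le_trans (_ : M * (v - a) <= _).
      apply: Hlip => // r /andP[ar rv]; apply: MP.
      by rewrite (le_trans xu) ?(le_trans (ltW au)) // (le_trans rv).
    by rewrite ler_wpM2l // lerB // ltW.
  apply/cvgrPdist_lt => eps eps0.
  have eps1 : 0 < Num.min 1 (eps / (M + 1)).
    by rewrite lt_min ltr01 divr_gt0 // ltr_wpDl.
  near=> y.
  have : `|x - y| < Num.min 1 (eps / (M + 1)) by near: y; apply/nbhs_ballP; exists (Num.min 1 (eps / (M + 1))).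
  rewrite lt_min => /andP[y1 y2].
  have yM : M * `|x - y| < eps.
    move: y2; rewrite ltr_pdivlMr ?ltr_wpDl // mulrDr mulr1 mulrC => y2.
    by apply: le_lt_trans y2; rewrite lerDl.
  apply: le_lt_trans yM; move: y1; rewrite ltr_distl => /andP[y1 y3].
  have [xy|yx] := leP x y.
    by rewrite distrC (distrC x) (ger0_norm (_ : 0 <= y - x)) ?subr_ge0 //; apply: K; lra.
  by rewrite (ger0_norm (_ : 0 <= x - y)) ?subr_ge0 ?(ltW yx) //; apply: K; lra.
have rH : rcll H.
  move=> x; split; first by apply: cvg_at_right_filter; exact: cH.
  by apply/cvg_ex; exists (H x); apply: cvg_at_left_filter; exact: cH.
have := @riemann_sum_cvg R e e' H a t (fun k => k.+1) (uniform_part a t)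
  (uniform_mesh a t) at_ eC rH (fun k => uniform_part_of k at_)
  (fun k i _ => uniform_part_mesh a t k i) (uniform_mesh_cvg a t).
rewrite /parts_integral (Hneg a) // mulr0 subr0 => -[i1 c1].
have ce := C1_cont eC.
pose st k := step_fun (uniform_part a t k) (fun i => e (uniform_part a t k i)) k.+1.
have pk k := uniform_part_of k at_.
have ms k : monotone_upto k.+1 (uniform_part a t k) by have [] := pk k.
have E k : riemann_sum e H k.+1 (uniform_part a t k) = Int a t (fun u => h u * st k u).
  have [sa sb _] := pk k.
  have := Int_step (fun i => e (uniform_part a t k i)) (ms k) (fun i _ => hi _ _).
  rewrite sa sb /st => ->; apply: eq_bigr => i _; congr (_ * _).
  rewrite /H (@Int_split _ a (uniform_part a t k i)) //.
  - by rewrite addrAC subrr add0r.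
  - by have := monotone_le (ms k) (leq0n i) (ltnW (ltn_ord i)); rewrite sa.
  - exact: ms.
have [M1 M10 M1P] := cont_bounded a t ce.
have [M2 M20 M2P] := hb a t.
have fi k : intg a t (fun u => h u * st k u).
  by have [sa sb _] := pk k; have := intg_step (fun i => e (uniform_part a t k i)) (ms k) (fun i _ => hi _ _);
    rewrite sa sb.
have bd k u : a < u <= t -> `|h u * st k u| <= M2 * M1.
  move=> uab; have [sa sb _] := pk k.
  have [|i ik iP] := @locate R k.+1 (uniform_part a t k) u (ms k); first by rewrite sa sb.
  rewrite /st (step_funE _ (ms k) ik iP) normrM ler_pM //.
    by apply: M2P; case/andP: uab => /ltW -> ->.
  apply: M1P; have := monotone_le (ms k) (leq0n i) (ltnW ik).
  have := monotone_le (ms k) (ltnW ik) (leqnn _).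
  by rewrite sa sb => -> ->.
have cv u : a < u <= t -> h u * st k u @[k --> \oo] --> h u * e u.
  move=> uab; apply: cvgM; first exact: cvg_cst.
  apply/cvgrPdist_lt => eps eps0.
  have /cvgrPdist_lt/(_ eps eps0)/nbhs_ballP[de de0 deP] := ce u.
  have /cvgrPdist_lt/(_ de de0) dde := uniform_mesh_cvg a t.
  near=> k; have [sa sb _] := pk k.
  have [|i ik iP] := @locate R k.+1 (uniform_part a t k) u (ms k); first by rewrite sa sb.
  rewrite /st (step_funE _ (ms k) ik iP); apply: deP.
  rewrite /ball /=; case/andP: iP => su us.
  have : `|0 - uniform_mesh a t k| < de by near: k; exact: dde.
  rewrite sub0r normrN => dk; have mi := uniform_part_mesh a t k i.
  rewrite ger0_norm ?subr_ge0 ?(ltW su) //.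
  by have := ler_norm (uniform_mesh a t k); lra.
have [hei c2] := Int_dominated fi bd cv.
have c1' : Int a t (fun u => h u * st k u) @[k --> \oo] --> e t * H t - Int a t (fun u => e' u * H u).
  by move: c1; rewrite (_ : (fun k => _) = fun k => Int a t (fun u => h u * st k u)) //; apply/funext => k; rewrite E.
have := cvg_unique _ c1' c2 => /(_ (@norm_hausdorff _ R)) hE.
split => //; first by apply: intg_eq hei => u _; rewrite mulrC.
rewrite -[Int a t h]/(H t) -[LHS](subrK (Int a t (fun u => e' u * H u))) hE addrC.
by congr (_ + Int _ _ _); apply/funext => u; rewrite mulrC.
Unshelve. all: by end_near. Qed.

End Paths2.


Section RealExponential.
Variables (R : realType) (n : nat) (M : 'M[R]_n).

Lemma geom_pow d m (P : 'M[R]_(d, n)) (Q : 'M[R]_(n, m)) i j :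
  geometric_bound (fun k => (P *m M ^+ k *m Q) i j).
Proof.
have := cgeom_Re (cgeom_sandwich (cplx_mx P) (cplx_mx M) (cplx_mx Q) i j).
rewrite (_ : (fun k => complex.Re _) = fun k => (P *m M ^+ k *m Q) i j) //.
apply/funext => k.
have -> : cplx_mx M ^+ k = cplx_mx (M ^+ k).
  elim: k => [|k IH]; first by rewrite !expr0 /cplx_mx map_mx1.
  by rewrite !exprS IH -!mulmxE /cplx_mx map_mxM.
by rewrite /cplx_mx -!map_mxM mxE.
Qed.

Lemma geom_entry i j : geometric_bound (fun k => (M ^+ k) i j).
Proof.
rewrite (_ : (fun k => _) = fun k => (1%:M *m M ^+ k *m 1%:M) i j); first exact: geom_pow.
by apply/funext => k; rewrite mul1mx mulmx1.
Qed.

Definition rexp (t : R) : 'M[R]_n := \matrix_(i, j) egf (fun k => (M ^+ k) i j) t.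

Lemma egf_sum (I : Type) (r : seq I) (a : I -> nat -> R) t :
  (forall i, geometric_bound (a i)) ->
  geometric_bound (fun k => \sum_(i <- r) a i k) /\
  egf (fun k => \sum_(i <- r) a i k) t = \sum_(i <- r) egf (a i) t.
Proof.
move=> ga; elim: r => [|i r [gr IH]].
  rewrite big_nil (_ : (fun k => _) = fun=> 0); last by apply/funext => k; rewrite big_nil.
  split; first exact: geometric_bound0.
  rewrite (_ : (fun=> 0) = fun k : nat => 0 * (0 : R)); last by apply/funext => k; rewrite mul0r.
  by rewrite egfZ ?mul0r //; exact: geometric_bound0.
rewrite (_ : (fun k => _) = fun k => a i k + \sum_(i <- r) a i k); last first.
  by apply/funext => k; rewrite big_cons.
by split; [exact: geometric_boundD|rewrite big_cons -IH egfD].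
Qed.

Lemma rexp_mul m (Q : 'M[R]_(n, m)) t i j :
  (rexp t *m Q) i j = egf (fun k => (M ^+ k *m Q) i j) t.
Proof.
rewrite (_ : (fun k => _) = fun k => \sum_l Q l j * (M ^+ k) i l); last first.
  by apply/funext => k; rewrite mxE; apply: eq_bigr => l _; rewrite mulrC.
have [|_ ->] := @egf_sum _ (index_enum 'I_n) (fun l k => Q l j * (M ^+ k) i l) t.
  by move=> l; apply: geometric_boundZ; exact: geom_entry.
rewrite mxE; apply: eq_bigr => l _; rewrite egfZ; last exact: geom_entry.
by rewrite mxE mulrC.
Qed.

Lemma mul_rexp m (P : 'M[R]_(m, n)) t i j :
  (P *m rexp t) i j = egf (fun k => (P *m M ^+ k) i j) t.
Proof.
rewrite (_ : (fun k => _) = fun k => \sum_l P i l * (M ^+ k) l j); last first.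
  by apply/funext => k; rewrite mxE.
have [|_ ->] := @egf_sum _ (index_enum 'I_n) (fun l k => P i l * (M ^+ k) l j) t.
  by move=> l; apply: geometric_boundZ; exact: geom_entry.
rewrite mxE; apply: eq_bigr => l _; rewrite egfZ; last exact: geom_entry.
by rewrite mxE.
Qed.

Lemma rexp_comm t : M *m rexp t = rexp t *m M.
Proof.
apply/matrixP => i j; rewrite rexp_mul mul_rexp; congr (egf _ t).
by apply/funext => k; rewrite mulmxE -exprS exprSr.
Qed.

Lemma rexp0 : rexp 0 = 1%:M.
Proof. by apply/matrixP => i j; rewrite mxE egf0 expr0. Qed.

Lemma rexp_derive t i j : is_derive t (1 : R) (fun s => rexp s i j) ((M *m rexp t) i j).
Proof.
rewrite mul_rexp (_ : (fun s => _) = egf (fun k => (M ^+ k) i j)); last first.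
  by apply/funext => s; rewrite mxE.
have := egf_derive t (geom_entry i j).
by rewrite (_ : shift_seq _ = fun k => (M *m M ^+ k) i j) //; apply/funext => k; rewrite /shift_seq exprS.
Qed.

Lemma rexp_derive_neg t i j :
  is_derive t (1 : R) (fun s => rexp (- s) i j) (- (M *m rexp (- t)) i j).
Proof.
have d : is_derive t (1 : R) (fun s : R => - s) (-1) by exact: is_deriveNid.
have := is_derive1_comp (f := fun s => rexp s i j) (rexp_derive (- t) i j) d.
by rewrite mulrN1.
Qed.

Lemma rexp_derive_shift c t i j :
  is_derive t (1 : R) (fun s => rexp (s + c) i j) ((M *m rexp (t + c)) i j).
Proof.
have d : is_derive t (1 : R) (fun s : R => s + c) 1.
  by apply: is_derive_eq; rewrite ?addr0.
have := @is_derive1_comp _ (fun s : R => rexp s i j) (fun s : R => s + c) t _ _ (rexp_derive (t + c) i j) d.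
by rewrite mulr1.
Qed.

Lemma derive0_cst (f : R -> R) : (forall t, is_derive t (1 : R) f 0) -> forall t, f t = f 0.
Proof.
move=> df t.
have H x y : x <= y -> f y = f x.
  move=> xy; have [|c _] := MVT_segment xy (fun s _ => df s).
    by apply: continuous_in_subspaceT => s _; apply: is_derive_cont (df s).
  by rewrite mul0r => /eqP; rewrite subr_eq0 => /eqP.
by have [t0|t0] := leP 0 t; [rewrite (H 0 t)|rewrite (H t 0) // ltW].
Qed.

(* The product below has zero derivative. *)
Lemma rexp_add_neg t c : rexp (- t) *m rexp (t + c) = rexp c.
Proof.
apply/matrixP => i j.
have d u : is_derive u (1 : R) (fun s => (rexp (- s) *m rexp (s + c)) i j) 0.
  rewrite (_ : (fun s => _) = \sum_(k < n) ((fun s : R => rexp (- s) i k) * (fun s : R => rexp (s + c) k j))); last first.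
    by apply/funext => s; rewrite fct_sumE mxE.
  have dd k : is_derive u (1 : R) ((fun s : R => rexp (- s) i k) * (fun s : R => rexp (s + c) k j))
      (rexp (- u) i k * (M *m rexp (u + c)) k j - (rexp (- u) *m M) i k * rexp (u + c) k j).
    have d1 := rexp_derive_neg u i k; have d2 := rexp_derive_shift c u k j.
    apply: is_derive_eq; rewrite /GRing.scale /= -rexp_comm; ring.
  have := is_derive_sum dd; rewrite sumrB.
  rewrite (_ : _ - _ = 0) //.
  have e1 : \sum_k rexp (- u) i k * (M *m rexp (u + c)) k j = (rexp (- u) *m (M *m rexp (u + c))) i j.
    by rewrite [RHS]mxE.
  have e2 : \sum_k (rexp (- u) *m M) i k * rexp (u + c) k j = (rexp (- u) *m M *m rexp (u + c)) i j.
    by rewrite [RHS]mxE.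
  by rewrite e1 e2 mulmxA subrr.
by rewrite (derive0_cst d t) oppr0 add0r rexp0 mul1mx.
Qed.

Lemma rexpD t c : rexp (t + c) = rexp t *m rexp c.
Proof.
have h : rexp (- t) *m rexp t = 1%:M.
  by rewrite -{2}[t]addr0 rexp_add_neg rexp0.
by rewrite -(rexp_add_neg t c) mulmxA (mulmx1C h) mul1mx.
Qed.

Lemma rexp_C1 i j : C1_pair (fun s => rexp s i j) (fun s => (M *m rexp s) i j).
Proof.
split => [u|]; first exact: rexp_derive.
move=> u; rewrite (_ : (fun s => _) = egf (fun k => (M *m M ^+ k) i j)); last first.
  by apply/funext => s; rewrite mul_rexp.
apply: (is_derive_cont (l := _)); apply: egf_derive.
rewrite (_ : (fun k => _) = shift_seq (fun k => (M ^+ k) i j)).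
  by apply: geometric_bound_shift; exact: geom_entry.
by apply/funext => k; rewrite /shift_seq exprS.
Qed.

End RealExponential.


Section Rcll.
Variable R : realType.
Implicit Types (l g h e : R -> R) (a b t u : R).

Lemma rcll_cont h : continuous h -> rcll h.
Proof.
move=> ch t; split; first by apply: cvg_at_right_filter; exact: ch.
by apply/cvg_ex; exists (h t); apply: cvg_at_left_filter; exact: ch.
Qed.

Lemma rcllD g h : rcll g -> rcll h -> rcll (fun u => g u + h u).
Proof.
move=> gP hP t; have [g1 g2] := gP t; have [h1 h2] := hP t.
by split; [exact: cvgD|exact: is_cvgD].
Qed.

Lemma rcllM g h : rcll g -> rcll h -> rcll (fun u => g u * h u).
Proof.
move=> gP hP t; have [g1 g2] := gP t; have [h1 h2] := hP t.
by split; [exact: cvgM|exact: is_cvgM].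
Qed.

Lemma rcll_cst (k : R) : rcll (fun=> k).
Proof. by apply: rcll_cont => u; exact: cst_continuous. Qed.

Lemma rcll_sum (I : Type) (r : seq I) (f : I -> R -> R) :
  (forall i, rcll (f i)) -> rcll (fun u => \sum_(i <- r) f i u).
Proof.
move=> fP; elim: r => [|i r IH].
  by rewrite (_ : (fun u => _) = fun=> 0); [exact: rcll_cst|apply/funext => u; rewrite big_nil].
rewrite (_ : (fun u => _) = fun u => f i u + \sum_(i <- r) f i u); first exact: rcllD.
by apply/funext => u; rewrite big_cons.
Qed.

Lemma continuous_bigsum (I : Type) (r : seq I) (f : I -> R -> R) :
  (forall i, continuous (f i)) -> continuous (fun u => \sum_(i <- r) f i u).
Proof.
move=> cf; elim: r => [|i r IH].
  by rewrite (_ : (fun u => _) = fun=> 0); [move=> u; exact: cvg_cst|apply/funext => u; rewrite big_nil].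
rewrite (_ : (fun u => _) = fun u => f i u + \sum_(i <- r) f i u).
  by move=> u; apply: cvgD; [exact: cf|exact: IH].
by apply/funext => u; rewrite big_cons.
Qed.

Lemma cadlag_rcll n (f : R -> 'cV[R]_n) i : cadlag f -> rcll (fun t => f t i 0).
Proof.
move=> fP t; have [f1 /cvg_ex[/= z f2]] := fP t; split.
  by apply: (@cvg_comp _ _ _ f (fun v : 'cV[R]_n => v i 0) _ (nbhs (f t))) => //; exact: coord_continuous.
apply/cvg_ex; exists (z i 0).
by apply: (@cvg_comp _ _ _ f (fun v : 'cV[R]_n => v i 0) _ (nbhs z)) => //; exact: coord_continuous.
Qed.

Lemma rcll_cadlag n (f : R -> 'cV[R]_n) : (forall i, rcll (fun t => f t i 0)) -> cadlag f.
Proof.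
move=> fP t.
have cvgmx (F : set_system R) (l : 'cV[R]_n) : Filter F ->
    (forall i, f x i 0 @[x --> F] --> l i 0) -> f x @[x --> F] --> l.
  move=> FF fl A [P lP PA].
  have H ij : \forall x \near F, P ij.1 ij.2 (f x ij.1 ij.2).
    by case: ij => i j /=; rewrite (ord1 j); apply: fl; have := lP i 0.
  have := @filter_forall _ _ _ _ FF H.
  by apply: filterS => x Px; apply: PA => i j; exact: (Px (i, j)).
split; first by apply: cvgmx => i; have [] := fP i t.
apply/cvg_ex; exists (\col_i lim (f x i 0 @[x --> t^'-])).
by apply: cvgmx => i; rewrite mxE; have [_] := fP i t.
Qed.

Lemma Int_sum (I : Type) (r : seq I) (f : I -> R -> R) a b :
  (forall i, intg a b (f i)) ->
  intg a b (fun u => \sum_(i <- r) f i u) /\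
  Int a b (fun u => \sum_(i <- r) f i u) = \sum_(i <- r) Int a b (f i).
Proof.
move=> fi; elim: r => [|i r [IH1 IH2]].
  rewrite big_nil (_ : (fun u => _) = fun=> 0); last by apply/funext => u; rewrite big_nil.
  split; first exact: intg_cst.
  by rewrite /Int Rintegral_cst //= mul0r.
rewrite (_ : (fun u => _) = fun u => f i u + \sum_(i <- r) f i u); last first.
  by apply/funext => u; rewrite big_cons.
by split; [exact: intgD|rewrite IntD // IH2 big_cons].
Qed.

End Rcll.

Section Duhamel.
Variables (R : realType) (n m : nat) (M : 'M[R]_n) (B : 'M[R]_(n, m)).
Variable l : R -> 'cV[R]_m.
Hypothesis lP : cadlag l.
Implicit Types (a t u : R).

Definition duhamel a t : 'cV[R]_n :=
  \col_i Int a t (fun u => (rexp M (t - u) *m (M *m B) *m l u) i 0).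

Lemma rcll_mulmx d (F : R -> 'M[R]_(d, m)) i :
  (forall j, continuous (fun u => F u i j)) -> rcll (fun u => (F u *m l u) i 0).
Proof.
move=> cF; rewrite (_ : (fun u => _) = fun u => \sum_j F u i j * l u j 0).
  by apply: rcll_sum => j; apply: rcllM; [exact: rcll_cont|exact: cadlag_rcll].
by apply/funext => u; rewrite mxE.
Qed.

Lemma cont_mulmx d k (F : R -> 'M[R]_(d, k)) (Q : 'M[R]_(k, m)) i j :
  (forall r, continuous (fun u => F u i r)) -> continuous (fun u => (F u *m Q) i j).
Proof.
move=> cF; rewrite (_ : (fun u => _) = fun u => \sum_r F u i r * Q r j).
  by apply: continuous_bigsum => r u; apply: cvgM; [exact: cF|exact: cvg_cst].
by apply/funext => u; rewrite mxE.
Qed.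

Lemma cont_rexp i j : continuous (fun u : R => rexp M u i j).
Proof. exact: (C1_cont (rexp_C1 M i j)). Qed.

(** Duhamel's formula: [rexp M (t - u)] splits as [rexp M t *m rexp M (- u)],
    and integration by parts in [t] turns the product into an integral. *)
Lemma duhamelE a t i : a <= t ->
  intg a t (fun r => (M *m (duhamel a r + B *m l r)) i 0) /\
  duhamel a t i 0 = Int a t (fun r => (M *m (duhamel a r + B *m l r)) i 0).
Proof.
move=> at_.
pose h k u := (rexp M (- u) *m (M *m B) *m l u) k 0.
have rh k : rcll (h k).
  apply: rcll_mulmx => j; apply: cont_mulmx => r u.
  apply: (@continuous_comp _ _ _ (fun v : R => - v) (fun v => rexp M v k r)).
    exact: opp_continuous.
  exact: cont_rexp.
have hi k x y : intg x y (h k) by apply: intg_rcll.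
have hb k x y := rcll_bounded x y (rh k).
have dE r j : duhamel a r j 0 = \sum_k rexp M r j k * Int a r (h k).
  rewrite mxE; under [RHS]eq_bigr do rewrite -IntZ //.
  have [|_ <-] := @Int_sum R _ (index_enum 'I_n) (fun k u => rexp M r j k * h k u) a r.
    by move=> k; apply: intgZ.
  congr Int; apply/funext => u; rewrite rexpD -!mulmxA mxE.
  by apply: eq_bigr => k _; rewrite /h -!mulmxA.
have IP k := integral_by_parts at_ (rexp_C1 M i k) (hi k) (hb k).
pose f1 k r := (M *m rexp M r) i k * Int a r (h k).
pose f2 k r := rexp M r i k * h k r.
have i1 k : intg a t (f1 k) by have [] := IP k.
have i2 k : intg a t (f2 k) by have [] := IP k.
have [j1 e1] := Int_sum (index_enum 'I_n) i1.
have [j2 e2] := Int_sum (index_enum 'I_n) i2.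
have E : (fun r => (M *m (duhamel a r + B *m l r)) i 0) =
    fun r => \sum_k f1 k r + \sum_k f2 k r.
  apply/funext => r; rewrite mulmxDr mxE; congr (_ + _).
    rewrite mxE; under eq_bigr do rewrite dE mulr_sumr.
    rewrite exchange_big /=; apply: eq_bigr => k _.
    rewrite /f1 [(M *m _) i k]mxE mulr_suml; apply: eq_bigr => k' _.
    by rewrite mulrA.
  have : rexp M r *m (rexp M (- r) *m (M *m B) *m l r) = M *m B *m l r.
    by rewrite !mulmxA -rexpD subrr rexp0 mul1mx.
  rewrite (mulmxA M B) => <-; rewrite mxE; exact: eq_bigr.
rewrite E; split; first exact: intgD.
rewrite IntD // e1 e2 -big_split dE; apply: eq_bigr => k _ /=.
by have [_ _ ->] := IP k.
Qed.

End Duhamel.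

Section Tails.
Variable R : realType.
Implicit Types (l g : R -> R) (a b t u : R).

Lemma Int_expR (c K a b : R) : 0 < c -> a <= b ->
  intg a b (fun u => K * expR (c * u)) /\
  Int a b (fun u => K * expR (c * u)) = K / c * (expR (c * b) - expR (c * a)).
Proof.
move=> c0 ab.
have ce : continuous (fun u : R => expR (c * u)).
  by move=> u; apply: is_derive_cont (expR_lin_derive c u).
have ei : intg a b (fun u => expR (c * u)) by apply: intg_cont => u _; exact: ce.
split; first exact: intgZ.
have dF u : is_derive u (1 : R) (fun u : R => c^-1 * expR (c * u)) (expR (c * u)).
  have := is_deriveZ c^-1 (expR_lin_derive c u).
  by rewrite /GRing.scale /= mulKf // lt0r_neq0.
rewrite IntZ // (@Int_FTC _ a b _ (fun u : R => c^-1 * expR (c * u)) ab) //.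
  by rewrite -mulrBr mulrA.
Qed.

Lemma parts_tail g g' l a b t c eps M K : C1_pair g g' -> rcll l ->
  0 < eps -> eps < c -> 0 <= M -> 0 <= K ->
  (forall u, u <= t -> `|g u| <= M * expR (c * u)) ->
  (forall u, u <= t -> `|g' u| <= M * expR (c * u)) ->
  (forall u, u <= t -> `|l u| <= K * expR (- eps * u)) ->
  a <= b -> b <= t ->
  `|parts_integral g g' l a t - parts_integral g g' l b t| <=
     M * K * (2 + (c - eps)^-1) * expR ((c - eps) * b).
Proof.
move=> [dg cg'] lP e0 ec M0 K0 gM g'M lK ab bt.
have at_ : a <= t by apply: le_trans bt.
have g'l x y : intg x y (fun u => g' u * l u) by apply: intg_contM => //; exact: intg_rcll.
rewrite /parts_integral (@Int_split _ a b t) //.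
rewrite (_ : _ - _ = g b * l b - g a * l a - Int a b (fun u => g' u * l u)); last by ring.
have dc : 0 < c - eps by rewrite subr_gt0.
have EE u : expR (c * u) * expR (- eps * u) = expR ((c - eps) * u).
  by rewrite -expRD; congr expR; ring.
have prod f u : (forall u, u <= t -> `|f u| <= M * expR (c * u)) -> u <= t ->
    `|f u * l u| <= M * K * expR ((c - eps) * u).
  move=> fM ut; rewrite normrM -EE mulrACA; apply: ler_pM => //; [exact: fM|exact: lK].
have mono : expR ((c - eps) * a) <= expR ((c - eps) * b) by rewrite ler_expR ler_pM2l.
have [ei eI] := Int_expR (M * K) dc ab.
have I1 : `|Int a b (fun u => g' u * l u)| <= M * K / (c - eps) * expR ((c - eps) * b).
  apply: le_trans (Int_abs (g'l _ _)) _.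
  apply: le_trans (_ : Int a b (fun u => M * K * expR ((c - eps) * u)) <= _).
    apply: Int_le => //; first by apply: intg_abs.
    by move=> u /andP[_ ub]; apply: prod g'M _; apply: le_trans bt.
  rewrite eI ler_wpM2l ?divr_ge0 ?mulr_ge0 ?(ltW dc) //.
  by rewrite lerBlDr lerDl expR_ge0.
have I2 := prod g b gM bt; have I3 := prod g a gM at_.
have I4 : M * K * expR ((c - eps) * a) <= M * K * expR ((c - eps) * b).
  by rewrite ler_wpM2l // mulr_ge0.
rewrite mulrDr mulrDl; have := ler_normB (g b * l b) (g a * l a).
have := ler_normB (g b * l b - g a * l a) (Int a b (fun u => g' u * l u)).
by rewrite mulrAC in I1 *; lra.
Qed.

(** A function on a left half-line with an exponential Cauchy bound. *)
Lemma ninfty_limit (I : R -> R) t D c : 0 < c -> 0 <= D ->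
  (forall a b, a <= b -> b <= t -> `|I a - I b| <= D * expR (c * b)) ->
  I (- k%:R) @[k --> \oo] --> limn (fun k => I (- k%:R)) /\
  forall a, a <= t -> `|I a - limn (fun k => I (- k%:R))| <= D * expR (c * a).
Proof.
move=> c0 D0 HI.
have cv : cvgn (fun k => I (- k%:R)).
  apply: cauchy_cvg; apply/cauchy_exP => e e0.
  have ex : exists N : nat, - N%:R <= t /\ D * expR (c * - N%:R) < e.
    have d0 : 0 < e / (D + 1) by rewrite divr_gt0 // ltr_wpDl.
    pose y := Num.min t (ln (e / (D + 1)) / c).
    exists (Num.bound `|y|); have yb := archi_boundP (normr_ge0 y).
    have yB : - (Num.bound `|y|)%:R <= y by have := ler_norm (- y); rewrite normrN; lra.
    split; first by apply: le_trans yB _; rewrite ge_min lexx.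
    apply: (@le_lt_trans _ _ (D * (e / (D + 1)))).
      rewrite ler_wpM2l // -[leRHS]lnK ?posrE // ler_expR mulrC -ler_pdivlMr //.
      by apply: le_trans yB _; rewrite ge_min lexx orbT.
    have D1 : 0 < D + 1 by lra.
    by rewrite mulrA ltr_pdivrMr // mulrDr mulr1 mulrC; lra.
  have [N [Nt ND]] := ex.
  have near_ball : \forall k \near \oo, ball (I (- N%:R)) e (I (- k%:R)).
    near=> k; rewrite /ball /= distrC; apply: le_lt_trans ND; apply: HI => //.
    by rewrite lerN2 ler_nat; near: k; exists N.
  by exists (I (- N%:R)); exact: near_ball.
split; first exact: cv.
move=> a at_; have cn : `|I a - I (- k%:R)| @[k --> \oo] --> `|I a - limn (fun k => I (- k%:R))|.
  by apply: cvg_norm; apply: cvgB => //; exact: cvg_cst.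
apply: (cvgr_to_le cn); near=> k.
have ka : - k%:R <= a.
  have := archi_boundP (normr_ge0 a); have : (Num.bound `|a|)%:R <= k%:R :> R.
    by rewrite ler_nat; near: k; exists (Num.bound `|a|).
  by have := ler_norm (- a); rewrite normrN; lra.
by rewrite distrC; apply: HI.
Unshelve. all: by end_near. Qed.

End Tails.


Section ScalarKernels.
Variable R : realType.
Implicit Types (a : nat -> R) (l : R -> R) (b s t u T : R).

Definition kernel_integral a l b t : R :=
  parts_integral (fun u => egf a (t - u)) (fun u => - egf (shift_seq a) (t - u)) l b t.

Definition kernel_limit a l t : R := limn (fun k => kernel_integral a l (- k%:R) t).

Definition decaying a := exists M c : R, [/\ 0 < c, 0 <= M &
  forall s, 0 <= s -> `|egf a s| <= M * expR (- c * s) /\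
    `|egf (shift_seq a) s| <= M * expR (- c * s)].

Definition subexponential l := forall eps, 0 < eps ->
  exists2 K : R, 0 <= K & forall u, u <= 0 -> `|l u| <= K * expR (- eps * u).

Lemma subexponential_le l t eps : rcll l -> subexponential l -> 0 < eps ->
  exists2 K : R, 0 <= K & forall u, u <= t -> `|l u| <= K * expR (- eps * u).
Proof.
move=> lP ls e0; have [K K0 KP] := ls eps e0.
have [K' K'0 K'P] := rcll_bounded 0 t lP.
exists (K + K' * expR (eps * `|t|)); first by rewrite addr_ge0 // mulr_ge0 // expR_ge0.
move=> u ut; rewrite mulrDl; have [u0|u0] := leP u 0.
  by rewrite (le_trans (KP u u0)) // lerDl !mulr_ge0 ?expR_ge0.
apply: (@le_trans _ _ (K' * 1)); first by rewrite mulr1; apply: K'P; rewrite ltW.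
apply: (@le_trans _ _ (K' * expR (eps * `|t|) * expR (- eps * u))); last first.
  by rewrite lerDr mulr_ge0 ?expR_ge0.
rewrite -mulrA ler_wpM2l // -expRD -expR0 ler_expR.
have := ler_norm t; nra.
Qed.

Lemma kernel_C1 a t : geometric_bound a ->
  C1_pair (fun u => egf a (t - u)) (fun u => - egf (shift_seq a) (t - u)).
Proof.
move=> ga.
have K c : geometric_bound c -> forall u, is_derive u (1 : R) (fun u : R => egf c (t - u)) (- egf (shift_seq c) (t - u)).
  move=> gc u.
  have d : is_derive u (1 : R) (fun s : R => t - s) (-1).
    by have := is_deriveB (is_derive_cst t u (1 : R)) (is_derive_id u (1 : R)); rewrite sub0r.
  have := @is_derive1_comp _ (egf c) (fun s : R => t - s) u _ _ (egf_derive (t - u) gc) d.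
  by rewrite mulrN1.
split; first exact: K.
move=> u; apply: cvgN.
by apply: is_derive_cont (K _ (geometric_bound_shift ga) u).
Qed.

Lemma kernel_limit_bound a l s T : geometric_bound a -> decaying a -> rcll l ->
  subexponential l -> s <= T -> exists D c : R, [/\ 0 < c, 0 <= D,
    (forall t b, s <= t <= T -> b <= s -> `|egf a (t - b) * l b| <= D * expR (c * b)) &
    (forall t b, s <= t <= T -> b <= s ->
      `|kernel_integral a l b t - kernel_limit a l t| <= D * expR (c * b))].
Proof.
move=> ga [M [c [c0 M0 aP]]] lP ls sT.
have e0 : 0 < c / 2 by rewrite divr_gt0.
have ec : c / 2 < c by lra.
have [K K0 KP] := subexponential_le T lP ls e0.
have dc : 0 < c - c / 2 by lra.
have C0 : 0 <= (c - c / 2)^-1 by rewrite invr_ge0 ltW.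
pose M' := M * expR (- c * s).
have M'0 : 0 <= M' by rewrite mulr_ge0 ?expR_ge0.
have ext (f : R -> R) t : s <= t -> (forall r, 0 <= r -> `|f r| <= M * expR (- c * r)) ->
    forall u, u <= t -> `|f (t - u)| <= M' * expR (c * u).
  move=> st fM u ut; have h : 0 <= t - u by rewrite subr_ge0.
  apply: le_trans (fM _ h) _; rewrite /M' -mulrA ler_wpM2l // -expRD ler_expR.
  by nra.
have a1 r : 0 <= r -> `|egf a r| <= M * expR (- c * r) by move=> /aP[].
have a2 r : 0 <= r -> `|egf (shift_seq a) r| <= M * expR (- c * r) by move=> /aP[].
pose D := M' * K * (2 + (c - c / 2)^-1).
have D0 : 0 <= D by rewrite !mulr_ge0 // addr_ge0.
exists D, (c - c / 2); split => //.
  move=> t b /andP[st tT] bs; rewrite normrM.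
  have bt : b <= t by apply: le_trans st.
  apply: (@le_trans _ _ (M' * expR (c * b) * (K * expR (- (c / 2) * b)))).
    by apply: ler_pM => //; [exact: (ext _ t)|apply: KP; apply: le_trans tT].
  rewrite mulrACA -expRD /D (_ : c * b + - (c / 2) * b = (c - c / 2) * b); last by ring.
  rewrite ler_wpM2r ?expR_ge0 // ler_peMr ?mulr_ge0 //; lra.
move=> t b /andP[st tT] bs.
have HI b1 b2 : b1 <= b2 -> b2 <= t ->
    `|kernel_integral a l b1 t - kernel_integral a l b2 t| <= D * expR ((c - c / 2) * b2).
  move=> b12 b2t; apply: (parts_tail (kernel_C1 t ga) lP e0 ec M'0 K0) => //.
  - by move=> u ut; exact: (ext _ t st a1).
  - by move=> u ut; rewrite normrN; exact: (ext _ t st a2).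
  - by move=> u ut; apply: KP; apply: le_trans tT.
have [_ H] := ninfty_limit dc D0 HI.
by apply: H; apply: le_trans st.
Qed.

Lemma kernel_integral_cvg a l b t (n : nat -> nat) (s : nat -> nat -> R) (d : nat -> R) :
  geometric_bound a -> rcll l -> b <= t ->
  (forall k, partition_of b t (n k) (s k)) ->
  (forall k i, (i < n k)%N -> s k i.+1 - s k i < d k) -> d @ \oo --> 0 ->
  riemann_sum (fun u => egf a (t - u)) l (n k) (s k) @[k --> \oo] --> kernel_integral a l b t.
Proof.
move=> ga lP bt sP sd d0.
by have [_ +] := riemann_sum_cvg bt (kernel_C1 t ga) lP sP sd d0.
Qed.

Lemma expR_ninfty (D c : R) (b : nat -> R) : 0 < c -> (forall k, b k <= - k%:R) ->
  D * expR (c * b k) @[k --> \oo] --> 0.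
Proof.
move=> c0 bk; rewrite -[0](mulr0 D); apply: cvgM; first exact: cvg_cst.
have h : expR (- c) ^+ k @[k --> \oo] --> 0.
  apply: cvg_expr; rewrite ger0_norm ?expR_ge0 // -[ltRHS]expR0 ltr_expR; lra.
apply: (@squeeze_cvgr _ _ _ _ (fun=> 0) (fun k => expR (- c) ^+ k)) => //.
  near=> k; rewrite expR_ge0 /= -expRM_natl ler_expR.
  by have := bk k; nra.
exact: cvg_cst.
Unshelve. all: by end_near. Qed.

Lemma kernel_limit_cvg a l t (b : nat -> R) : geometric_bound a -> decaying a -> rcll l ->
  subexponential l -> (forall k, b k <= - k%:R) ->
  kernel_integral a l (b k) t @[k --> \oo] --> kernel_limit a l t.
Proof.
move=> ga da lP ls bk.
have [D [c [c0 D0 _ H]]] := kernel_limit_bound ga da lP ls (lexx t).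
apply/cvgrPdist_lt => e e0.
have /cvgrPdist_lt/(_ e e0) De := expR_ninfty D c0 bk.
near=> k; rewrite distrC; apply: (@le_lt_trans _ _ (D * expR (c * b k))).
  apply: H; rewrite ?lexx //; apply: le_trans (bk k) _.
  have := archi_boundP (normr_ge0 t); have : (Num.bound `|t|)%:R <= k%:R :> R.
    by rewrite ler_nat; near: k; exists (Num.bound `|t|).
  by have := ler_norm (- t); rewrite normrN; lra.
have : `|0 - D * expR (c * b k)| < e by near: k; exact: De.
by rewrite sub0r normrN; apply: le_lt_trans; exact: ler_norm.
Unshelve. all: by end_near. Qed.

Lemma cvg_sum_seq (I : Type) (r : seq I) (f : I -> nat -> R) (z : I -> R) :
  (forall i, f i k @[k --> \oo] --> z i) ->
  \sum_(i <- r) f i k @[k --> \oo] --> \sum_(i <- r) z i.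
Proof.
move=> fz; elim: r => [|i r IH].
  by rewrite big_nil (_ : (fun k => _) = fun=> 0); [exact: cvg_cst|apply/funext => k; rewrite big_nil].
rewrite big_cons (_ : (fun k => _) = fun k => f i k + \sum_(i <- r) f i k).
  exact: cvgD.
by apply/funext => k; rewrite big_cons.
Qed.

End ScalarKernels.

Section StateEquation.
Variables (R : realType) (n m : nat) (M : 'M[R]_n) (B : 'M[R]_(n, m)).
Variable l : R -> 'cV[R]_m.
Hypothesis lP : cadlag l.
Hypothesis ls : forall j, subexponential (fun u => l u j 0).
Let coef i j k := (M ^+ k *m B) i j.
Hypothesis dec : forall i j, decaying (coef i j).
Implicit Types (s t u b T : R).

Definition state_path t : 'cV[R]_n :=
  \col_i \sum_j kernel_limit (coef i j) (fun u => l u j 0) t.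

Let gc i j : geometric_bound (coef i j).
Proof.
rewrite (_ : coef i j = fun k => (1%:M *m M ^+ k *m B) i j); first exact: geom_pow.
by apply/funext => k; rewrite mul1mx.
Qed.

Let lj j : rcll (fun u => l u j 0). Proof. exact: cadlag_rcll. Qed.

Let V t i := state_path t i 0 - (B *m l t) i 0.

(* Truncating the integral at b. *)
Lemma sum_kernel_integral b t i : b <= t ->
  \sum_j kernel_integral (coef i j) (fun u => l u j 0) b t =
  (B *m l t) i 0 - \sum_j egf (coef i j) (t - b) * l b j 0 + duhamel M B l b t i 0.
Proof.
move=> bt; rewrite /kernel_integral /parts_integral !sumrB.
congr (_ - _ + _).
  rewrite mxE; apply: eq_bigr => j _; congr (_ * _).
  by rewrite subrr egf0 /coef expr0 mul1mx.
rewrite mxE -sumrN.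
have cc j : continuous (fun u => - egf (shift_seq (coef i j)) (t - u)).
  by have [] := kernel_C1 t (gc i j).
have ii j : intg b t (fun u => - egf (shift_seq (coef i j)) (t - u) * l u j 0).
  by apply: intg_contM => //; exact: intg_rcll.
under eq_bigr do rewrite -IntN //.
have [|_ <-] := @Int_sum R _ (index_enum 'I_m) (fun j u => - (- egf (shift_seq (coef i j)) (t - u) * l u j 0)) b t.
  by move=> j; apply: intgN.
congr Int; apply/funext => u; rewrite mxE; apply: eq_bigr => j _.
rewrite mulNr opprK; congr (_ * _); rewrite rexp_mul; congr (egf _ (t - u)).
by apply/funext => k; rewrite /shift_seq /coef exprSr -mulmxE mulmxA.
Qed.

Lemma state_path_uniform s T : s <= T -> exists D c : R, [/\ 0 < c, 0 <= D &
  forall t b i, s <= t <= T -> b <= s -> `|duhamel M B l b t i 0 - V t i| <= D * expR (c * b)].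
Proof.
move=> sT.
have Hij (ij : 'I_n * 'I_m) : exists Dc : R * R, [/\ 0 < Dc.2, 0 <= Dc.1 &
    forall t b, s <= t <= T -> b <= s ->
      `|egf (coef ij.1 ij.2) (t - b) * l b ij.2 0| <= Dc.1 * expR (Dc.2 * b) /\
      `|kernel_integral (coef ij.1 ij.2) (fun u => l u ij.2 0) b t
        - kernel_limit (coef ij.1 ij.2) (fun u => l u ij.2 0) t| <= Dc.1 * expR (Dc.2 * b)].
  case: ij => i j /=.
  have [D [c [c0 D0 H1 H2]]] := kernel_limit_bound (gc i j) (dec i j) (lj j) (ls j) sT.
  by exists (D, c); split => // t b st bs; split; [exact: H1|exact: H2].
have [Dc DcP] := choice Hij.
have [c c0 cP] : exists2 c : R, 0 < c & forall ij, c <= (Dc ij).2.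
  exists (\big[Num.min/1]_ij (Dc ij).2).
    by elim/big_ind: _ => // [x y x0 y0|ij _]; [rewrite lt_min x0|have [] := DcP ij].
  by move=> ij; apply: bigmin_le_cond.
pose E0 ij := (Dc ij).1 * 2 * expR (((Dc ij).2 - c) * `|s|).
pose D := \sum_i \sum_j E0 (i, j).
have D1 ij : 0 <= (Dc ij).1 by have [] := DcP ij.
exists D, c; split => //.
  by apply: sumr_ge0 => i _; apply: sumr_ge0 => j _; rewrite !mulr_ge0 ?expR_ge0.
move=> t b i st bs; have bt : b <= t by case/andP: st => st _; apply: le_trans st.
have E : duhamel M B l b t i 0 - V t i =
  \sum_j (kernel_integral (coef i j) (fun u => l u j 0) b t - kernel_limit (coef i j) (fun u => l u j 0) t)
  + \sum_j egf (coef i j) (t - b) * l b j 0.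
  by rewrite sumrB sum_kernel_integral // /V [state_path t i 0]mxE; ring.
have term ij : (Dc ij).1 * expR ((Dc ij).2 * b) <= (Dc ij).1 * expR (((Dc ij).2 - c) * `|s|) * expR (c * b).
  rewrite -mulrA ler_wpM2l // -expRD ler_expR; have := cP ij; have := ler_norm s; nra.
rewrite E (le_trans (ler_normD _ _)) //.
apply: (@le_trans _ _ (\sum_j (Dc (i, j)).1 * 2 * expR (((Dc (i, j)).2 - c) * `|s|) * expR (c * b))).
  rewrite (le_trans (lerD (ler_norm_sum _ _ _) (ler_norm_sum _ _ _))) // -big_split /=.
  apply: ler_sum => j _; have [_ _ /(_ t b st bs)[h1 h2]] := DcP (i, j).
  by have := term (i, j); move: h1 h2 => /=; lra.
rewrite -mulr_suml ler_wpM2r ?expR_ge0 // /D.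
rewrite (bigD1 i) //= lerDl; apply: sumr_ge0 => i' _; apply: sumr_ge0 => j _.
by rewrite !mulr_ge0 ?expR_ge0.
Qed.

Lemma state_path_integral s t i : s <= t ->
  intg s t (fun r => (M *m state_path r) i 0) /\
  V t i - V s i = Int s t (fun r => (M *m state_path r) i 0).
Proof.
move=> st; have [D [c [c0 D0 H]]] := state_path_uniform st.
pose b k : R := - (k%:R + `|s|).
have bk k : b k <= - k%:R by rewrite /b lerN2 lerDl.
have bs k : b k <= s.
  by rewrite /b; have := ler_norm (- s); have := ler0n R k; rewrite normrN; lra.
have De := expR_ninfty D c0 bk.
have cvV r j : s <= r <= t -> duhamel M B l (b k) r j 0 @[k --> \oo] --> V r j.
  move=> sr; apply/cvgrPdist_lt => e e0; have /cvgrPdist_lt/(_ e e0) De' := De.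
  near=> k; rewrite distrC; apply: le_lt_trans (H r (b k) j sr (bs k)) _.
  have : `|0 - D * expR (c * b k)| < e by near: k; exact: De'.
  by rewrite sub0r normrN; apply: le_lt_trans; exact: ler_norm.
have XE r : state_path r = (\col_j V r j) + B *m l r.
  by apply/matrixP => j k; rewrite !mxE (ord1 k) /V [(B *m l r) j 0]mxE subrK mxE.
pose f k r := (M *m (duhamel M B l (b k) r + B *m l r)) i 0.
have fE k r : f k r = \sum_j M i j * (duhamel M B l (b k) r j 0 + (B *m l r) j 0).
  by rewrite /f mxE; apply: eq_bigr => j _; rewrite mxE.
have dE k r : b k <= r -> _ := @duhamelE R n m M B l lP (b k) r i.
have fi k : intg s t (f k).
  by have [h _] := dE k t (le_trans (bs k) st); apply: intg_sub h.
have fI k : duhamel M B l (b k) t i 0 - duhamel M B l (b k) s i 0 = Int s t (f k).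
  have [h1 ->] := dE k t (le_trans (bs k) st); have [h2 ->] := dE k s (bs k).
  by rewrite (Int_split (bs k) st h1) addrAC subrr add0r.
(* a bound on the finite-horizon solutions, uniform in the horizon *)
have [W W0 WP] : exists2 W : R, 0 <= W & forall k r j, s <= r <= t ->
    `|duhamel M B l (b k) r j 0| <= W.
  pose g0 j r := (M *m (duhamel M B l s r + B *m l r)) j 0.
  pose W1 := \sum_j Int s t (fun r => `|g0 j r|).
  have gi j : intg s t (fun r => `|g0 j r|).
    by apply: intg_abs; have [] := @duhamelE R n m M B l lP s t j st.
  have In0 j x : s <= x -> x <= t -> 0 <= Int x t (fun r => `|g0 j r|).
    move=> sx xt; rewrite -(mul0r (t - x)) -Int_cst //; apply: Int_le => //.
      exact: intg_cst.
    by apply: intg_sub (gi j).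
  have W10 : 0 <= W1 by apply: sumr_ge0 => j _; apply: In0.
  exists (W1 + D * expR (c * s) + D * expR (c * s)); first by rewrite !addr_ge0 // mulr_ge0 // expR_ge0.
  move=> k r j /andP[sr rt]; have srt : s <= r <= t by rewrite sr.
  have h1 := H r (b k) j srt (bs k); have h2 := H r s j srt (lexx s).
  have h3 : `|duhamel M B l s r j 0| <= W1.
    have [i0 ->] := @duhamelE R n m M B l lP s r j sr.
    apply: le_trans (Int_abs i0) _; apply: (@le_trans _ _ (Int s t (fun r => `|g0 j r|))).
      by rewrite (Int_split sr rt (gi j)) lerDl In0.
    rewrite /W1 (bigD1 j) //= lerDl; apply: sumr_ge0 => j' _; exact: In0.
  have h4 : D * expR (c * b k) <= D * expR (c * s).
    by rewrite ler_wpM2l // ler_expR ler_pM2l.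
  have := ler_normB (duhamel M B l (b k) r j 0 - V r j) (duhamel M B l s r j 0 - V r j).
  have := ler_normD (duhamel M B l (b k) r j 0 - duhamel M B l s r j 0) (duhamel M B l s r j 0).
  rewrite subrK (_ : _ - V r j - _ = duhamel M B l (b k) r j 0 - duhamel M B l s r j 0); last by ring.
  by lra.
have bl j : exists2 K, 0 <= K & forall u, s <= u <= t -> `|(B *m l u) j 0| <= K.
  apply: rcll_bounded; rewrite (_ : (fun u => _) = fun u => \sum_r B j r * l u r 0).
    by apply: rcll_sum => r; apply: rcllM => //; exact: rcll_cst.
  by apply/funext => u; rewrite mxE.
have [K KP] := choice (fun j => let: ex_intro2 K K0 KP := bl j in ex_intro _ K KP).
have bd k u : s < u <= t -> `|f k u| <= \sum_j `|M i j| * (W + K j).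
  move=> /andP[/ltW su ut]; rewrite fE (le_trans (ler_norm_sum _ _ _)) //.
  apply: ler_sum => j _; rewrite normrM ler_wpM2l // (le_trans (ler_normD _ _)) // lerD //.
    by apply: WP; rewrite su.
  by apply: KP; rewrite su.
have cv u : s < u <= t -> f k u @[k --> \oo] --> (M *m state_path u) i 0.
  move=> /andP[/ltW su ut].
  rewrite (_ : (M *m state_path u) i 0 = \sum_j M i j * (V u j + (B *m l u) j 0)); last first.
    by rewrite mxE; apply: eq_bigr => j _; rewrite /V subrK.
  rewrite (_ : (fun k => f k u) = fun k => \sum_j M i j * (duhamel M B l (b k) u j 0 + (B *m l u) j 0)); last first.
    by apply/funext => k; rewrite fE.
  apply: cvg_sum_seq => j; apply: cvgM; first exact: cvg_cst.
  by apply: cvgD; [apply: cvV; rewrite su|exact: cvg_cst].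
have [fXi fX] := Int_dominated fi bd cv.
split => //.
have c1 : Int s t (f k) @[k --> \oo] --> V t i - V s i.
  rewrite (_ : (fun k => _) = fun k => duhamel M B l (b k) t i 0 - duhamel M B l (b k) s i 0); last first.
    by apply/funext => k; rewrite fI.
  by apply: cvgB; apply: cvV; rewrite lexx ?st.
exact: (cvg_unique (@norm_hausdorff _ R) c1 fX).
Unshelve. all: by end_near. Qed.

Lemma state_path_cadlag : cadlag state_path.
Proof.
apply: rcll_cadlag => i.
rewrite (_ : (fun t => _) = fun t => V t i + (B *m l t) i 0); last first.
  by apply/funext => t; rewrite /V subrK.
apply: rcllD; last first.
  rewrite (_ : (fun u => _) = fun u => \sum_r B i r * l u r 0).
    by apply: rcll_sum => r; apply: rcllM => //; exact: rcll_cst.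
  by apply/funext => u; rewrite mxE.
apply: rcll_cont => t.
have t1 : t - 1 <= t + 1 by lra.
have [gi _] := state_path_integral i t1.
set g := fun r => _ in gi.
have gcc : (@lebesgue_measure R).-integrable `[t - 1, t + 1] (EFin \o g) by apply/intg_cc.
have cP := parameterized_integral_continuous t1 gcc.
have tin : t \in `]t - 1, t + 1[ by rewrite in_itv /=; apply/andP; split; lra.
have t2 : t - 1 < t + 1 by lra.
have cPt := within_continuous_continuous t2 cP tin.
have E : \forall u \near t, V u i = V (t - 1) i + (\int[@lebesgue_measure R]_(x in `[(t - 1)%R, u]) g x)%R.
  near=> u.
  have : `|t - u| < 1 by near: u; apply/nbhs_ballP; exists 1 => //=.
  rewrite ltr_distl => /andP[u1 u2].
  have tu : t - 1 <= u by lra.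
  have [hi hE] := state_path_integral i tu.
  by rewrite (Int_cc hi) -hE addrC subrK.
have Et := nbhs_singleton E.
have lim_t : V (t - 1) i + (\int[@lebesgue_measure R]_(x in `[(t - 1)%R, u]) g x)%R @[u --> t] --> V t i.
  by rewrite [V t i]Et; apply: cvgD; [exact: cvg_cst|exact: cPt].
apply: cvg_trans lim_t; apply: near_eq_cvg.
by near=> u; rewrite (near E u).
Unshelve. all: by end_near. Qed.

Lemma state_path_solution s t : s <= t ->
  state_path t - state_path s =
  \col_i (\int[@lebesgue_measure R]_(u in `[s, t]) (M *m state_path u) i 0)%R
  + B *m (l t - l s).
Proof.
move=> st; apply/matrixP => i j; rewrite (ord1 j) {j}.
have [hi hE] := state_path_integral i st.
have entryB (x y : 'cV[R]_n) : (x - y) i 0 = x i 0 - y i 0.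
  by rewrite [LHS]mxE; congr (_ + _); rewrite [LHS]mxE.
rewrite entryB.
have -> : (\col_i0 (\int[@lebesgue_measure R]_(u in `[s, t]) (M *m state_path u) i0 0)%R
  + B *m (l t - l s)) i 0 = Int s t (fun r => (M *m state_path r) i 0) +
    ((B *m l t) i 0 - (B *m l s) i 0).
  by rewrite [LHS]mxE [X in X + _]mxE (Int_cc hi) mulmxBr entryB.
have key (I x y z w : R) : x - z - (y - w) = I -> x - y = I + (z - w).
  by move=> <-; ring.
by apply: key; exact: hE.
Qed.

End StateEquation.


Section MeasurableMatrices.
Context (dO : measure_display) (O : measurableType dO) (R : realType).

Lemma measurable_gt (f : O -> R) : (forall c, measurable [set w | c < f w]) -> measurable_fun setT f.
Proof.
move=> H; apply: (measurability _ (RGenOInfty.measurableE R)).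
move=> _ [_ [c ->] <-]; rewrite setTI (_ : _ @^-1` _ = [set w | c < f w]) //.
by apply/seteqP; split => w; rewrite /= in_itv /= andbT.
Qed.

Lemma measurable_matrixP (d n : nat) (X : O -> 'M[R]_(d, n)) :
  (forall U, borel U -> measurable (X @^-1` U)) <->
  (forall i j, measurable_fun setT (fun w => X w i j)).
Proof.
split=> [H i j|H U bU].
  apply: measurable_gt => c.
  have : borel [set V : 'M[R]_(d, n) | c < V i j].
    apply: sub_gen_smallest; rewrite /=.
    rewrite (_ : [set V | _] = (fun V : 'M[R]_(d, n) => V i j) @^-1` [set x | c < x]) //.
    by apply: open_comp; [move=> V _; exact: coord_continuous|exact: open_gt].
  exact: H.
pose box (b : 'M[rat]_(d, n) * nat) := [set V : 'M[R]_(d, n) |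
  forall i j, `|V i j - ratr (b.1 i j)| < b.2.+1%:R^-1].
have mbox b : measurable (X @^-1` box b).
  rewrite (_ : _ @^-1` _ = \bigcap_(ij in [set: 'I_d * 'I_n])
      [set w | `|X w ij.1 ij.2 - ratr (b.1 ij.1 ij.2)| < b.2.+1%:R^-1]).
    apply: fin_bigcap_measurable; first exact: finite_finset.
    move=> [i j] _ /=; rewrite -[X in measurable X]setTI.
    have mf : measurable_fun setT (fun w => `|X w i j - ratr (b.1 i j)|).
      by apply: measurableT_comp => //; apply: measurable_funB.
    by have := mf measurableT `]-oo, b.2.+1%:R^-1[%classic (measurable_itv _);
      rewrite (_ : _ @^-1` _ = [set w | `|X w i j - ratr (b.1 i j)| < b.2.+1%:R^-1]) //;
      apply/seteqP; split => w; rewrite /= in_itv.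
  apply/seteqP; split => w /= h; first by move=> [i j] _ /=.
  by move=> i j; have := h (i, j) I.
have bigc (F : 'M[rat]_(d, n) * nat -> Prop) : measurable (X @^-1` \bigcup_(b in F) box b).
  rewrite (_ : _ @^-1` _ = \bigcup_k (if unpickle k is Some b then
      if `[<F b>] then X @^-1` box b else set0 else set0)).
    by apply: bigcupT_measurable => k; case: unpickle => [b|] //; case: ifP.
  apply/seteqP; split => w.
    by case=> b Fb bw; exists (pickle b) => //; rewrite pickleK (asboolT Fb).
  by case=> k _; case: unpickle => [b|] //; case: asboolP => // Fb bw; exists b.
pose D := [set V : set 'M[R]_(d, n) | measurable (X @^-1` V)].
suff : @borel 'M[R]_(d, n) `<=` D by exact.
apply: smallest_sub => [|V Vo].
  split; first by rewrite /D /= preimage_set0.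
    by move=> V DV; rewrite /D /= setTD preimage_setC; apply: measurableC.
  by move=> V DV; rewrite /D /= preimage_bigcup; apply: bigcupT_measurable.
rewrite /D /= (_ : V = \bigcup_(b in [set b | box b `<=` V]) box b); first exact: bigc.
apply/seteqP; split => [M VM|M [b]]; last by apply.
have /nbhs_ballP[e /= e0 eV] : nbhs M V by apply: open_nbhs_nbhs.
pose k := Num.bound (2 / e).
have k0 : (0 : R) < k.+1%:R^-1 by rewrite invr_gt0.
have ke : 2 * k.+1%:R^-1 < e.
  have : 2 / e < k.+1%:R :> R.
    apply: lt_le_trans (archi_boundP _) _; first by rewrite divr_ge0 // ltW.
    by rewrite ler_nat.
  by rewrite ltr_pdivrMr // ltr_pdivrMr // mulrC.
have hr (ij : 'I_d * 'I_n) : exists r : rat, `|M ij.1 ij.2 - ratr r| < k.+1%:R^-1.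
  have : M ij.1 ij.2 - k.+1%:R^-1 < M ij.1 ij.2 + k.+1%:R^-1.
    by rewrite ltrD2l; apply: lt_trans k0; rewrite oppr_lt0.
  case/rat_in_itvoo => r; rewrite in_itv /= => /andP[h1 h2]; exists r.
  by rewrite distrC ltr_distl h1 h2.
have [r rP] := choice hr.
exists (\matrix_(i, j) r (i, j), k) => /=; last by move=> i j; rewrite mxE; exact: rP (i, j).
move=> M' /= M'P; apply: eV; split=> // i j; rewrite /ball /=.
have := M'P i j; have := rP (i, j); rewrite mxE /= => h1 h2.
have -> : M i j - M' i j = (M i j - ratr (r (i, j))) - (M' i j - ratr (r (i, j))) by ring.
apply: le_lt_trans (ler_normB _ _) _; apply: lt_trans ke.
by rewrite mulr_natl mulr2n ltrD.
Qed.

End MeasurableMatrices.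

Section RandomVectors.
Context (dO : measure_display) (O : measurableType dO) (R : realType) (P : probability O R).

Lemma random_vectorP n (X : O -> 'cV[R]_n) :
  random_vector X <-> forall i, measurable_fun setT (fun w => X w i 0).
Proof.
split=> [/measurable_matrixP H i|H]; first exact: H.
by apply/measurable_matrixP => i j; rewrite (ord1 j).
Qed.

Lemma complex_random_vectorP n (X : O -> 'cV[R[i]]_n) :
  complex_random_vector X <-> forall i,
    measurable_fun setT (fun w => complex.Re (X w i 0)) /\
    measurable_fun setT (fun w => complex.Im (X w i 0)).
Proof.
have eR : (fun w => Re_mx (X w)) = fun w => \col_i complex.Re (X w i 0).
  by apply/funext => w; apply/matrixP => i j; rewrite !mxE (ord1 j).
have eI : (fun w => Im_mx (X w)) = fun w => \col_i complex.Im (X w i 0).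
  by apply/funext => w; apply/matrixP => i j; rewrite !mxE (ord1 j).
have E (g : O -> 'I_n -> R) i : (fun w => (\col_i g w i : 'cV[R]_n) i 0) = fun w => g w i.
  by apply/funext => w; rewrite mxE.
rewrite /complex_random_vector eR eI; split=> [[/random_vectorP h1 /random_vectorP h2] i|H].
  by have := h1 i; have := h2 i; rewrite !E.
by split; apply/random_vectorP => i; rewrite E; have [] := H i.
Qed.

(* Two measurable events which differ by a null set are equally likely. *)
Lemma probability_ae_eq (E F : set O) : measurable E -> measurable F ->
  {ae P, forall w, E w <-> F w} -> P E = P F.
Proof.
move=> mE mF [N [mN N0 hN]].
have le (E' F' : set O) : measurable E' -> measurable F' ->
    (forall w, ~ N w -> E' w -> F' w) -> (P E' <= P F')%E.
  move=> mE' mF' h; rewrite -[leRHS]adde0 -N0.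
  apply: le_trans (measureU2 _ mF' mN).
  apply: le_measure; rewrite ?inE //; first exact: measurableU.
  by move=> w Ew; have [Nw|Nw] := pselect (N w); [right|left; apply: h].
have hN' w : ~ N w -> (E w <-> F w) by move=> Nw; apply: contrapT => h; apply: Nw; exact: hN.
apply/eqP; rewrite eq_le; apply/andP; split; apply: le => // w Nw; first by case: (hN' w Nw).
by case: (hN' w Nw).
Qed.

Lemma measurable_finite_all n (E : nat -> set O) : (forall i, (i < n)%N -> measurable (E i)) ->
  measurable [set w | forall i, (i < n)%N -> E i w].
Proof.
move=> mE; rewrite (_ : [set w | _] = \bigcap_(i in `I_n) E i).
  by apply: fin_bigcap_measurable => // i; exact: mE.
by apply/seteqP; split => w h i /h.
Qed.

End RandomVectors.


Section InProbability.
Context (dO : measure_display) (O : measurableType dO) (R : realType) (P : probability O R).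

Definition csq n (v : 'cV[R[i]]_n) : R :=
  \sum_i (complex.Re (v i 0) ^+ 2 + complex.Im (v i 0) ^+ 2).

Lemma csq_ge0 n (v : 'cV[R[i]]_n) : 0 <= csq v.
Proof. by apply: sumr_ge0 => i _; rewrite addr_ge0 ?sqr_ge0. Qed.

Lemma cnorm_csq n (v : 'cV[R[i]]_n) : cnorm v = Num.sqrt (csq v).
Proof.
rewrite /cnorm /enorm !sqr_sqrtr; try by apply: sumr_ge0 => i _; rewrite sqr_ge0.
by rewrite -big_split /=; congr Num.sqrt; apply: eq_bigr => i _; rewrite !mxE.
Qed.

Lemma lt_cnorm n (v : 'cV[R[i]]_n) (e : R) : 0 < e -> (e < cnorm v) = (e ^+ 2 < csq v).
Proof.
move=> e0; rewrite cnorm_csq -[in RHS](sqr_sqrtr (csq_ge0 v)) ltr_pXn2r // nnegrE ?sqrtr_ge0 //.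
exact: ltW.
Qed.

Lemma csqD n (u v : 'cV[R[i]]_n) : csq (u + v) <= 2 * csq u + 2 * csq v.
Proof.
rewrite /csq !mulr_sumr -big_split /=; apply: ler_sum => i _; rewrite mxE.
case: (u i 0) => a b; case: (v i 0) => c e /=.
have := sqr_ge0 (a - c); have := sqr_ge0 (b - e); rewrite !expr2; nra.
Qed.

Lemma csqN n (v : 'cV[R[i]]_n) : csq (- v) = csq v.
Proof. by apply: eq_bigr => i _; rewrite mxE; case: (v i 0) => a b /=; rewrite !sqrrN. Qed.

Lemma csq_eq0 n (v : 'cV[R[i]]_n) : csq v <= 0 -> v = 0.
Proof.
move=> v0; have : csq v == 0 by rewrite eq_le v0 csq_ge0.
rewrite psumr_eq0 => [/allP h|i _]; last by rewrite addr_ge0 ?sqr_ge0.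
apply/matrixP => i j; rewrite (ord1 j) [RHS]mxE; have := h i (mem_index_enum i).
case: (v i 0) => a b /=; rewrite paddr_eq0 ?sqr_ge0 // !sqrf_eq0.
by move=> /andP[/eqP -> /eqP ->].
Qed.

Lemma crvB n (X Y : O -> 'cV[R[i]]_n) : complex_random_vector X -> complex_random_vector Y ->
  complex_random_vector (fun w => X w - Y w).
Proof.
move=> /complex_random_vectorP mX /complex_random_vectorP mY.
apply/complex_random_vectorP => i; have [a1 a2] := mX i; have [b1 b2] := mY i.
split; [rewrite (_ : (fun w => _) = fun w => complex.Re (X w i 0) - complex.Re (Y w i 0))
       |rewrite (_ : (fun w => _) = fun w => complex.Im (X w i 0) - complex.Im (Y w i 0))];
  try exact: measurable_funB.
all: by apply/funext => w; rewrite !mxE; case: (X w i 0) (Y w i 0) => x y [].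
Qed.

Lemma measurable_cnorm_gt n (X : O -> 'cV[R[i]]_n) (e : R) : complex_random_vector X -> 0 < e ->
  measurable [set w | e < cnorm (X w)].
Proof.
move=> /complex_random_vectorP mX e0.
rewrite (_ : [set w | _] = (fun w => csq (X w)) @^-1` `]e ^+ 2, +oo[%classic).
  rewrite -[X in measurable X]setTI.
  have mf : measurable_fun setT (fun w => csq (X w)); last by apply: mf => //; exact: measurable_itv.
  by apply: measurable_sum => i; have [h1 h2] := mX i; apply: measurable_funD; apply: measurable_funX.
by apply/seteqP; split => w; rewrite /= in_itv /= andbT lt_cnorm.
Qed.

Lemma cvge0P (T : Type) (F : set_system T) {FF : Filter F} (g : T -> \bar R) :
  (forall x, (0 <= g x)%E) ->
  g x @[x --> F] --> 0%E <-> (forall eps : R, 0 < eps -> \forall x \near F, (g x < eps%:E)%E).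
Proof.
move=> g0; split=> [g_cvg eps eps0|H A /= A0].
  apply: (g_cvg [set y | (y < eps%:E)%E]) => /=.
  suff : nbhs (0 : R) (fun r : R => (r%:E < eps%:E)%E) by exact.
  by apply/nbhs_ballP; exists eps => //= r; rewrite /ball /= sub0r normrN lte_fin; apply: le_lt_trans (ler_norm r).
have [e /= e0 eA] : exists2 e : R, 0 < e & forall r : R, `|r| < e -> A r%:E.
  have [e /= e0 eA] : nbhs_ball (0 : R) (fun r => A r%:E) by apply/nbhs_ballP.
  by exists e => // r re; apply: eA; rewrite /ball /= sub0r normrN.
apply: filterS (H e e0) => x; have := g0 x; rewrite /preimage /=; case: (g x) => [r| |] //=.
by rewrite lee_fin lte_fin => r0 re; apply: eA; rewrite ger0_norm.
Qed.

Definition cvg_prob n (Z_ : nat -> O -> 'cV[R[i]]_n) (Z : O -> 'cV[R[i]]_n) :=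
  forall e : R, 0 < e -> P [set w | e < cnorm (Z_ k w - Z w)] @[k --> \oo] --> 0%E.

Definition centry_cvg n (v_ : nat -> 'cV[R[i]]_n) (v : 'cV[R[i]]_n) := forall i,
  complex.Re (v_ k i 0) @[k --> \oo] --> complex.Re (v i 0) /\
  complex.Im (v_ k i 0) @[k --> \oo] --> complex.Im (v i 0).

Lemma cvg_sqr0 (f : nat -> R) c : f k @[k --> \oo] --> c -> (f k - c) ^+ 2 @[k --> \oo] --> 0.
Proof.
move=> fc; have f0 : f k - c @[k --> \oo] --> 0.
  by rewrite -(subrr c); apply: cvgB => //; exact: cvg_cst.
by rewrite -(mulr0 0); apply: cvgM.
Qed.

Lemma cvg_prob_pointwise n (Z_ : nat -> O -> 'cV[R[i]]_n) Z :
  (forall k, complex_random_vector (Z_ k)) -> complex_random_vector Z ->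
  (forall w, centry_cvg (Z_^~ w) (Z w)) -> cvg_prob Z_ Z.
Proof.
move=> mZ_ mZ cv e e0.
pose F k := [set w | e < cnorm (Z_ k w - Z w)].
have mF k : measurable (F k) by apply: measurable_cnorm_gt => //; exact: crvB.
have F0 : lim_sup_set F = set0.
  rewrite -subset0 => w /= Fw.
  have c0 : csq (Z_ k w - Z w) @[k --> \oo] --> 0.
    rewrite [X in _ --> X](_ : 0 = \sum_(i < n) (0 : R)); last by rewrite big1.
    apply: cvg_sum_seq => i.
    have [c1 c2] := cv w i.
    rewrite (_ : (fun k => _) = fun k => (complex.Re (Z_ k w i 0) - complex.Re (Z w i 0)) ^+ 2
      + (complex.Im (Z_ k w i 0) - complex.Im (Z w i 0)) ^+ 2); last first.
      by apply/funext => k; rewrite !mxE; case: (Z_ k w i 0) (Z w i 0) => x y [].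
    rewrite -[X in _ --> X](addr0 (0:R)); apply: cvgD; exact: cvg_sqr0.
  have e2 : 0 < e ^+ 2 by rewrite exprn_gt0.
  move/cvgrPdist_lt : c0 => /(_ _ e2)[N _ NP].
  have [k Nk] := Fw N I; rewrite /F /= lt_cnorm // => h.
  have := NP k Nk; rewrite sub0r normrN ger0_norm ?csq_ge0 // => h'.
  by have := lt_trans h h'; rewrite ltxx.
have := @lim_sup_set_cvg _ _ _ P F mF; rewrite F0 measure0 => cvU.
have {cvU} : P (\bigcup_(k >= m) F k) @[m --> \oo] --> 0%E.
  by apply: cvU; apply: le_lt_trans (probability_le1 _ _) (ltry _); apply: bigcup_measurable.
apply: (@squeeze_cvge _ _ _ _ (cst 0%E)); last exact: cvg_cst.
apply: nearW => k; rewrite measure_ge0 /=; apply: le_measure; rewrite ?inE //.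
  exact: mF.
  by apply: bigcup_measurable.
by move=> w Fw; exists k => //=.
Qed.

Lemma probability_small_eq0 (E : set O) : (forall eps : R, 0 < eps -> (P E <= eps%:E)%E) -> P E = 0%E.
Proof.
move=> h; apply/eqP; rewrite eq_le measure_ge0 andbT; apply/lee_addgt0Pr => eps e0.
by rewrite add0e h.
Qed.

Lemma cvg_prob_unique n (Z_ Z_' : nat -> O -> 'cV[R[i]]_n) Z Z' :
  (forall k, complex_random_vector (Z_ k)) -> (forall k, complex_random_vector (Z_' k)) ->
  complex_random_vector Z -> complex_random_vector Z' ->
  (\forall k \near \oo, {ae P, forall w, Z_ k w = Z_' k w}) ->
  cvg_prob Z_ Z -> cvg_prob Z_' Z' -> {ae P, forall w, Z w = Z' w}.
Proof.
move=> mZ_ mZ_' mZ mZ' ZZ cZ cZ'.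
pose E k := [set w | k.+1%:R^-1 < cnorm (Z w - Z' w)].
have mE k : measurable (E k) by apply: measurable_cnorm_gt; [exact: crvB|rewrite invr_gt0].
have E0 k : P (E k) = 0%E.
  apply: probability_small_eq0 => eps eps0; set e : R := k.+1%:R^-1.
  have e0 : 0 < e by rewrite invr_gt0.
  have e2 : 0 < e / 2 by rewrite divr_gt0.
  have eps2 : (0 < eps / 2)%R by rewrite divr_gt0.
  pose F j := [set w | e / 2 < cnorm (Z_ j w - Z w)].
  pose F' j := [set w | e / 2 < cnorm (Z_' j w - Z' w)].
  have mF j : measurable (F j) by apply: measurable_cnorm_gt => //; exact: crvB.
  have mF' j : measurable (F' j) by apply: measurable_cnorm_gt => //; exact: crvB.
  have small (G : nat -> set O) : (P (G j) @[j --> \oo] --> 0)%E ->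
      \forall j \near \oo, (P (G j) < (eps / 2)%:E)%E.
    by move=> /cvge0P cG; apply: cG.
  have := small _ (cZ _ e2); have := small _ (cZ' _ e2).
  move=> h1 h2; near \oo => j.
  have h1j : (P (F' j) < (eps / 2)%:E)%E by near: j.
  have h2j : (P (F j) < (eps / 2)%:E)%E by near: j.
  have [N [mN N0 hN]] : {ae P, forall w, Z_ j w = Z_' j w} by near: j.
  apply: (@le_trans _ _ (P (N `|` (F j `|` F' j)))).
    apply: le_measure; rewrite ?inE //; first by do ?apply: measurableU.
    move=> w Ew; have [Nw|Nw] := pselect (N w); first by left.
    have Zw : Z_ j w = Z_' j w by apply: contrapT => h; apply: Nw; exact: hN.
    right; apply: contrapT => /not_orP[]; rewrite /F /F' /= => /negP + /negP.
    rewrite -!leNgt => g1 g2.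
    have q (v : 'cV[R[i]]_n) : cnorm v <= e / 2 -> csq v <= e ^+ 2 / 4.
      rewrite leNgt lt_cnorm // -leNgt.
      by rewrite expr_div_n (_ : 2 ^+ 2 = 4 :> R) // -natrX.
    move: Ew; rewrite /E /= lt_cnorm // ltNge => /negP; apply.
    rewrite (_ : Z w - Z' w = (Z_' j w - Z' w) + - (Z_ j w - Z w)); last first.
      by rewrite Zw opprB [RHS]addrC addrA subrK.
    apply: le_trans (csqD _ _) _; rewrite csqN.
    move: (q _ g1) (q _ g2); move: (e ^+ 2) (csq _) (csq _) => x y z; lra.
  apply: le_trans (measureU2 _ mN (measurableU _ _ (mF j) (mF' j))) _.
  rewrite [X in (X + _)%E]N0 add0e; apply: le_trans (measureU2 _ (mF j) (mF' j)) _.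
  by rewrite (_ : eps = eps / 2 + eps / 2) ?EFinD ?leeD // ?ltW //; lra.
have nE : P.-negligible (\bigcup_k E k).
  by apply: negligible_bigcup => k; exists (E k); split => //; exact: E0.
apply: negligibleS nE.
move=> w /= ne; apply: contrapT => h; apply: ne.
apply: subr0_eq; apply: csq_eq0; rewrite leNgt; apply/negP => c0; apply: h.
have s0 : 0 < cnorm (Z w - Z' w) by rewrite cnorm_csq sqrtr_gt0.
exists (Num.bound (cnorm (Z w - Z' w))^-1) => //.
rewrite /E /= -[ltRHS]invrK ltf_pV2 ?posrE ?invr_gt0 //.
apply: lt_trans (archi_boundP _) _; first by rewrite invr_ge0 ltW.
by rewrite ltr_nat.
Unshelve. all: by end_near. Qed.

End InProbability.


Section LevyIntegrals.
Context (dO : measure_display) (O : measurableType dO) (R : realType) (P : probability O R).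
Variables (m d : nat).
Implicit Types (L : R -> O -> 'cV[R]_m) (f : R -> 'M[R[i]]_(d, m)) (Z : O -> 'cV[R[i]]_d).

Lemma step_integral_Re L f n s w i : complex.Re (step_integral L f n s w i 0) =
  \sum_j riemann_sum (fun u => complex.Re (f u i j)) (fun u => L u w j 0) n s.
Proof.
rewrite /step_integral /riemann_sum summxE (big_morph (@complex.Re R) (@cReD R) (erefl _)) exchange_big.
apply: eq_bigr => r _; rewrite mxE (big_morph (@complex.Re R) (@cReD R) (erefl _)).
by apply: eq_bigr => j _; rewrite !mxE cReM /= mulr0 subr0.
Qed.

Lemma step_integral_Im L f n s w i : complex.Im (step_integral L f n s w i 0) =
  \sum_j riemann_sum (fun u => complex.Im (f u i j)) (fun u => L u w j 0) n s.
Proof.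
rewrite /step_integral /riemann_sum summxE (big_morph (@complex.Im R) (@cImD R) (erefl _)) exchange_big.
apply: eq_bigr => r _; rewrite mxE (big_morph (@complex.Im R) (@cImD R) (erefl _)).
by apply: eq_bigr => j _; rewrite !mxE cImM /= mulr0 add0r.
Qed.

Lemma step_integral_measurable L f n s : (forall t, random_vector (L t)) ->
  complex_random_vector (step_integral L f n s).
Proof.
move=> mL; have mLj t j : measurable_fun setT (fun w => L t w j 0).
  by have /random_vectorP := mL t; apply.
apply/complex_random_vectorP => i; split.
  rewrite (_ : (fun w => _) = fun w => \sum_j riemann_sum (fun u => complex.Re (f u i j)) (fun u => L u w j 0) n s).
    apply: measurable_sum => j; apply: measurable_sum => r.
    by apply: measurable_funM => //; apply: measurable_funB.
  by apply/funext => w; exact: step_integral_Re.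
rewrite (_ : (fun w => _) = fun w => \sum_j riemann_sum (fun u => complex.Im (f u i j)) (fun u => L u w j 0) n s).
  apply: measurable_sum => j; apply: measurable_sum => r.
  by apply: measurable_funM => //; apply: measurable_funB.
by apply/funext => w; exact: step_integral_Im.
Qed.

(* Convergence along all sequences of partitions with mesh tending to 0. *)
Definition path_integral L f a b (w : O) (z : 'cV[R[i]]_d) := forall n s delta,
  (forall k, partition_of a b (n k) (s k)) ->
  (forall k i, (i < n k)%N -> s k i.+1 - s k i < delta k) -> delta @ \oo --> (0 : R) ->
  centry_cvg (fun k => step_integral L f (n k) (s k) w) z.

Lemma uniform_path_integral L f a b w z : a <= b -> path_integral L f a b w z ->
  centry_cvg (fun k => step_integral L f k.+1 (uniform_part a b k) w) z.
Proof.
move=> ab H; apply: (H (fun k => k.+1) (fun k => uniform_part a b k) (uniform_mesh a b)).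
- by move=> k; exact: uniform_part_of.
- by move=> k i _; exact: uniform_part_mesh.
- exact: uniform_mesh_cvg.
Qed.

Lemma measurable_entry_cvg n (Z_ : nat -> O -> 'cV[R[i]]_n) (Z : O -> 'cV[R[i]]_n) :
  (forall k, complex_random_vector (Z_ k)) -> (forall w, centry_cvg (Z_^~ w) (Z w)) ->
  complex_random_vector Z.
Proof.
move=> mZ cZ; apply/complex_random_vectorP => i; split.
  apply: (@measurable_fun_cvg _ _ _ _ (fun k w => complex.Re (Z_ k w i 0))).
    by move=> k; have /complex_random_vectorP/(_ i)[] := mZ k.
  by move=> w _; have [] := cZ w i.
apply: (@measurable_fun_cvg _ _ _ _ (fun k w => complex.Im (Z_ k w i 0))).
  by move=> k; have /complex_random_vectorP/(_ i)[] := mZ k.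
by move=> w _; have [] := cZ w i.
Qed.

Lemma levy_integral_pathwise L f a b Z : (forall t, random_vector (L t)) -> a <= b ->
  (forall w, path_integral L f a b w (Z w)) -> levy_integral P L f a b Z.
Proof.
move=> mL ab cv.
have mZ : complex_random_vector Z.
  apply: (measurable_entry_cvg (Z_ := fun k => step_integral L f k.+1 (uniform_part a b k))).
    by move=> k; exact: step_integral_measurable.
  by move=> w; apply: uniform_path_integral.
split=> // e eta e0 eta0; apply: contrapT => H.
have bad (k : nat) : exists ns : nat * (nat -> R), [/\ partition_of a b ns.1 ns.2,
    (forall i, (i < ns.1)%N -> ns.2 i.+1 - ns.2 i < k.+1%:R^-1) &
    ~ (P [set w | (e < cnorm (step_integral L f ns.1 ns.2 w - Z w))%R] < eta%:E)%E].
  apply: contrapT => H'; apply: H; exists (k.+1%:R^-1); first by rewrite invr_gt0.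
  by move=> n s h1 h2; apply: contrapT => h3; apply: H'; exists (n, s).
have [ns nsP] := choice bad.
have : cvg_prob P (fun k => step_integral L f (ns k).1 (ns k).2) Z.
  apply: cvg_prob_pointwise => // [k|w]; first exact: step_integral_measurable.
  apply: (cv w (fun k => (ns k).1) (fun k => (ns k).2) (fun k => k.+1%:R^-1)).
  - by move=> k; have [] := nsP k.
  - by move=> k; have [] := nsP k.
  - exact: cvg_harmonic.
move=> /(_ e e0)/cvge0P => /(_ (fun=> measure_ge0 _ _) eta eta0)[N _ NP].
by have [_ _] := nsP N; apply; apply: (NP N) => /=.
Qed.

Lemma levy_integral_cvg_prob L f a b Z : a <= b -> levy_integral P L f a b Z ->
  cvg_prob P (fun k => step_integral L f k.+1 (uniform_part a b k)) Z.
Proof.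
move=> ab [mZ H] e e0; apply/cvge0P => // eta eta0.
have [delta d0 dP] := H e eta e0 eta0.
have /cvgrPdist_lt/(_ _ d0)[N _ NP] := @uniform_mesh_cvg R a b.
exists N => // k Nk; apply: dP; first exact: uniform_part_of.
move=> i _; apply: lt_trans (uniform_part_mesh _ _ _ _) _.
by have := NP k Nk; rewrite sub0r normrN; apply: le_lt_trans; exact: ler_norm.
Qed.

Lemma levy_integral_unique L L' f a b Z Z' : (forall t, random_vector (L t)) ->
  (forall t, random_vector (L' t)) -> {ae P, forall w, forall t, L t w = L' t w} -> a <= b ->
  levy_integral P L f a b Z -> levy_integral P L' f a b Z' -> {ae P, forall w, Z w = Z' w}.
Proof.
move=> mL mL' LL ab hZ hZ'; have [mZ _] := hZ; have [mZ' _] := hZ'.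
apply: (cvg_prob_unique _ _ mZ mZ' _ (levy_integral_cvg_prob ab hZ) (levy_integral_cvg_prob ab hZ')).
- by move=> k; exact: step_integral_measurable.
- by move=> k; exact: step_integral_measurable.
- apply: nearW => k; apply: filterS LL => w Lw.
  by apply: eq_bigr => i _; rewrite !Lw.
Qed.

Lemma ninfty_sequence (t : R) : exists b : nat -> R, (forall k, b k <= t) /\
  (forall k, b k <= - k%:R).
Proof.
exists (fun k => - (k%:R + `|t|)); split => k; last by rewrite lerN2 lerDl.
have := ler_norm (- t); have := ler0n R k; rewrite normrN; lra.
Qed.

Lemma cvg_prob_ninfty (J : R -> O -> 'cV[R[i]]_d) Z (b : nat -> R) :
  (forall e : R, 0 < e -> P [set w | e < cnorm (J a w - Z w)] @[a --> -oo] --> 0%E) ->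
  (forall k, b k <= - k%:R) -> cvg_prob P (fun k => J (b k)) Z.
Proof.
move=> H bk e e0; apply/cvge0P => // eta eta0.
have [M [_ MP]] : \forall a \near -oo, (P [set w | e < cnorm (J a w - Z w)]%R < eta%:E)%E.
  by have /cvge0P := H e e0; apply.
exists (Num.bound `|M|).+1 => // k /= Mk; apply: MP; apply: le_lt_trans (bk k) _.
have := archi_boundP (normr_ge0 M); have : (Num.bound `|M|)%:R < k%:R :> R by rewrite ltr_nat.
have := ler_norm (- M); rewrite normrN; lra.
Qed.

Lemma levy_integral_ninfty_unique L L' f t Z Z' : (forall t, random_vector (L t)) ->
  (forall t, random_vector (L' t)) -> {ae P, forall w, forall t, L t w = L' t w} ->
  levy_integral_ninfty P L f t Z -> levy_integral_ninfty P L' f t Z' ->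
  {ae P, forall w, Z w = Z' w}.
Proof.
move=> mL mL' LL [mZ [J [hJ cJ]]] [mZ' [J' [hJ' cJ']]].
have [b [bt bk]] := ninfty_sequence t.
apply: (cvg_prob_unique _ _ mZ mZ' _ (cvg_prob_ninfty cJ bk) (cvg_prob_ninfty cJ' bk)).
- by move=> k; have [] := hJ (b k) (bt k).
- by move=> k; have [] := hJ' (b k) (bt k).
- apply: nearW => k; apply: (levy_integral_unique mL mL' LL (bt k)); first exact: hJ.
  exact: hJ'.
Qed.

Lemma cnorm_event_ae (Z1 Z1' Z2 Z2' : O -> 'cV[R[i]]_d) (e : R) : 0 < e ->
  complex_random_vector Z1 -> complex_random_vector Z1' ->
  complex_random_vector Z2 -> complex_random_vector Z2' ->
  {ae P, forall w, Z1 w = Z1' w} -> {ae P, forall w, Z2 w = Z2' w} ->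
  P [set w | e < cnorm (Z1 w - Z2 w)] = P [set w | e < cnorm (Z1' w - Z2' w)].
Proof.
move=> e0 m1 m1' m2 m2' h1 h2; apply: probability_ae_eq.
- by apply: measurable_cnorm_gt => //; exact: crvB.
- by apply: measurable_cnorm_gt => //; exact: crvB.
- by move: h1 h2; apply: filterS2 => w /= -> ->.
Qed.

(* Changing the integrator and the value of the integral on a null set. *)
Lemma levy_integral_ninfty_ae L L' f t Z Z' : (forall t, random_vector (L t)) ->
  (forall t, random_vector (L' t)) -> {ae P, forall w, forall t, L t w = L' t w} ->
  complex_random_vector Z' -> {ae P, forall w, Z w = Z' w} ->
  levy_integral_ninfty P L f t Z -> levy_integral_ninfty P L' f t Z'.
Proof.
move=> mL mL' LL mZ' ZZ [mZ [J [hJ cJ]]].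
have aeJ a : {ae P, forall w, J a w = J a w} by exact: aeW.
split; first exact: mZ'.
exists J; split=> [a at_|e e0].
  have [mJ H] := hJ a at_; split=> [|e eta e0 eta0]; first exact: mJ.
  have [delta d0 dP] := H e eta e0 eta0; exists delta; first exact: d0.
  move=> n s sP sd.
  have ae_step : {ae P, forall w, step_integral L f n s w = step_integral L' f n s w}.
    by apply: filterS LL => w Lw; apply: eq_bigr => i _; rewrite !Lw.
  have E := cnorm_event_ae e0 (step_integral_measurable f n s mL)
    (step_integral_measurable f n s mL') mJ mJ ae_step (aeJ a).
  exact: (eq_ind _ (fun x => (x < eta%:E)%E) (dP n s sP sd) _ E).
have := cJ e e0; apply: cvg_trans; apply: near_eq_cvg.
near=> a; have at_ : a <= t by near: a; by apply: nbhs_ninfty_le; exact: num_real.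
have [mJ _] := hJ a at_; exact: (cnorm_event_ae e0 mJ mJ mZ mZ' (aeJ a) ZZ).
Unshelve. all: by end_near. Qed.

Lemma levy_integral_ninfty_pathwise L f t (J : R -> O -> 'cV[R[i]]_d) Z :
  (forall t, random_vector (L t)) ->
  (forall a w, a <= t -> path_integral L f a t w (J a w)) ->
  (forall b : nat -> R, (forall k, b k <= t) -> (forall k, b k <= - k%:R) ->
    forall w, centry_cvg (fun k => J (b k) w) (Z w)) ->
  levy_integral_ninfty P L f t Z.
Proof.
move=> mL hJ cJ.
have lJ a : a <= t -> levy_integral P L f a t (J a).
  by move=> at_; apply: levy_integral_pathwise => // w; exact: hJ.
have mJ a : a <= t -> complex_random_vector (J a) by case/lJ.
have [b [bt bk]] := ninfty_sequence t.
have mZ : complex_random_vector Z.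
  apply: (measurable_entry_cvg (Z_ := fun k => J (b k))) => [k|w]; first exact: mJ.
  exact: cJ.
split=> //; exists J; split=> // e e0; apply/cvge0P => // eta eta0.
apply: contrapT => H.
have bad (k : nat) : exists a, [/\ a <= t, a <= - k%:R & ~ (P [set w | e < cnorm (J a w - Z w)]%R < eta%:E)%E].
  apply: contrapT => H'; apply: H; exists (Num.min t (- k%:R)); split; first exact: num_real.
  move=> a; rewrite lt_min => /andP[/ltW a1 /ltW a2].
  by apply: contrapT => a3; apply: H'; exists a.
have [a aP] := choice bad.
have : cvg_prob P (fun k => J (a k)) Z.
  apply: cvg_prob_pointwise => // [k|w]; first by apply: mJ; have [] := aP k.
  by apply: cJ => k; have [] := aP k.
move=> /(_ e e0)/cvge0P => /(_ (fun=> measure_ge0 _ _) eta eta0)[N _ NP].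
by have [_ _] := aP N; apply; apply: (NP N) => /=.
Qed.

End LevyIntegrals.


Section Rectangles.
Variables (T : pointedType) (R : realType) (m : nat).
Implicit Types (n : nat) (xi : nat -> T -> 'cV[R]_m).

Lemma borelC k (U : set 'cV[R]_k) : borel U -> borel (~` U).
Proof. exact: (@measurableC _ (g_sigma_algebraType [set U : set 'cV[R]_k | open U])). Qed.

Lemma borelI k (U V : set 'cV[R]_k) : borel U -> borel V -> borel (U `&` V).
Proof. exact: (@measurableI _ (g_sigma_algebraType [set U : set 'cV[R]_k | open U])). Qed.

Lemma borelT k : borel [set: 'cV[R]_k].
Proof. exact: (@measurableT _ (g_sigma_algebraType [set U : set 'cV[R]_k | open U])). Qed.

Lemma borel_coord_gt k (j : 'I_k) (c : R) : borel [set v : 'cV[R]_k | c < `|v j 0|].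
Proof.
apply: sub_gen_smallest; rewrite /=.
rewrite (_ : [set v | _] = (fun v : 'cV[R]_k => `|v j 0|) @^-1` [set x | c < x]) //.
apply: open_comp; last exact: open_gt.
move=> v _; apply: continuous_comp; first exact: coord_continuous.
exact: norm_continuous.
Qed.

Definition rectangles n xi : set (set T) := [set E | exists2 U : nat -> set 'cV[R]_m,
  (forall i, borel (U i)) & E = [set w | forall i, (i < n)%N -> U i (xi i w)]].

Lemma rectangles_setI n xi : setI_closed (rectangles n xi).
Proof.
move=> _ _ [U bU ->] [V bV ->]; exists (fun i => U i `&` V i).
  by move=> i; exact: borelI.
apply/seteqP; split=> w /=; first by move=> [h1 h2] i i_n; split; [exact: h1|exact: h2].
by move=> h; split=> i /h[].
Qed.

Lemma rectangles_measurable n xi i j : (i < n)%N ->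
  measurable_fun setT (fun w : g_sigma_algebraType (rectangles n xi) => xi i w j 0).
Proof.
move=> i_n; have /measurable_matrixP : forall U, borel U ->
    measurable ((xi i : g_sigma_algebraType (rectangles n xi) -> 'cV[R]_m) @^-1` U); last exact.
move=> U bU; apply: sub_gen_smallest; exists (fun k => if k == i then U else setT).
  by move=> k; case: eqP => // _; exact: borelT.
apply/seteqP; split=> w /=; first by move=> Uw k _; case: eqP => [->|].
by move=> /(_ i i_n); rewrite eqxx.
Qed.

End Rectangles.

Section Dynkin.
Context (d1 d2 : measure_display) (T1 : measurableType d1) (T2 : measurableType d2) (R : realType).
Context (m1 : {measure set T1 -> \bar R}) (m2 : {measure set T2 -> \bar R}).
Hypotheses (m12 : m1 setT = m2 setT) (m1fin : (m1 setT < +oo)%E).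
Variables (T : pointedType) (f1 : T1 -> T) (f2 : T2 -> T) (G : set (set T)).
Hypothesis GI : setI_closed G.

(** A π-λ argument for image measures. *)
Lemma generated_agree :
  (forall E, G E -> [/\ measurable (f1 @^-1` E), measurable (f2 @^-1` E) &
     m1 (f1 @^-1` E) = m2 (f2 @^-1` E)]) ->
  forall E, <<s G >> E -> [/\ measurable (f1 @^-1` E), measurable (f2 @^-1` E) &
     m1 (f1 @^-1` E) = m2 (f2 @^-1` E)].
Proof.
move=> GH; pose H := [set E | [/\ measurable (f1 @^-1` E), measurable (f2 @^-1` E) &
     m1 (f1 @^-1` E) = m2 (f2 @^-1` E)]].
have m2fin : (m2 setT < +oo)%E by rewrite -m12.
suff HS : <<s G >> `<=` H by move=> E /HS.
apply: lambda_system_subset => //; split=> //.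
- by split; rewrite ?preimage_setT.
- move=> A B BA [A1 A2 A12] [B1 B2 B12].
  have D1 : f1 @^-1` (A `\` B) = f1 @^-1` A `\` f1 @^-1` B by [].
  have D2 : f2 @^-1` (A `\` B) = f2 @^-1` A `\` f2 @^-1` B by [].
  rewrite /H /= D1 D2; split; [exact: measurableD|exact: measurableD|].
    have fin1 : (m1 (f1 @^-1` A) < +oo)%E 
      by exact: (le_lt_trans (le_measure m1 (mem_set A1) (mem_set measurableT) (@subsetT _ _)) m1fin).
    have fin2 : (m2 (f2 @^-1` A) < +oo)%E 
      by exact: (le_lt_trans (le_measure m2 (mem_set A2) (mem_set measurableT) (@subsetT _ _)) m2fin).
    have -> : m1 (f1 @^-1` A `\` f1 @^-1` B) = (m1 (f1 @^-1` A) - m1 (f1 @^-1` B))%E.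
      by rewrite measureD // (setIidr (preimage_subset BA)).
    have -> : m2 (f2 @^-1` A `\` f2 @^-1` B) = (m2 (f2 @^-1` A) - m2 (f2 @^-1` B))%E.
      by rewrite measureD // (setIidr (preimage_subset BA)).
    by rewrite A12 B12.
- move=> F ndF HF; have mF1 i : measurable (f1 @^-1` F i) by have [] := HF i.
  have mF2 i : measurable (f2 @^-1` F i) by have [] := HF i.
  have U1 : measurable (f1 @^-1` \bigcup_i F i) by rewrite preimage_bigcup; exact: bigcupT_measurable.
  have U2 : measurable (f2 @^-1` \bigcup_i F i) by rewrite preimage_bigcup; exact: bigcupT_measurable.
  split=> //; rewrite !preimage_bigcup in U1 U2 *.
  have nd1 : nondecreasing_seq (fun i => f1 @^-1` F i).
    by move=> i j ij; apply/subsetPset; apply: preimage_subset; apply/subsetPset; exact: ndF.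
  have nd2 : nondecreasing_seq (fun i => f2 @^-1` F i).
    by move=> i j ij; apply/subsetPset; apply: preimage_subset; apply/subsetPset; exact: ndF.
  have c1 := nondecreasing_cvg_mu mF1 U1 nd1.
  have c2 := nondecreasing_cvg_mu mF2 U2 nd2.
  have c1' : m2 (f2 @^-1` F k) @[k --> \oo] --> m1 (\bigcup_i f1 @^-1` F i).
    have E : (fun k => m2 (f2 @^-1` F k)) = (fun k => m1 (f1 @^-1` F k)).
      by apply/funext => k; have [_ _ ->] := HF k.
    by rewrite E; exact: c1.
  exact: (cvg_unique (@ereal_hausdorff R) c1' (c2 _ m2)).
Qed.

End Dynkin.

Section Ottaviani.
Context (dO : measure_display) (O : measurableType dO) (R : realType) (P : probability O R).
Variables (m : nat) (L : R -> O -> 'cV[R]_m).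
Hypothesis LP : levy_process P L.
Variables (n : nat) (t : nat -> R).
Hypothesis t_le : forall i, (i < n)%N -> t i <= t i.+1.
Let xi i w := L (t i.+1) w - L (t i) w.

Lemma increment_measurable s u : random_vector (fun w => L u w - L s w).
Proof.
have /random_vectorP h1 := levy_measurable LP u; have /random_vectorP h2 := levy_measurable LP s.
apply/random_vectorP => j; rewrite (_ : (fun w => _) = fun w => L u w j 0 - L s w j 0).
  by apply: measurable_funB.
by apply/funext => w; rewrite !mxE.
Qed.

Lemma rectangle_event k (U : nat -> set 'cV[R]_m) : (forall i, borel (U i)) ->
  measurable [set w | forall i, (i < k)%N -> U i (xi i w)].
Proof.
move=> bU; apply: (@measurable_finite_all _ _ k (fun i => xi i @^-1` U i)) => i _.
exact: increment_measurable.
Qed.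

Lemma past_independent i (E : set O) (V : set 'cV[R]_m) : (i < n)%N -> <<s rectangles i xi >> E -> borel V ->
  measurable E /\ P (E `&` [set w | V (L (t n) w - L (t i) w)]) =
    (P E * P [set w | V (L (t n) w - L (t i) w)%R])%E.
Proof.
move=> i_n EG bV; set F := [set w | V _].
have mF : measurable F := increment_measurable _ _ bV.
have r0 : 0 <= fine (P F) by rewrite fine_ge0.
have PF : (fine (P F))%:E = P F by rewrite fineK // fin_num_measure.
pose m2 : {measure set O -> \bar R} := mscale (NngNum r0) P.
pose m1 : {measure set O -> \bar R} := mrestr P mF.
have m1E A : m1 A = P (A `&` F) by [].
have m2E A : m2 A = (P A * P F)%E by rewrite -[in RHS]PF muleC.
have agree : forall E0, rectangles i xi E0 -> [/\ measurable (id @^-1` E0),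
    measurable (id @^-1` E0) & m1 (id @^-1` E0) = m2 (id @^-1` E0)]; last first.
  have [] := @generated_agree _ _ O O R m1 m2 _ _ O id id (rectangles i xi)
    (@rectangles_setI O R m i xi) agree E EG.
  - by rewrite m1E m2E probability_setT mul1e setTI.
  - by rewrite m1E setTI; apply: le_lt_trans (probability_le1 _ mF) (ltry _).
  - by rewrite !preimage_id m1E m2E.
move=> _ [U bU ->]; rewrite !preimage_id; have mU := rectangle_event i bU; split=> //.
rewrite m1E m2E.
pose s k := if (k <= i)%N then t k else t n.
have tn k : (k <= n)%N -> t k <= t n.
  by move=> kn; exact: (@monotone_le R n t k n t_le kn (leqnn n)).
have s_le k : (k < i.+1)%N -> s k <= s k.+1.
  rewrite ltnS /s => ki; rewrite ki; case: ifP => [ki'|_]; first by apply: t_le; apply: ltn_trans i_n.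
  by apply: tn; apply: leq_trans ki _; exact: ltnW.
pose W (V' : set 'cV[R]_m) k := if (k < i)%N then U k else V'.
have bW V' : borel V' -> forall k, borel (W V' k) by move=> bV' k; rewrite /W; case: ifP.
have ind V' : borel V' -> P ([set w | forall k, (k < i)%N -> U k (xi k w)] `&`
     [set w | V' (L (t n) w - L (t i) w)]) =
    ((\prod_(k < i) P [set w | U k (xi k w)]) * P [set w | V' (L (t n) w - L (t i) w)%R])%E.
  move=> bV'; have := levy_independent LP s_le (bW V' bV').
  rewrite big_ord_recr /= /W ltnn /s ltnn leqnn => h.
  transitivity (P [set w | forall k, (k < i.+1)%N -> (if (k < i)%N then U k else V')
     (L (if (k < i)%N then t k.+1 else t n) w - L (if (k <= i)%N then t k else t n) w)]).
    congr (P _); apply/seteqP; split=> w /=.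
      move=> [h1 h2] k; rewrite ltnS => ki; rewrite ki.
      by have [ki'|] := ltnP k i; [exact: h1|move=> ik; rewrite (_ : k = i) //; apply/eqP; rewrite eqn_leq ki].
    move=> H; split=> [k ki|]; last by have := H i (leqnn _); rewrite ltnn leqnn.
    by have := H k (leqW ki); rewrite ki (ltnW ki).
  rewrite h; congr (_ * _)%E; apply: eq_bigr => k _.
  by rewrite ltn_ord ltnW // ltn_ord.
rewrite ind // -/F; congr (_ * _)%E.
have T0 : [set w | [set: 'cV[R]_m] (L (t n) w - L (t i) w)] = [set: O] by apply/seteqP; split.
by have := ind _ (@borelT R m); rewrite T0 setIT probability_setT mule1.
Qed.

Section Coordinate.
Variable j : 'I_m.
Let D i w := L (t i) w j 0 - L (t 0%N) w j 0.

Let D_past i k : (k <= i)%N ->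
  measurable_fun setT (fun w : g_sigma_algebraType (rectangles i xi) => D k w).
Proof.
move=> ki; rewrite (_ : (fun w => _) = fun w => \sum_(0 <= a < k) if (a < i)%N then xi a w j 0 else 0).
  apply: measurable_sum => a; case: (boolP (a < i)%N) => [ai|_]; last exact: measurable_cst.
  exact: rectangles_measurable.
apply/funext => w; elim: k ki => [|k IH] ki; first by rewrite /D subrr big_nil.
rewrite big_nat_recr //= ki -(IH (ltnW ki)) /D /xi !mxE.
by rewrite [RHS]addrC addrA subrK.
Qed.

Lemma ottaviani (x b : R) : 0 <= b ->
  (forall i, (i <= n)%N -> (P [set w | b < `|L (t n) w j 0 - L (t i) w j 0|]%R <= (2^-1)%:E)%E) ->
  (P [set w | exists2 i, (i <= n)%N & (x + b < `|L (t i) w j 0 - L (t 0%N) w j 0|)%R] <=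
   2%:E * P [set w | x < `|L (t n) w j 0 - L (t 0%N) w j 0|]%R)%E.
Proof.
move=> b0 small; rewrite -/(D n).
pose E i := [set w | x + b < `|D i w| /\ forall k, (k < i)%N -> `|D k w| <= x + b].
pose G := [set w | x < `|D n w|].
have E_past i : <<s rectangles i xi >> (E i).
  have mD k c : (k <= i)%N -> measurable ([set w | c < `|D k w|] : set (g_sigma_algebraType (rectangles i xi))).
    move=> ki; have mf : measurable_fun setT (fun w : g_sigma_algebraType (rectangles i xi) => `|D k w|).
      by apply: measurableT_comp => //; exact: D_past.
    have := mf measurableT `]c, +oo[%classic (measurable_itv _).
    rewrite setTI (_ : _ @^-1` _ = [set w | c < `|D k w|]) //.
    by apply/seteqP; split=> w; rewrite /= in_itv /= andbT.
  have -> : E i = [set w | x + b < `|D i w|] `&`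
      [set w | forall k, (k < i)%N -> (~` [set w | x + b < `|D k w|]) w].
    by apply/seteqP; split=> w /= [h1 h2]; split=> // k ki; have := h2 k ki; rewrite leNgt => /negP.
  apply: (@measurableI _ (g_sigma_algebraType (rectangles i xi))); first exact: mD.
  apply: (@measurable_finite_all _ (g_sigma_algebraType (rectangles i xi)) i
    (fun k => ~` [set w | x + b < `|D k w|])) => k ki.
  by apply: measurableC; apply: mD; exact: ltnW.
have mG : measurable G.
  have := increment_measurable (t 0%N) (t n) (@borel_coord_gt R m j x).
  by rewrite (_ : _ @^-1` _ = G) //; apply/seteqP; split=> w; rewrite /G /D /= !mxE.
have mE i : measurable (E i).
  suff : <<s rectangles i xi >> `<=` measurable by apply.
  apply: smallest_sub; first exact: sigma_algebra_measurable.
  by move=> _ [U bU ->]; exact: rectangle_event.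
have half i : (i <= n)%N -> (P (E i) <= 2%:E * P (E i `&` G))%E.
  rewrite leq_eqVlt => /predU1P[->|i_n].
    rewrite (_ : E n `&` G = E n).
      by rewrite -[leLHS]mul1e lee_wpmul2r // lee_fin ler1n.
    by apply/seteqP; split=> [w []//|w En]; split=> //; have [h _] := En; apply: le_lt_trans h; rewrite lerDl.
  pose V := ~` [set v : 'cV[R]_m | b < `|v j 0|].
  have bV : borel V by apply: borelC; exact: borel_coord_gt.
  have [_ ind] := past_independent i_n (E_past i) bV.
  set F := [set w | V _] in ind.
  have mF : measurable F := increment_measurable _ _ bV.
  have PF : (1 <= 2%:E * P F)%E.
    have FE : F = ~` [set w | b < `|L (t n) w j 0 - L (t i) w j 0|].
      by apply/seteqP; split=> w; rewrite /F /V /= !mxE.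
    have mFC : measurable [set w | b < `|L (t n) w j 0 - L (t i) w j 0|].
      by rewrite -(setCK [set w | b < _]) -FE; exact: measurableC.
    rewrite FE probability_setC //; have := small i (ltnW i_n).
    rewrite -(fineK (fin_num_measure P _ mFC)) lee_fin => r2.
    by rewrite -EFinB -EFinM lee_fin; lra.
  apply: (@le_trans _ _ (2%:E * P (E i `&` F))%E).
    rewrite ind muleCA -[leLHS]mule1; apply: lee_wpmul2l => //.
  rewrite lee_wpmul2l // ?lee_fin //; apply: le_measure; rewrite ?inE; try exact: measurableI.
  move=> w [Ew Fw]; split=> //; have [h _] := Ew.
  move: Fw; rewrite /F /V /= => /negP; rewrite -leNgt !mxE => h2.
  rewrite /G /=; have := ler_normB (D n w) (L (t n) w j 0 - L (t i) w j 0).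
  rewrite (_ : D n w - _ = D i w); last by rewrite /D; ring.
  by lra.
have UE : [set w | exists2 i, (i <= n)%N & (x + b < `|D i w|)%R] = \big[setU/set0]_(i < n.+1) E i.
  rewrite -bigcup_mkord; apply/seteqP; split=> w.
    case=> i i_n h.
    have ex : exists i, x + b < `|D i w| by exists i.
    case: (ex_minnP ex) => k hk kmin; exists k; first by rewrite /= ltnS (leq_trans _ i_n) ?kmin.
    by split=> // k' k'k; rewrite leNgt; apply/negP => /kmin; rewrite leqNgt k'k.
  by case=> i /= i_n [h _]; exists i.
have trE : trivIset setT E.
  apply/trivIsetP => i k _ _; wlog ik : i k / (i < k)%N => [H|_].
    move=> ne; have := ne; rewrite neq_ltn => /orP[ik|ki]; first exact: H.
    by rewrite setIC; apply: H => //; rewrite eq_sym.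
  rewrite -subset0 => w [[h _] [_ /(_ i ik)]]; rewrite leNgt => /negP; exact.
rewrite UE measure_semi_additive_ord_I //; last 2 first.
- by apply: sub_trivIset trE.
- exact: bigsetU_measurable.
apply: (@le_trans _ _ (\sum_(i < n.+1) 2%:E * P (E i `&` G))%E).
  by apply: lee_sum => i _; apply: half; rewrite -ltnS.
rewrite -ge0_sume_distrr // lee_wpmul2l // ?lee_fin //.
rewrite -(@measure_semi_additive_ord_I _ _ _ P (fun i => E i `&` G)) //; last 3 first.
- by move=> k _; exact: measurableI.
- by apply: sub_trivIset (@subsetT _ _) _; exact: trivIset_setIr.
- by apply: bigsetU_measurable => i _; exact: measurableI.
apply: le_measure; rewrite ?inE //; first by apply: bigsetU_measurable => i _; exact: measurableI.
by rewrite -(bigcup_mkord n.+1 (fun i => E i `&` G)) => w [i _ []].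
Qed.

End Coordinate.
End Ottaviani.


Section PathGrowth.
Variable R : realType.
Implicit Types (l : R -> R) (a u e b c : R).

Definition dyadic N k : R := k%:R / (2 ^ N)%:R.

Lemma dyadic_le1 N k : (k <= 2 ^ N)%N -> 0 <= dyadic N k <= 1.
Proof.
move=> kN; rewrite /dyadic divr_ge0 //= ler_pdivrMr ?ltr0n ?expn_gt0 // mul1r.
by rewrite ler_nat.
Qed.

Lemma dyadic_dense u v : 0 <= u -> u < v -> v <= 1 ->
  exists N, exists2 k, (k <= 2 ^ N)%N & u < dyadic N k < v.
Proof.
move=> u0 uv v1; pose N := Num.bound (v - u)^-1.
have vu : 0 < v - u by rewrite subr_gt0.
have p0 : 0 < (2 ^ N)%:R :> R by rewrite ltr0n expn_gt0.
have hN : (2 ^ N)%:R^-1 < v - u.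
  rewrite -[ltRHS]invrK ltf_pV2 ?posrE ?invr_gt0 //.
  apply: lt_trans (archi_boundP _) _; first by rewrite invr_ge0 ltW.
  by rewrite ltr_nat ltn_expl.
have /truncn_itv/andP[h1 h2] : 0 <= u * (2 ^ N)%:R by rewrite mulr_ge0 // ltW.
set k := Num.truncn _ in h1 h2.
have d1 : u < dyadic N k.+1 by rewrite /dyadic ltr_pdivlMr.
have d2 : dyadic N k.+1 < v.
  rewrite /dyadic -natr1 mulrDl mul1r.
  have : k%:R / (2 ^ N)%:R <= u by rewrite ler_pdivrMr.
  by lra.
exists N, k.+1; last by rewrite d1.
have : dyadic N k.+1 <= 1 by apply: le_trans v1; exact: ltW.
by rewrite /dyadic ler_pdivrMr // mul1r ler_nat.
Qed.

(* A right-continuous function on a unit interval is controlled by the dyadic points. *)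
Lemma dyadic_control l a c : rcll l ->
  (forall N k, (k <= 2 ^ N)%N -> `|l (a + dyadic N k) - l a| <= c) ->
  forall u, a <= u <= a + 1 -> `|l u - l a| <= c.
Proof.
move=> lP H u /andP[au ua]; have [u1|u1] := leP (a + 1) u.
  rewrite (_ : u = a + dyadic 0 1); first exact: H.
  by apply/eqP; rewrite eq_le /dyadic expn0 divr1 u1 ua.
rewrite leNgt; apply/negP => h; pose e := `|l u - l a| - c.
have e0 : 0 < e by rewrite subr_gt0.
have [del d0 dP] := rcll_right u lP e0.
have [|||N [k kN /andP[k1 k2]]] := @dyadic_dense (u - a) (Num.min (u - a + del) 1).
- by rewrite subr_ge0.
- by rewrite lt_min ltrDl d0 /=; lra.
- by rewrite ge_min lexx orbT.
have := dP (a + dyadic N k); move: k2; rewrite lt_min => /andP[k2 _].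
case/(_ _)/Wrap => [|h2]; first by apply/andP; split; lra.
have := H N k kN; have := ler_normB (l (a + dyadic N k) - l a) (l (a + dyadic N k) - l u).
rewrite (_ : _ - _ - (_ - _) = l u - l a); last by ring.
by move: h2; rewrite /e; lra.
Qed.

Lemma block_growth l e b n0 : rcll l -> 0 < e -> 0 <= b ->
  (forall n, (n0 <= n)%N -> forall u, - n.+1%:R <= u <= - n.+1%:R + 1 ->
     `|l u - l (- n.+1%:R)| <= expR (e * n.+1%:R) + b) ->
  exists2 K, 0 <= K & forall u, u <= 0 -> `|l u| <= K * expR (- (2 * e) * u).
Proof.
move=> lP e0 b0 H; pose c n := expR (e * n.+1%:R) + b.
have c_ge0 n : 0 <= c n by rewrite addr_ge0 ?expR_ge0.
have c_le n n' : (n <= n')%N -> c n <= c n'.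
  by move=> nn'; rewrite lerD2r ler_expR ler_wpM2l ?ler_nat // ltW.
have [K0 K00 K0P] := rcll_bounded (- n0%:R) 0 lP.
have at_nat n : (n0 <= n)%N -> `|l (- n%:R)| <= K0 + n%:R * c n.
  elim: n => [|n IH].
    rewrite leqn0 => /eqP n00; rewrite mul0r addr0; apply: K0P.
    by rewrite n00 mulr0n oppr0 lexx.
  rewrite leq_eqVlt => /predU1P[<-|n0n].
    apply: le_trans (K0P _ _) _; first by rewrite lexx oppr_le0 ler0n.
    by rewrite lerDl mulr_ge0.
  have h1 := IH n0n.
  have h2 : `|l (- n%:R) - l (- n.+1%:R)| <= c n.
    by apply: H => //; rewrite -natr1; apply/andP; split; lra.
  have := ler_normB (l (- n%:R)) (l (- n%:R) - l (- n.+1%:R)).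
  rewrite opprB addrCA subrr addr0 => h3.
  have h4 : (n%:R + 1) * c n <= n.+1%:R * c n.+1.
    by rewrite natr1 ler_wpM2l // c_le.
  by lra.
pose C := (1 + b) / e * expR (2 * e * 2).
have C0 : 0 <= C by rewrite mulr_ge0 ?expR_ge0 // divr_ge0 ?addr_ge0 // ltW.
exists (K0 + C); first by rewrite addr_ge0.
move=> u u0; have E1 : 1 <= expR (- (2 * e) * u).
  by rewrite -expR0 ler_expR mulNr -mulrN !mulr_ge0 ?oppr_ge0 // ltW.
have K0E : K0 <= K0 * expR (- (2 * e) * u) by rewrite ler_peMr.
have CE0 : 0 <= C * expR (- (2 * e) * u) by rewrite mulr_ge0 ?expR_ge0.
rewrite mulrDl; have [un|un] := leP (- n0%:R) u.
  by have := K0P u; rewrite un u0 => /(_ isT); lra.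
have /truncn_itv/andP[t1 t2] : 0 <= - u by rewrite oppr_ge0.
move: (Num.truncn _) t1 t2 => n t1 t2.
have n0n : (n0 <= n)%N.
  rewrite -ltnS -(ltr_nat R); apply: lt_trans t2; by rewrite ltrNr.
have h1 : `|l u - l (- n.+1%:R)| <= c n.
  by apply: H => //; rewrite -natr1 in t2 *; apply/andP; split; lra.
have h2 := at_nat n.+1 (leqW n0n).
have c12 := c_le _ _ (leqnSn n).
have n2E : n.+2%:R = n.+1%:R + 1 :> R by rewrite natr1.
have n1E : n.+1%:R = n%:R + 1 :> R by rewrite natr1.
have h3 : `|l u| <= K0 + n.+2%:R * c n.+1.
  have := ler_normD (l u - l (- n.+1%:R)) (l (- n.+1%:R)); rewrite subrK.
  rewrite n2E [(_ + 1) * _]mulrDl mul1r; lra.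
have G1 : 1 <= expR (e * n.+2%:R) by rewrite -expR0 ler_expR mulr_ge0 // ltW.
have Gn : n.+2%:R <= expR (e * n.+2%:R) / e.
  rewrite ler_pdivlMr // mulrC; apply: le_trans (expR_ge1Dx _); lra.
have GG : expR (e * n.+2%:R) * expR (e * n.+2%:R) <= expR (2 * e * 2) * expR (- (2 * e) * u).
  have n2u : n.+2%:R <= 2 - u by rewrite n2E n1E; rewrite n1E in t2; lra.
  by rewrite -!expRD ler_expR; nra.
apply: le_trans h3 _; apply: lerD => //.
apply: (@le_trans _ _ (expR (e * n.+2%:R) / e * ((1 + b) * expR (e * n.+2%:R)))).
  apply: ler_pM => //; rewrite /c mulrDl mul1r lerD2l ler_peMr //.
rewrite /C (_ : _ / e * _ = (1 + b) / e * (expR (e * n.+2%:R) * expR (e * n.+2%:R))); last by ring.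
by rewrite -[leRHS]mulrA ler_wpM2l // divr_ge0 ?addr_ge0 // ltW.
Qed.

End PathGrowth.


Section LevyGrowth.
Context (dO : measure_display) (O : measurableType dO) (R : realType) (P : probability O R).
Variables (m : nat) (L : R -> O -> 'cV[R]_m).
Hypothesis LP : levy_process P L.

Section Coordinate.
Variable j : 'I_m.
Implicit Types (s t h c x a b : R).

Lemma path_coord_rcll w : rcll (fun t => L t w j 0).
Proof. by apply: cadlag_rcll; exact: levy_cadlag LP w. Qed.

Definition oscillation s t c : set O := [set w | c < `|L t w j 0 - L s w j 0|].

Let oscE s t c : oscillation s t c = [set w | [set v : 'cV[R]_m | c < `|v j 0|] (L t w - L s w)].
Proof. by apply/seteqP; split=> w; rewrite /oscillation /= !mxE. Qed.

Lemma oscillation_measurable s t c : measurable (oscillation s t c).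
Proof.
rewrite oscE; exact: (increment_measurable LP s t (@borel_coord_gt R m j c)).
Qed.

Lemma oscillation_shift s t h c : s <= t ->
  P (oscillation (s + h) (t + h) c) = P (oscillation s t c).
Proof.
move=> st; rewrite !oscE; exact: (levy_stationary LP h st (@borel_coord_gt R m j c)).
Qed.

Lemma dyadic0 N : dyadic R N 0 = 0. Proof. by rewrite /dyadic mul0r. Qed.
Lemma dyadicn N : dyadic R N (2 ^ N) = 1.
Proof. by rewrite /dyadic divff // pnatr_eq0 -lt0n expn_gt0. Qed.

Lemma tightness : exists2 b : R, 0 <= b & forall N k, (k <= 2 ^ N)%N ->
  (P (oscillation (dyadic R N k) 1 b) <= (2^-1)%:E)%E.
Proof.
pose B (r : nat) := \bigcap_N [set w | forall k, (k < (2 ^ N).+1)%N ->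
  (~` oscillation (dyadic R N k) 1 r%:R) w].
have mB r : measurable (B r).
  apply: bigcapT_measurable => N.
  apply: (@measurable_finite_all _ O (2 ^ N).+1 (fun k => ~` oscillation (dyadic R N k) 1 r%:R)) => k _.
  by apply: measurableC; exact: oscillation_measurable.
have ndB : nondecreasing_seq B.
  move=> r r' rr'; apply/subsetPset => w Bw N _ k kN h; apply: (Bw N I k kN).
  by apply: le_lt_trans h; rewrite ler_nat.
have UB : \bigcup_r B r = [set: O].
  apply/seteqP; split=> // w _; have [K K0 KP] := rcll_bounded 0 1 (path_coord_rcll w).
  exists (Num.bound (K + K)) => // N _ k; rewrite ltnS => kN; apply/negP; rewrite -leNgt.
  apply: le_trans (ltW (archi_boundP _)); last by rewrite addr_ge0.
  apply: le_trans (ler_normB _ _) _; apply: lerD; apply: KP; last exact: dyadic_le1.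
  by rewrite ler01 lexx.
have mUB : measurable (\bigcup_r B r) by rewrite UB.
have cv : P (B k) @[k --> \oo] --> 1%E.
  by rewrite -(probability_setT P) -UB; exact: (nondecreasing_cvg_mu mB mUB ndB).
have [r hc] : exists r, ((2^-1)%:E < P (B r))%E.
  apply: contrapT => hno; have : (1 <= (2^-1)%:E :> \bar R)%E.
    apply: (cvge_to_le cv); apply: nearW => r /=.
    by rewrite leNgt; apply/negP => hc; apply: hno; exists r.
  by rewrite lee_fin leNgt invf_lt1 // ltr1n.
exists r%:R => // N k kN.
have -> : (2^-1)%:E = (1 - (2^-1)%:E :> \bar R)%E by rewrite -EFinB; congr EFin; field.
apply: (@le_trans _ _ (P (~` B r))).
  apply: le_measure; rewrite ?inE; [exact: oscillation_measurable|exact: measurableC|].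
  by move=> w h /(_ N I k); rewrite ltnS => /(_ kN).
by rewrite probability_setC //; apply: leeB => //; exact: ltW.
Qed.

(** The maximal inequality passes from dyadic grids to all dyadic times. *)
Lemma block_maximal b : 0 <= b ->
  (forall N k, (k <= 2 ^ N)%N -> (P (oscillation (dyadic R N k) 1 b) <= (2^-1)%:E)%E) ->
  forall a x, let E N := [set w | exists2 k, (k <= 2 ^ N)%N & oscillation a (a + dyadic R N k) (x + b) w] in
  measurable (\bigcup_N E N) /\ (P (\bigcup_N E N) <= 2%:E * P (oscillation 0 1 x))%E.
Proof.
move=> b0 tight a x E.
have mE N : measurable (E N).
  rewrite (_ : E N = \bigcup_(k in `I_(2 ^ N).+1) oscillation a (a + dyadic R N k) (x + b)).
    by apply: bigcup_measurable => k _; exact: oscillation_measurable.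
  by apply/seteqP; split=> w [k kN h]; exists k.
have mU : measurable (\bigcup_N E N) by exact: bigcupT_measurable.
split=> //.
have ndE : nondecreasing_seq E.
  apply/nondecreasing_seqP => N; apply/subsetPset => w [k kN h]; exists (2 * k)%N.
    by rewrite expnS leq_mul2l.
  rewrite (_ : dyadic R N.+1 (2 * k) = dyadic R N k) // /dyadic expnS !natrM -mulf_div divff ?mul1r //.
have E_le N : (P (E N) <= 2%:E * P (oscillation 0 1 x))%E.
  pose t i := a + dyadic R N i.
  have t_le i : (i < 2 ^ N)%N -> t i <= t i.+1.
    by move=> _; rewrite lerD2l ler_wpM2r ?invr_ge0 // ler_nat.
  have := @ottaviani _ _ _ _ _ _ LP (2 ^ N) t t_le j x b b0.
  rewrite /t dyadic0 addr0 dyadicn => ott.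
  apply: le_trans (ott _) _.
    move=> i iN; apply: le_trans (tight N i iN); have /andP[_ st] := dyadic_le1 R iN.
    by rewrite -(oscillation_shift a b st) ![_ + a]addrC.
  by rewrite -(oscillation_shift a x (@ler01 R)) add0r [1 + a]addrC.
have cv : P (E k) @[k --> \oo] --> P (\bigcup_N E N) := nondecreasing_cvg_mu mE mU ndE.
by apply: (cvge_to_le cv); apply: nearW => N; exact: E_le.
Qed.

End Coordinate.

Section Tail.
Hypothesis L_log_moment : ('E_P[fun w => ln (Num.max 1 (enorm (L 1 w)))%R] < +oo)%E.

Let Z w := ln (Num.max 1 (enorm (L 1 w))).

Lemma log_norm_measurable : measurable_fun setT Z.
Proof.
have /random_vectorP mL := levy_measurable LP 1.
apply: measurableT_comp; first exact: measurable_ln.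
apply: measurable_maxr; first exact: measurable_cst.
apply: measurableT_comp; first by apply: continuous_measurable_fun; exact: sqrt_continuous.
by apply: measurable_sum => i; apply: measurable_funX.
Qed.

Lemma log_norm_ge0 w : 0 <= Z w.
Proof. by rewrite /Z ln_ge0 // le_max lexx. Qed.

Lemma log_tail_sum (e : R) : 0 < e -> exists K : R, forall N,
  (\sum_(0 <= n < N) P [set w | (e * n.+1%:R < Z w)%R] <= K%:E)%E.
Proof.
move=> e0; pose F n := [set w | e * n.+1%:R < Z w].
have mF n : measurable (F n).
  have := log_norm_measurable measurableT (measurable_itv `]e * n.+1%:R, +oo[).
  rewrite setTI (_ : _ @^-1` _ = F n) //.
  by apply/seteqP; split=> w; rewrite /= in_itv /= andbT.
have point N w : \sum_(0 <= n < N) e * \1_(F n) w <= Z w /\ \sum_(0 <= n < N) e * \1_(F n) w <= e * N%:R.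
  elim: N => [|N [IH1 IH2]]; first by rewrite big_nil mulr0 log_norm_ge0.
  rewrite big_nat_recr //= indicE; have [/set_mem FN|FN] := boolP (w \in F N).
    move: FN; rewrite /F /= mulr1 -natr1 mulrDr mulr1 => FN; split; lra.
  rewrite mulr0 addr0; split=> //; apply: le_trans IH2 _.
  by rewrite ler_pM2l // ler_nat.
have EZ : ('E_P[Z] = \int[P]_w (Z w)%:E)%E by rewrite unlock.
have fZ : ('E_P[Z])%E \is a fin_num.
  by rewrite ge0_fin_numE // expectation_ge0 // => w; exact: log_norm_ge0.
exists (fine ('E_P[Z])%E / e) => N.
have : (e%:E * \sum_(0 <= n < N) P (F n) <= 'E_P[Z])%E.
  rewrite ge0_sume_distrr // EZ.
  have mI n : measurable_fun setT (fun w => e * \1_(F n) w : R).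
    by apply: measurable_funM; [exact: measurable_cst|apply: measurable_indic].
  have I0 n w : (0 <= (e * \1_(F n) w)%:E)%E by rewrite lee_fin mulr_ge0 // ltW.
  rewrite (_ : \sum_(0 <= n < N) e%:E * P (F n) = \int[P]_w (\sum_(0 <= n < N) (e * \1_(F n) w)%:E))%E.
    apply: ge0_le_integral => //.
    - by move=> w _; apply: sume_ge0 => n _; exact: I0.
    - by apply: emeasurable_sum => n; apply/measurable_EFinP.
    - by apply/measurable_EFinP; exact: log_norm_measurable.
    - by move=> w _; rewrite sumEFin lee_fin; have [] := point N w.
  rewrite ge0_integral_sum //.
  - apply: eq_bigr => n _; under eq_integral do rewrite EFinM.
    rewrite ge0_integralZl_EFin // ?ltW //; first by rewrite integral_indic ?setIT.
    + by apply/measurable_EFinP; exact: measurable_indic.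
  - by move=> n; apply/measurable_EFinP.
rewrite -(fineK fZ) [(_ / _)%:E]EFinM lee_pdivlMr // muleC //.
Qed.

Lemma probability_ae_le (E F : set O) : measurable E -> measurable F ->
  {ae P, forall w, E w -> F w} -> (P E <= P F)%E.
Proof.
move=> mE mF EF; have -> : P E = P (E `&` F).
  apply: probability_ae_eq => //; first exact: measurableI.
  by apply: filterS EF => w EFw; split=> [Ew|[]//]; split=> //; exact: EFw.
apply: le_measure; rewrite ?inE //; first exact: measurableI.

Qed.

Lemma coord_le_enorm (v : 'cV[R]_m) j : `|v j 0| <= enorm v.
Proof.
rewrite /enorm -sqrtr_sqr; apply: ler_wsqrtr.
by rewrite (bigD1 j) //= lerDl; apply: sumr_ge0 => i _; rewrite sqr_ge0.
Qed.

Lemma increment_tail (j : 'I_m) (y : R) :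
  (P (oscillation j 0 1 (expR y)) <= P [set w | (y < Z w)%R])%E.
Proof.
apply: probability_ae_le; first exact: oscillation_measurable.
  have := log_norm_measurable measurableT (measurable_itv `]y, +oo[).
  rewrite setTI (_ : _ @^-1` _ = [set w | y < Z w]) //.
  by apply/seteqP; split=> w; rewrite /= in_itv /= andbT.
apply: filterS (levy_start LP) => w L0; rewrite /oscillation /= L0 [X in _ - X]mxE subr0 => h.
have h2 : expR y < Num.max 1 (enorm (L 1 w)).
  by apply: lt_le_trans h _; rewrite le_max coord_le_enorm orbT.
by rewrite /Z -(expRK y) ltr_ln // posrE ?expR_gt0 // lt_max ltr01.
Qed.

Lemma levy_growth_rate (j : 'I_m) (e : R) : 0 < e -> {ae P, forall w,
  exists2 K : R, 0 <= K & forall u, u <= 0 -> `|L u w j 0| <= K * expR (- (2 * e) * u)}.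
Proof.
move=> e0; have [b b0 tight] := tightness j.
pose a (n : nat) : R := - n.+1%:R; pose x (n : nat) : R := expR (e * n.+1%:R).
pose A n := \bigcup_N [set w | exists2 k, (k <= 2 ^ N)%N &
  oscillation j (a n) (a n + dyadic R N k) (x n + b) w].
have mA n : measurable (A n) by have [] := block_maximal b0 tight (a n) (x n).
have PA n : (P (A n) <= 2%:E * P [set w | (e * n.+1%:R < Z w)%R])%E.
  have [_ h] := block_maximal b0 tight (a n) (x n); apply: le_trans h _.
  by rewrite lee_wpmul2l ?lee_fin // increment_tail.
have [K KP] := log_tail_sum e0.
have sumA : (\sum_(n <oo) P (A n) < +oo)%E.
  apply: (@le_lt_trans _ _ (2 * K)%:E); last exact: ltry.
  apply: lime_le; first by apply: is_cvg_nneseries.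
  apply: nearW => N; rewrite EFinM; apply: le_trans (lee_wpmul2l _ (KP N)); last by rewrite lee_fin.
  rewrite ge0_sume_distrr //; apply: lee_sum => n _; exact: PA.
have A0 := lim_sup_set_cvg0 mA sumA.
exists (lim_sup_set A); split=> //.
  by apply: bigcapT_measurable => n; apply: bigcup_measurable.
move=> w /= bad n _; apply: contrapT => no; apply: bad.
apply: (@block_growth R (fun u => L u w j 0) e b n) => //; first exact: path_coord_rcll.
move=> k nk; apply: dyadic_control; first exact: path_coord_rcll.
move=> N i iN; rewrite leNgt; apply/negP => h; apply: no; exists k => //.
by exists N => //; exists i.
Qed.

Theorem levy_subexponential : {ae P, forall w, forall j, subexponential (fun u => L u w j 0)}.
Proof.
have H (n : nat) : {ae P, forall w, forall j : 'I_m, exists2 K : R, 0 <= K &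
    forall u, u <= 0 -> `|L u w j 0| <= K * expR (- (2 * n.+1%:R^-1) * u)}.
  by apply: filter_forall => j; apply: levy_growth_rate; rewrite invr_gt0.
apply: filterS (ae_foralln H) => w Hw j eps eps0.
have [K K0 KP] := Hw (Num.bound (2 / eps)) j; exists K => // u u0.
apply: le_trans (KP u u0) _; rewrite ler_wpM2l // ler_expR !mulNr -!mulrN.
rewrite ler_wpM2r ?oppr_ge0 // ler_pdivrMr // mulrC -ler_pdivrMr //.
apply: le_trans (ltW (archi_boundP _)) _; first by rewrite divr_ge0 // ltW.
by rewrite ler_nat.
Qed.

End Tail.
End LevyGrowth.


Section RegularVersion.
Context (dO : measure_display) (O : measurableType dO) (R : realType) (P : probability O R).
Variables (m : nat).

Lemma random_vectorB (X Y : O -> 'cV[R]_m) : random_vector X -> random_vector Y ->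
  random_vector (fun w => X w - Y w).
Proof.
move=> /random_vectorP mX /random_vectorP mY; apply/random_vectorP => j.
rewrite (_ : (fun w => _) = fun w => X w j 0 - Y w j 0); first exact: measurable_funB.
by apply/funext => w; rewrite !mxE.
Qed.

Lemma levy_process_ae (L L' : R -> O -> 'cV[R]_m) : levy_process P L ->
  (forall t, random_vector (L' t)) -> (forall w, cadlag (fun t => L' t w)) ->
  {ae P, forall w, forall t, L t w = L' t w} -> levy_process P L'.
Proof.
move=> LP mL' cL' LL; have mL := levy_measurable LP.
have ae1 (s t : R) (U : set 'cV[R]_m) : borel U ->
    P [set w | U (L' t w - L' s w)] = P [set w | U (L t w - L s w)].
  move=> bU; apply: probability_ae_eq; [exact: (random_vectorB (mL' t) (mL' s) bU)
    |exact: (random_vectorB (mL t) (mL s) bU)|].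
  by apply: filterS LL => w Lw; rewrite /= !Lw.
split=> //.
- by move: LL (levy_start LP); apply: filterS2 => w /= Lw <-; rewrite Lw.
- by move=> s t h U st bU; rewrite !ae1 //; exact: (levy_stationary LP).
- move=> n t U t_le bU; rewrite (eq_bigr (fun i : 'I_n => P [set w | U i (L (t i.+1) w - L (t i) w)])); last first.
    by move=> i _; exact: ae1.
  rewrite -(levy_independent LP t_le bU); apply: probability_ae_eq.
  + apply: (@measurable_finite_all _ O n (fun i => (fun w => L' (t i.+1) w - L' (t i) w) @^-1` U i)) => i _.
    exact: (random_vectorB (mL' _) (mL' _) (bU i)).
  + apply: (@measurable_finite_all _ O n (fun i => (fun w => L (t i.+1) w - L (t i) w) @^-1` U i)) => i _.
    exact: (random_vectorB (mL _) (mL _) (bU i)).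
  + by apply: filterS LL => w Lw; split=> H i /H; rewrite !Lw.
Qed.

Lemma cadlag_cst (v : 'cV[R]_m) : cadlag (fun=> v).
Proof. by move=> t; split; [exact: cvg_cst|exact: is_cvg_cst]. Qed.

(** On a null set the paths are replaced by 0, so that every path is tame. *)
Lemma regular_version (L : R -> O -> 'cV[R]_m) : levy_process P L ->
  ('E_P[fun w => ln (Num.max 1 (enorm (L 1 w)))%R] < +oo)%E ->
  exists L', [/\ levy_process P L',
    (forall w j, subexponential (fun u => L' u w j 0)) &
    {ae P, forall w, forall t, L t w = L' t w}].
Proof.
move=> LP LM; have [N [mN N0 hN]] := levy_subexponential LP LM.
pose L' t w : 'cV[R]_m := if `[< N w >] then 0 else L t w.
have ae_eq : {ae P, forall w, forall t, L t w = L' t w}.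
  by exists N; split=> // w /= h; apply: contrapT => Nw; apply: h => t; rewrite /L' asboolF.
exists L'; split=> //.
  apply: (levy_process_ae LP) => // [t|w].
    have /random_vectorP mL := levy_measurable LP t.
    apply/random_vectorP => j; rewrite (_ : (fun w => _) = fun w => L t w j 0 * \1_(~` N) w).
      apply: measurable_funM => //; apply: measurable_indic; exact: measurableC.
    apply/funext => w; rewrite /L' indicE; case: asboolP => Nw.
      by rewrite mxE memNset ?mulr0 //= => h; exact: h.
    by rewrite mem_set ?mulr1.
  rewrite /L'; case: asboolP => _; first exact: cadlag_cst.
  exact: levy_cadlag LP w.
move=> w j; rewrite /L'; case: asboolP => Nw.
  by move=> eps _; exists 0 => // u _; rewrite mxE normr0 mul0r.
by apply: contrapT => h; apply: Nw; apply: hN => /= H; apply: h; exact: H.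
Qed.

End RegularVersion.


Section ShiftedKernel.
Variable R : realType.
Implicit Types (a : nat -> R) (l : R -> R) (b s t u h : R).

Lemma rcll_shift l h : rcll l -> rcll (fun u => l (u + h)).
Proof.
move=> lP t; have [_ /cvg_ex[/= z cz]] := lP (t + h); split.
  apply/cvgrPdist_lt => e e0; have [del d0 dP] := rcll_right (t + h) lP e0.
  apply/nbhs_ballP; exists del => //= u; rewrite /ball /= => tu lt_tu.
  rewrite distrC; apply: dP; rewrite lerD2r (ltW lt_tu) /=.
  by move: tu; rewrite ltr_distlC => /andP[]; lra.
apply/cvg_ex; exists z; apply/cvgrPdist_lt => e e0.
have /cvgrPdist_lt/(_ e e0) /nbhs_ballP[del d0 dP] := cz.
apply/nbhs_ballP; exists del => //= u; rewrite /ball /= => tu lt_ut.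
apply: dP; rewrite /ball /= ?ltrD2r //.
by rewrite opprD addrACA subrr addr0.
Qed.

Lemma subexponential_shift l h : rcll l -> subexponential l -> subexponential (fun u => l (u + h)).
Proof.
move=> lP ls e e0; have [K K0 KP] := subexponential_le h lP ls e0.
exists (K * expR (- e * h)); first by rewrite mulr_ge0 ?expR_ge0.
move=> u u0; rewrite -mulrA -expRD -mulrDr [h + u]addrC; apply: KP.
by rewrite gerDr.
Qed.

Lemma riemann_sum_shift g l h n (s : nat -> R) :
  riemann_sum g (fun u => l (u + h)) n s = riemann_sum (fun u => g (u - h)) l n (fun i => s i + h).
Proof. by apply: eq_bigr => i _; rewrite addrK. Qed.

Lemma uniform_sum_cvg a l b t : geometric_bound a -> rcll l -> b <= t ->
  riemann_sum (fun u => egf a (t - u)) l k.+1 (uniform_part b t k) @[k --> \oo]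
  --> kernel_integral a l b t.
Proof.
move=> ga lP bt; apply: (@kernel_integral_cvg R a l b t (fun k => k.+1) (fun k => uniform_part b t k) (uniform_mesh b t)) => //.
- by move=> k; exact: uniform_part_of.
- by move=> k i _; exact: uniform_part_mesh.
- exact: uniform_mesh_cvg.
Qed.

Lemma kernel_integral_shift a l b t h : geometric_bound a -> rcll l -> b <= t ->
  kernel_integral a (fun u => l (u + h)) b t = kernel_integral a l (b + h) (t + h).
Proof.
move=> ga lP bt; have c1 := uniform_sum_cvg ga (rcll_shift h lP) bt.
have c2 : riemann_sum (fun u => egf a (t + h - u)) l k.+1 (fun i => uniform_part b t k i + h) @[k --> \oo]
    --> kernel_integral a l (b + h) (t + h).
  apply: (@kernel_integral_cvg R a l _ _ (fun k => k.+1) (fun k i => uniform_part b t k i + h) (uniform_mesh b t)) => //.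
  - by rewrite lerD2r.
  - move=> k; have [p1 p2 p3] := uniform_part_of k bt.
    by split=> [||i ik]; rewrite ?p1 ?p2 // lerD2r p3.
  - by move=> k i _; rewrite opprD addrACA subrr addr0; exact: uniform_part_mesh.
  - exact: uniform_mesh_cvg.
apply: (cvg_unique (@norm_hausdorff _ R) c1).
rewrite (_ : (fun k => _) = fun k => riemann_sum (fun u => egf a (t + h - u)) l k.+1
  (fun i => uniform_part b t k i + h)) //.
apply/funext => k; rewrite riemann_sum_shift.
have -> : (fun u => egf a (t - (u - h))) = fun u => egf a (t + h - u).
  by apply/funext => u; rewrite opprB addrA.
by [].
Qed.

Lemma kernel_limit_shift a l t h : geometric_bound a -> decaying a -> rcll l ->
  subexponential l -> kernel_limit a (fun u => l (u + h)) t = kernel_limit a l (t + h).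
Proof.
move=> ga da lP ls; pose b (k : nat) : R := - (k%:R + `|h| + `|t|).
have bE k : b k <= - k%:R by rewrite /b; have := normr_ge0 h; have := normr_ge0 t; lra.
have bhE k : b k + h <= - k%:R by rewrite /b; have := ler_norm h; have := normr_ge0 t; lra.
have bt k : b k <= t.
  rewrite /b; have := ler_norm (- t); have := normr_ge0 h; have := ler0n R k.
  by rewrite normrN; lra.
have c1 := @kernel_limit_cvg R a _ t _ ga da (rcll_shift h lP) (subexponential_shift h lP ls) bE.
have c2 := @kernel_limit_cvg R a _ (t + h) _ ga da lP ls bhE.
apply: (cvg_unique (@norm_hausdorff _ R) c1).
rewrite (_ : (fun k => _) = fun k => kernel_integral a l (b k + h) (t + h)) //.
by apply/funext => k; rewrite kernel_integral_shift.
Qed.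

(* Measurable functionals of the increments. *)
Lemma kernel_limit_measurable (d : measure_display) (T : measurableType d) (l : T -> R -> R) a t :
  geometric_bound a -> decaying a -> (forall x, rcll (l x)) -> (forall x, subexponential (l x)) ->
  (forall u v, measurable_fun setT (fun x => l x v - l x u)) ->
  measurable_fun setT (fun x => kernel_limit a (l x) t).
Proof.
move=> ga da lP ls ml; pose b (k : nat) : R := - (k%:R + `|t|).
have bE k : b k <= - k%:R by rewrite /b; have := normr_ge0 t; lra.
have bt k : b k <= t.
  by rewrite /b; have := ler_norm (- t); have := ler0n R k; rewrite normrN; lra.
apply: (@measurable_fun_cvg _ _ _ _ (fun k x => kernel_integral a (l x) (b k) t)); last first.
  by move=> x _; exact: kernel_limit_cvg.
move=> k; apply: (@measurable_fun_cvg _ _ _ _ (fun n x => riemann_sum (fun u => egf a (t - u)) (l x) n.+1 (uniform_part (b k) t n))); last first.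
  by move=> x _; exact: uniform_sum_cvg.
move=> n; apply: measurable_sum => i; apply: measurable_funM => //.
Qed.

End ShiftedKernel.

Section IncrementFields.
Context (dO : measure_display) (O : measurableType dO) (R : realType) (P : probability O R).
Variables (m : nat) (L : R -> O -> 'cV[R]_m).
Hypothesis LP : levy_process P L.
Variable h : R.

(** The path at (b, w), shifted in time by h when b is true: a set of pairs is
    an event for the shifted and for the original process at the same time. *)
Definition two_paths (u : R) (x : bool * O) : 'cV[R]_m := L (if x.1 then u + h else u) x.2.

Let node (s : seq R) i : R := nth 0 (sort <=%R s) i.
Let incr s i x := two_paths (node s i.+1) x - two_paths (node s i) x.

Definition grid_events (s : seq R) : set (set (bool * O)) := rectangles (size s).-1 (incr s).

Let node_le s i : (i < (size s).-1)%N -> node s i <= node s i.+1.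
Proof.
move=> i_n; have /sortedP : sorted <=%R (sort <=%R s) by apply: sort_sorted; exact: le_total.
by move=> /(_ 0 i); apply; rewrite size_sort; case: (size s) i_n.
Qed.

(* Stationarity and independence of the increments, on a grid. *)
Lemma grid_events_agree s E : <<s grid_events s >> E ->
  [/\ measurable (pair true @^-1` E), measurable (pair false @^-1` E) &
      P (pair true @^-1` E) = P (pair false @^-1` E)].
Proof.
apply: generated_agree => //.
- exact: (le_lt_trans (probability_le1 P measurableT) (ltry 1%R)).
- exact: rectangles_setI.
move=> _ [U bU ->]; set n := (size s).-1.
have m1 (t : nat -> R) : measurable [set w | forall i, (i < n)%N -> U i (L (t i.+1) w - L (t i) w)].
  apply: (@measurable_finite_all _ O n (fun i => (fun w => L (t i.+1) w - L (t i) w) @^-1` U i)) => i _.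
  exact: increment_measurable LP _ _ _ (bU i).
have E1 : pair true @^-1` [set w | forall i, (i < n)%N -> U i (incr s i w)] =
  [set w | forall i, (i < n)%N -> U i (L (node s i.+1 + h) w - L (node s i + h) w)] by [].
have E2 : pair false @^-1` [set w | forall i, (i < n)%N -> U i (incr s i w)] =
  [set w | forall i, (i < n)%N -> U i (L (node s i.+1) w - L (node s i) w)] by [].
rewrite E1 E2; split; [exact: (m1 (fun i => node s i + h))|exact: m1|].
have t1 i : (i < n)%N -> node s i <= node s i.+1 by exact: node_le.
have t2 i : (i < n)%N -> node s i + h <= node s i.+1 + h by move=> i_n; rewrite lerD2r t1.
have ind1 := levy_independent LP t1 bU.
have ind2 := @levy_independent _ _ _ _ _ _ LP n (fun i => node s i + h) U t2 bU.
apply: (etrans ind2); apply: (etrans _ (esym ind1)).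
by apply: eq_bigr => i _; apply: (levy_stationary LP) => //; exact: t1.
Qed.

Let increment_grid s u v j : u \in s -> v \in s ->
  measurable_fun setT (fun x : g_sigma_algebraType (grid_events s) =>
    two_paths v x j 0 - two_paths u x j 0).
Proof.
have from0 k : (k < size s)%N -> measurable_fun setT
    (fun x : g_sigma_algebraType (grid_events s) => two_paths (node s k) x j 0 - two_paths (node s 0) x j 0).
  move=> ks; rewrite (_ : (fun w => _) = fun x => \sum_(0 <= a < k) if (a < (size s).-1)%N then incr s a x j 0 else 0).
    apply: measurable_sum => a; case: (boolP (a < (size s).-1)%N) => [an|_]; last exact: measurable_cst.
    exact: rectangles_measurable.
  apply/funext => x; elim: k ks => [|k IH] ks; first by rewrite subrr big_nil.
  rewrite big_nat_recr //= -(IH (ltnW ks)) (_ : (k < (size s).-1)%N); last by case: (size s) ks.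
  by rewrite /incr !mxE [RHS]addrC addrA subrK.
have at_node u' : u' \in s -> exists2 k, (k < size s)%N & u' = node s k.
  move=> us; exists (index u' (sort <=%R s)); last by rewrite /node nth_index // mem_sort.
  by rewrite -(size_sort <=%R) index_mem mem_sort.
move=> /at_node[k ks ->] /at_node[k' ks' ->].
rewrite (_ : (fun x => _) = fun x => (two_paths (node s k') x j 0 - two_paths (node s 0) x j 0) -
  (two_paths (node s k) x j 0 - two_paths (node s 0) x j 0)).
  by apply: measurable_funB; exact: from0.
by apply/funext => x; ring.
Qed.

Let grid_events_sub s s' : {subset s <= s'} -> <<s grid_events s >> `<=` <<s grid_events s' >>.
Proof.
move=> ss'; apply: smallest_sub; first exact: smallest_sigma_algebra.
move=> _ [U bU ->].
apply: (@measurable_finite_all _ (g_sigma_algebraType (grid_events s')) (size s).-1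
  (fun i => incr s i @^-1` U i)) => i i_n.
have /measurable_matrixP : forall k l, measurable_fun setT
    (fun x : g_sigma_algebraType (grid_events s') => incr s i x k l); last by apply.
move=> k l; rewrite (ord1 l) (_ : (fun x => _) = fun x => two_paths (node s i.+1) x k 0 - two_paths (node s i) x k 0).
  have i1 : (i.+1 < size s)%N by case: (size s) i_n.
  by apply: increment_grid; apply: ss'; rewrite -(mem_sort <=%R) mem_nth // size_sort // ltnW.
by apply/funext => x; rewrite /incr !mxE.
Qed.

Definition increment_events : set (set (bool * O)) := [set E | exists s, <<s grid_events s >> E].

Lemma increment_events_agree E : <<s increment_events >> E ->
  [/\ measurable (pair true @^-1` E), measurable (pair false @^-1` E) &
      P (pair true @^-1` E) = P (pair false @^-1` E)].
Proof.
apply: generated_agree => //.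
- exact: (le_lt_trans (probability_le1 P measurableT) (ltry 1%R)).
- move=> E1 E2 [s1 E1s] [s2 E2s]; exists (s1 ++ s2).
  apply: (@measurableI _ (g_sigma_algebraType (grid_events (s1 ++ s2)))).
    by apply: grid_events_sub E1s => x xs; rewrite mem_cat xs.
  by apply: grid_events_sub E2s => x xs; rewrite mem_cat xs orbT.
- by move=> E' [s Es]; exact: grid_events_agree Es.
Qed.

Lemma increment_events_measurable u v j : measurable_fun setT
  (fun x : g_sigma_algebraType increment_events => two_paths v x j 0 - two_paths u x j 0).
Proof.
apply: measurable_gt => c; apply: sub_gen_smallest; exists [:: u; v].
have := @increment_grid [:: u; v] u v j; rewrite !inE !eqxx orbT => /(_ isT isT).
move=> /(_ measurableT _ (measurable_itv `]c, +oo[)); rewrite setTI.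
rewrite (_ : _ @^-1` _ = [set x | c < two_paths v x j 0 - two_paths u x j 0]) //.
by apply/seteqP; split=> x; rewrite /= in_itv /= andbT.
Qed.

End IncrementFields.


Section KernelLinearity.
Variable R : realType.
Implicit Types (a : nat -> R) (l : R -> R) (b s t u : R).

Lemma egf_lin c a a' t : geometric_bound a -> geometric_bound a' ->
  egf (fun k => c * a k + a' k) t = c * egf a t + egf a' t.
Proof. by move=> ga ga'; rewrite egfD ?egfZ //; exact: geometric_boundZ. Qed.

Lemma geometric_bound_lin c a a' : geometric_bound a -> geometric_bound a' ->
  geometric_bound (fun k => c * a k + a' k).
Proof. by move=> ga ga'; apply: geometric_boundD => //; exact: geometric_boundZ. Qed.

Lemma decaying_lin c a a' : geometric_bound a -> geometric_bound a' ->
  decaying a -> decaying a' -> decaying (fun k => c * a k + a' k).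
Proof.
move=> ga ga' [M [r [r0 M0 H]]] [M' [r' [r'0 M'0 H']]].
exists (`|c| * M + M'), (Num.min r r'); split.
- by rewrite lt_min r0.
- by rewrite addr_ge0 // mulr_ge0.
have key (x x' : R) s : 0 <= s -> `|x| <= M * expR (- r * s) -> `|x'| <= M' * expR (- r' * s) ->
    `|c * x + x'| <= (`|c| * M + M') * expR (- Num.min r r' * s).
  move=> s0 h h'; apply: le_trans (ler_normD _ _) _; rewrite mulrDl normrM; apply: lerD.
    rewrite -mulrA ler_wpM2l //; apply: le_trans h _; rewrite ler_wpM2l // ler_expR !mulNr lerN2.
    by rewrite ler_wpM2r // ge_min lexx.
  apply: le_trans h' _; rewrite ler_wpM2l // ler_expR !mulNr lerN2.
  by rewrite ler_wpM2r // ge_min lexx orbT.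
move=> s s0; have [h1 h2] := H s s0; have [h1' h2'] := H' s s0; split.
  by rewrite egf_lin //; exact: key.
rewrite (_ : shift_seq _ = fun k => c * shift_seq a k + shift_seq a' k) // egf_lin; first exact: key.
- exact: geometric_bound_shift.
- exact: geometric_bound_shift.
Qed.

Lemma egf_zero t : egf (fun=> 0) t = 0 :> R.
Proof.
rewrite (_ : (fun=> 0) = fun k : nat => (0 : R) * (fun=> 0 : R) k); last by apply/funext => k; rewrite mul0r.
by rewrite egfZ ?mul0r //; exact: geometric_bound0.
Qed.

Lemma decaying0 : decaying (fun=> 0 : R).
Proof.
exists 0, 1; split=> // s _; rewrite (_ : shift_seq _ = fun=> 0) // egf_zero normr0 mul0r.
by split.
Qed.

Lemma kernel_integral_lin c a a' l b t : geometric_bound a -> geometric_bound a' -> rcll l -> b <= t ->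
  kernel_integral (fun k => c * a k + a' k) l b t = c * kernel_integral a l b t + kernel_integral a' l b t.
Proof.
move=> ga ga' lP bt; have c1 := uniform_sum_cvg ga lP bt; have c2 := uniform_sum_cvg ga' lP bt.
have c3 := uniform_sum_cvg (geometric_bound_lin c ga ga') lP bt.
apply: (cvg_unique (@norm_hausdorff _ R) c3).
have E k : riemann_sum (fun u => egf (fun k => c * a k + a' k) (t - u)) l k.+1 (uniform_part b t k) =
  c * riemann_sum (fun u => egf a (t - u)) l k.+1 (uniform_part b t k) +
  riemann_sum (fun u => egf a' (t - u)) l k.+1 (uniform_part b t k).
  rewrite /riemann_sum mulr_sumr -big_split /=; apply: eq_bigr => i _.
  by rewrite egf_lin // mulrDl mulrA.
rewrite (funext E); exact: (cvgD (cvgM (cvg_cst c) c1) c2).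
Qed.

Lemma kernel_limit_lin c a a' l t : geometric_bound a -> geometric_bound a' ->
  decaying a -> decaying a' -> rcll l -> subexponential l ->
  kernel_limit (fun k => c * a k + a' k) l t = c * kernel_limit a l t + kernel_limit a' l t.
Proof.
move=> ga ga' da da' lP ls; have [b [bt bk]] := ninfty_sequence t.
have c1 := @kernel_limit_cvg R a l t b ga da lP ls bk.
have c2 := @kernel_limit_cvg R a' l t b ga' da' lP ls bk.
have c3 := @kernel_limit_cvg R _ l t b (geometric_bound_lin c ga ga') (decaying_lin c ga ga' da da') lP ls bk.
apply: (cvg_unique (@norm_hausdorff _ R) c3).
have E k : kernel_integral (fun k => c * a k + a' k) l (b k) t =
  c * kernel_integral a l (b k) t + kernel_integral a' l (b k) t by exact: kernel_integral_lin.
rewrite (funext E); exact: (cvgD (cvgM (cvg_cst c) c1) c2).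
Qed.

Lemma kernel_limit_zero l t : rcll l -> subexponential l -> kernel_limit (fun=> 0) l t = 0.
Proof.
move=> lP ls; have g0 := geometric_bound0 R; have d0 := decaying0.
have := kernel_limit_lin (- 1) t g0 g0 d0 d0 lP ls.
rewrite (_ : (fun k : nat => _) = fun=> 0) => [->|]; first by rewrite mulN1r addNr.
by apply/funext => k; rewrite mulr0 addr0.
Qed.

Lemma kernel_limit_sum (I : Type) (r : seq I) (c : I -> R) (a : I -> nat -> R) l t :
  (forall i, geometric_bound (a i)) -> (forall i, decaying (a i)) ->
  rcll l -> subexponential l ->
  [/\ geometric_bound (fun k => \sum_(i <- r) c i * a i k),
      decaying (fun k => \sum_(i <- r) c i * a i k) &
      kernel_limit (fun k => \sum_(i <- r) c i * a i k) l t = \sum_(i <- r) c i * kernel_limit (a i) l t].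
Proof.
move=> ga da lP ls; elim: r => [|i r [g d E]].
  rewrite (_ : (fun k => _) = fun=> 0); last by apply/funext => k; rewrite big_nil.
  by rewrite big_nil; split; [exact: geometric_bound0|exact: decaying0|exact: kernel_limit_zero].
rewrite (_ : (fun k => _) = fun k => c i * a i k + \sum_(i <- r) c i * a i k); last first.
  by apply/funext => k; rewrite big_cons.
split; [exact: geometric_bound_lin|exact: decaying_lin|].
by rewrite kernel_limit_lin // E big_cons.
Qed.

(* Entries of the exponential of a stable matrix. *)
Lemma stable_decaying n m (S : 'M[R[i]]_n) (Q : 'M[R[i]]_(n, m)) i j :
  (forall z, spectrum S z -> complex.Re z < 0) ->
  decaying (fun k => complex.Re ((S ^+ k *m Q) i j)) /\
  decaying (fun k => complex.Im ((S ^+ k *m Q) i j)).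
Proof.
move=> st; have [M [c [c0 M0 H]]] := mexp_decays Q i j st.
have [M' [c' [c'0 M'0 H']]] := mexp_decays (S *m Q) i j st.
have shift (k : nat) : (S ^+ k *m (S *m Q)) i j = (S ^+ k.+1 *m Q) i j.
  by rewrite mulmxA exprSr.
have mono (x s : R) : 0 <= s -> x <= M * expR (- c * s) \/ x <= M' * expR (- c' * s) ->
    x <= (M + M') * expR (- Num.min c c' * s).
  move=> s0 [|] h; apply: le_trans h _; apply: ler_pM => //; rewrite ?expR_ge0 //.
  - by rewrite lerDl.
  - by rewrite ler_expR !mulNr lerN2 ler_wpM2r // ge_min lexx.
  - by rewrite lerDr.
  - by rewrite ler_expR !mulNr lerN2 ler_wpM2r // ge_min lexx orbT.
have shE : shift_seq (fun k => (S ^+ k *m Q) i j) = fun k => (S ^+ k *m (S *m Q)) i j.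
  by apply/funext => k; rewrite /shift_seq shift.
have cm : 0 < Num.min c c' by rewrite lt_min c0.
have MM : 0 <= M + M' by rewrite addr_ge0.
split; exists (M + M'), (Num.min c c'); split=> // s s0; split; apply: mono => //.
- by left; apply: le_trans (H s s0); exact: (abs_Re_le (cegf (fun k => (S ^+ k *m Q) i j) s)).
- by right; apply: le_trans (H' s s0); rewrite -shE; exact: (abs_Re_le (cegf _ s)).
- by left; apply: le_trans (H s s0); exact: (abs_Im_le (cegf (fun k => (S ^+ k *m Q) i j) s)).
- by right; apply: le_trans (H' s s0); rewrite -shE; exact: (abs_Im_le (cegf _ s)).
Qed.

End KernelLinearity.

Section OrnsteinUhlenbeck.
Context (dO : measure_display) (O : measurableType dO) (R : realType) (P : probability O R).
Variables (m d : nat) (L : R -> O -> 'cV[R]_m).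
Hypothesis mL : forall t, random_vector (L t).
Hypothesis L_rcll : forall w j, rcll (fun u => L u w j 0).
Hypothesis L_sub : forall w j, subexponential (fun u => L u w j 0).
Variable alpha : 'I_d -> 'I_m -> nat -> R[i].
Hypothesis ga : forall i j, cgeom (alpha i j).
Let re i j k := complex.Re (alpha i j k).
Let im i j k := complex.Im (alpha i j k).
Hypothesis da : forall i j, decaying (re i j) /\ decaying (im i j).

(** The pathwise value of the integral over (-oo, t] of a decaying kernel. *)
Definition moving_average t w : 'cV[R[i]]_d := \col_i
  ((\sum_j kernel_limit (re i j) (fun u => L u w j 0) t) +i*
   (\sum_j kernel_limit (im i j) (fun u => L u w j 0) t)).

Lemma moving_average_integral (f : R -> 'M[R[i]]_(d, m)) t :
  (forall u i j, f u i j = cegf (alpha i j) (t - u)) ->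
  levy_integral_ninfty P L f t (moving_average t).
Proof.
move=> fE; pose J b w : 'cV[R[i]]_d := \col_i
  ((\sum_j kernel_integral (re i j) (fun u => L u w j 0) b t) +i*
   (\sum_j kernel_integral (im i j) (fun u => L u w j 0) b t)).
have gre i j : geometric_bound (re i j) := cgeom_Re (ga i j).
have gim i j : geometric_bound (im i j) := cgeom_Im (ga i j).
apply: (@levy_integral_ninfty_pathwise _ _ _ P _ _ L f t J) => // [b w bt n s delta sP sd d0 i|b bt bk w i].
  rewrite /J mxE /=; split.
    rewrite (_ : (fun k => _) = fun k => \sum_j riemann_sum (fun u => egf (re i j) (t - u)) (fun u => L u w j 0) (n k) (s k)).
      by apply: cvg_sum_seq => j; apply: (kernel_integral_cvg (d := delta)).
    apply/funext => k; rewrite step_integral_Re; apply: eq_bigr => j _.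
    by congr (riemann_sum _ _ _ _); apply/funext => u; rewrite fE.
  rewrite (_ : (fun k => _) = fun k => \sum_j riemann_sum (fun u => egf (im i j) (t - u)) (fun u => L u w j 0) (n k) (s k)).
    by apply: cvg_sum_seq => j; apply: (kernel_integral_cvg (d := delta)).
  apply/funext => k; rewrite step_integral_Im; apply: eq_bigr => j _.
  by congr (riemann_sum _ _ _ _); apply/funext => u; rewrite fE.
rewrite /moving_average mxE /=; split.
  rewrite (_ : (fun k => _) = fun k => \sum_j kernel_integral (re i j) (fun u => L u w j 0) (b k) t).
    by apply: cvg_sum_seq => j; apply: kernel_limit_cvg => //; have [] := da i j.
  by apply/funext => k; rewrite /J mxE.
rewrite (_ : (fun k => _) = fun k => \sum_j kernel_integral (im i j) (fun u => L u w j 0) (b k) t).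
  by apply: cvg_sum_seq => j; apply: kernel_limit_cvg => //; have [] := da i j.
by apply/funext => k; rewrite /J mxE.
Qed.

End OrnsteinUhlenbeck.


Section RealAverages.
Context (dO : measure_display) (O : measurableType dO) (R : realType) (P : probability O R).
Variables (m d : nat) (L : R -> O -> 'cV[R]_m).
Hypothesis LP : levy_process P L.
Hypothesis L_sub : forall w j, subexponential (fun u => L u w j 0).
Variable a : 'I_d -> 'I_m -> nat -> R.
Hypothesis ga : forall i j, geometric_bound (a i j).
Hypothesis da : forall i j, decaying (a i j).

Definition real_average t w : 'cV[R]_d :=
  \col_i \sum_j kernel_limit (a i j) (fun u => L u w j 0) t.

Let L_rcll w j : rcll (fun u => L u w j 0).
Proof. by apply: cadlag_rcll; exact: levy_cadlag LP w. Qed.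

Lemma real_average_measurable t : random_vector (real_average t).
Proof.
apply/random_vectorP => i.
rewrite (_ : (fun w => _) = fun w => \sum_j kernel_limit (a i j) (fun u => L u w j 0) t).
  apply: measurable_sum => j.
  apply: (@kernel_limit_measurable R _ O (fun w u => L u w j 0)) => // u v.
  have /random_vectorP/(_ j) := increment_measurable LP u v.
  by rewrite (_ : (fun w => _) = fun w => L v w j 0 - L u w j 0) //; apply/funext => w; rewrite !mxE.
by apply/funext => w; rewrite mxE.
Qed.

Theorem real_average_stationary : stationary P real_average.
Proof.
move=> n t h U bU.
pose l (j : 'I_m) (x : bool * O) u := two_paths L h u x j 0.
have l_rcll j x : rcll (l j x).
  by case: x => [[] w]; [exact: (rcll_shift h (L_rcll w j))|exact: L_rcll].
have l_sub j x : subexponential (l j x).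
  by case: x => [[] w]; [exact: (subexponential_shift h (L_rcll w j) (L_sub w j))|exact: L_sub].
pose Phi (x : bool * O) : 'M[R]_(d, n) := \matrix_(i, r) \sum_j kernel_limit (a i j) (l j x) (t r).
have mPhi : <<s increment_events L h >> (Phi @^-1` U).
  have /measurable_matrixP : forall i r, measurable_fun setT
    (fun x : g_sigma_algebraType (increment_events L h) => Phi x i r); last by move=> /(_ U bU).
  move=> i r; rewrite (_ : (fun x => _) = fun x => \sum_j kernel_limit (a i j) (l j x) (t r)).
    apply: measurable_sum => j.
    apply: (@kernel_limit_measurable R _ (g_sigma_algebraType (increment_events L h)) (l j)) => // u v.
    exact: increment_events_measurable.
  by apply/funext => x; rewrite mxE.
have [_ _] := increment_events_agree LP mPhi.
have E1 : pair true @^-1` (Phi @^-1` U) = [set w | U (\matrix_(i, j) real_average (t j + h) w i 0)].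
  apply/seteqP; split=> w; rewrite /preimage /= (_ : Phi (true, w) = \matrix_(i, j) real_average (t j + h) w i 0) //;
    apply/matrixP => i r; rewrite !mxE; apply: eq_bigr => j _;
    by rewrite -kernel_limit_shift.
have E2 : pair false @^-1` (Phi @^-1` U) = [set w | U (\matrix_(i, j) real_average (t j) w i 0)].
  apply/seteqP; split=> w; rewrite /preimage /= (_ : Phi (false, w) = \matrix_(i, j) real_average (t j) w i 0) //;
    by apply/matrixP => i r; rewrite !mxE; apply: eq_bigr => j _.
by rewrite E1 E2.
Qed.

End RealAverages.

Section StateSpace.
Variables (R : realType) (d m p q : nat).
Variables (A : nat -> 'M[R]_d) (B : nat -> 'M[R]_(d, m)).
Let SA := state_A p A.
Let SB := state_B p q A B.

Lemma cplx_mxX n (M : 'M[R]_n) k : cplx_mx (M ^+ k) = cplx_mx M ^+ k.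
Proof.
elim: k => [|k IH]; first by rewrite !expr0 /cplx_mx map_mx1.
by rewrite !exprS -!mulmxE /cplx_mx map_mxM -/(cplx_mx _) -/(cplx_mx (M ^+ k)) IH.
Qed.

Lemma state_spectrum z : (0 < p)%N -> spectrum (cplx_mx SA) z ->
  mxpoly_spectrum (ar_poly p (cplx_coefs A)) z.
Proof.
move=> p0 /eigenvalueP[v vz v0]; apply: companion_singular => //.
rewrite -cplx_state_A; apply/eqP; apply: contraNT v0 => det0.
have U : z%:M - cplx_mx SA \in unitmx by rewrite unitmxE unitfE.
have : v *m (z%:M - cplx_mx SA) = 0 by rewrite mulmxBr mul_mx_scalar vz subrr.
by move/(congr1 (mulmx^~ (invmx (z%:M - cplx_mx SA)))); rewrite mulmxK // mul0mx => ->.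
Qed.

Lemma state_decaying r j : (0 < p)%N ->
  (forall x, mxpoly_spectrum (ar_poly p (cplx_coefs A)) x -> complex.Re x < 0) ->
  decaying (fun k => (SA ^+ k *m SB) r j).
Proof.
move=> p0 stab; have st z : spectrum (cplx_mx SA) z -> complex.Re z < 0.
  by move=> /(state_spectrum p0); exact: stab.
have [+ _] := stable_decaying (cplx_mx SB) r j st.
rewrite (_ : (fun k => _) = fun k => (SA ^+ k *m SB) r j) //.
by apply/funext => k; rewrite -cplx_mxX /cplx_mx -map_mxM mxE.
Qed.

End StateSpace.


Lemma cRe_sum (R : realType) (I : Type) (r : seq I) (z : I -> R[i]) :
  complex.Re (\sum_(k <- r) z k) = \sum_(k <- r) complex.Re (z k).
Proof. exact: (big_morph (@complex.Re R) (@cReD R) (erefl _)). Qed.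

Lemma cIm_sum (R : realType) (I : Type) (r : seq I) (z : I -> R[i]) :
  complex.Im (\sum_(k <- r) z k) = \sum_(k <- r) complex.Im (z k).
Proof. exact: (big_morph (@complex.Im R) (@cImD R) (erefl _)). Qed.

Lemma kernel_limit_big (R : realType) (I : Type) (r : seq I) (a : I -> nat -> R) (l : R -> R) t :
  (forall i, geometric_bound (a i)) -> (forall i, decaying (a i)) ->
  rcll l -> subexponential l ->
  kernel_limit (fun k => \sum_(i <- r) a i k) l t = \sum_(i <- r) kernel_limit (a i) l t.
Proof.
move=> ga da lP ls; have [_ _ E] := kernel_limit_sum r (fun=> 1) t ga da lP ls.
have E1 : (fun k => \sum_(i <- r) a i k) = fun k => \sum_(i <- r) 1 * a i k.
  by apply/funext => k; apply: eq_bigr => i _; rewrite mul1r.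
by rewrite E1 E; apply: eq_bigr => i _; rewrite mul1r.
Qed.

Lemma crv_sum (dO : measure_display) (O : measurableType dO) (R : realType) (d : nat) (I : Type)
  (r : seq I) (Z : I -> O -> 'cV[R[i]]_d) : (forall k, complex_random_vector (Z k)) ->
  complex_random_vector (fun w => \sum_(k <- r) Z k w).
Proof.
move=> mZ; apply/complex_random_vectorP => i; split.
  rewrite (_ : (fun w => _) = fun w => \sum_(k <- r) complex.Re (Z k w i 0)).
    by apply: measurable_sum => k; have /complex_random_vectorP/(_ i)[] := mZ k.
  by apply/funext => w; rewrite summxE (big_morph (@complex.Re R) (@cReD R) (erefl _)).
rewrite (_ : (fun w => _) = fun w => \sum_(k <- r) complex.Im (Z k w i 0)).
  by apply: measurable_sum => k; have /complex_random_vectorP/(_ i)[] := mZ k.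
by apply/funext => w; rewrite summxE (big_morph (@complex.Im R) (@cImD R) (erefl _)).
Qed.

Theorem corollary3p3 (R : realType) (dO : measure_display)
  (O : measurableType dO) (P : probability O R) (d m p q : nat)
  (d_gt0 : (0 < d)%N) (m_gt0 : (0 < m)%N) (q_gt0 : (0 < q)%N)
  (q_lt_p : (q < p)%N)
  (L : R -> O -> 'cV[R]_m) (L_levy : levy_process P L)
  (A : nat -> 'M[R]_d) (B : nat -> 'M[R]_(d, m))
  (F_irreducible : left_coprime (ar_poly p A) (ma_poly q B))
  (S : 'I_p -> 'M[R[i]]_d)
  (S_complete : complete_solvents (cplx_coefs A) S)
  (S_regular : forall k, regular_solvent p (cplx_coefs A) (S k))
  (A_stable : forall x,
     mxpoly_spectrum (ar_poly p (cplx_coefs A)) x -> complex.Re x < 0)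
  (L_log_moment :
     ('E_P[fun w => ln (Num.max 1 (enorm (L 1 w)))%R] < +oo)%E)
  (Gamma : 'I_p -> R -> R[i])
  (Gamma_contour : forall k,
     solvent_contour (ar_poly p (cplx_coefs A)) (S k) (Gamma k)) :
  let F := mfd (ar_poly p (cplx_coefs A)) (ma_poly q (cplx_coefs B)) in
  let f := fun (k : 'I_p) (t u : R) =>
    ou_kernel (S k) (residue F (Gamma k)) t u in
  (forall k t, exists Z, levy_integral_ninfty P L (f k t) t Z) /\
  (forall Yk : 'I_p -> R -> O -> 'cV[R[i]]_d,
     (forall k t, levy_integral_ninfty P L (f k t) t (Yk k t)) ->
     let Y := fun (t : R) (w : O) => \sum_k Yk k t w in
     [/\ forall t, levy_integral_ninfty P L
           (fun u => \sum_k f k t u) t (Y t),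
         forall t, {ae P, forall w, Y t w = cplx_mx (Re_mx (Y t w))},
         stationary P (fun t w => Re_mx (Y t w)) &
         MCARMA P p q A B L (fun t w => Re_mx (Y t w))]).

Proof.
move=> F f.
have p0 : (0 < p)%N by exact: leq_ltn_trans q_lt_p.
have [L' [LP' L_sub LL']] := regular_version L_levy L_log_moment.
have L'L : {ae P, forall w, forall t, L' t w = L t w} by apply: filterS LL' => w Lw t; rewrite Lw.
have mL := levy_measurable L_levy; have mL' := levy_measurable LP'.
have L_rcll w j : rcll (fun u => L' u w j 0) by apply: cadlag_rcll; exact: levy_cadlag LP' w.
pose K k := residue F (Gamma k).
pose alpha k i j n := (S k ^+ n *m K k) i j.
have stable_S k z : spectrum (S k) z -> complex.Re z < 0.
  by move=> Sz; apply: A_stable; have [_ ->] := S_complete; exists k.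
have galpha k i j : cgeom (alpha k i j) by exact: cgeom_mul.
have dalpha k i j : decaying (fun n => complex.Re (alpha k i j n)) /\
    decaying (fun n => complex.Im (alpha k i j n)).
  exact: stable_decaying (stable_S k).
pose Z k t := moving_average L' (alpha k) t.
have fE k t u i j : f k t u i j = cegf (alpha k i j) (t - u) by exact: mexp_mulE.
have hZ k t : levy_integral_ninfty P L' (f k t) t (Z k t).
  by apply: moving_average_integral => // u i j; exact: fE.
have mZ k t : complex_random_vector (Z k t) by case: (hZ k t).
have aeZ k t : {ae P, forall w, Z k t w = Z k t w} by exact: aeW.
split; first by move=> k t; exists (Z k t); exact: levy_integral_ninfty_ae mL' mL L'L (mZ k t) (aeZ k t) (hZ k t).
move=> Yk hY Y.
(* The real kernel C e^(A s) B of the state space model. *)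
pose gam i j n := (state_C R d p *m state_A p A ^+ n *m state_B p q A B) i j.
pose coef r j n := (state_A p A ^+ n *m state_B p q A B) r j.
have gcoef r j : geometric_bound (coef r j).
  rewrite (_ : coef r j = fun n => (1%:M *m state_A p A ^+ n *m state_B p q A B) r j); first exact: geom_pow.
  by apply/funext => n; rewrite mul1mx.
have dcoef r j : decaying (coef r j) by exact: state_decaying.
have gamE i j : gam i j = fun n => \sum_r state_C R d p i r * coef r j n.
  by apply/funext => n; rewrite /gam -mulmxA mxE.
have gam_sum i j w t : [/\ geometric_bound (gam i j), decaying (gam i j) &
    kernel_limit (gam i j) (fun u => L' u w j 0) t =
    \sum_r state_C R d p i r * kernel_limit (coef r j) (fun u => L' u w j 0) t].
  by rewrite gamE; apply: kernel_limit_sum.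
have ggam i j : geometric_bound (gam i j) by rewrite gamE; have [] := gam_sum i j point 0; rewrite gamE.
have dgam i j : decaying (gam i j) by have [] := gam_sum i j point 0.
pose X t w := state_path (state_A p A) (state_B p q A B) (fun u => L' u w) t.
have XE : X = real_average L' coef by [].
pose V := real_average L' gam.
have VX t w : V t w = state_C R d p *m X t w.
  apply/matrixP => i l; rewrite (ord1 l) [LHS]mxE [RHS]mxE.
  apply: (@etrans _ _ (\sum_j \sum_r state_C R d p i r * kernel_limit (coef r j) (fun u => L' u w j 0) t)).
    by apply: eq_bigr => j _; have [_ _ ->] := gam_sum i j w t.
  apply: etrans; first exact: exchange_big.
  by apply: eq_bigr => r _; rewrite [X t w r 0]mxE mulr_sumr.
have alpha_sum i j n : \sum_k alpha k i j n = (gam i j n)%:C.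
  have := markov_parameters B q_lt_p q_gt0 S_complete S_regular Gamma_contour n.
  move=> /matrixP/(_ i j); rewrite summxE => ->.
  by rewrite -cplx_mxX /cplx_mx -!map_mxM mxE.
have Z_sum t w : \sum_k Z k t w = cplx_mx (V t w).
  have sum_Re i j : \sum_k kernel_limit (fun n => complex.Re (alpha k i j n)) (fun u => L' u w j 0) t =
      kernel_limit (gam i j) (fun u => L' u w j 0) t.
    have h1 k : geometric_bound (fun n => complex.Re (alpha k i j n)) := cgeom_Re (galpha k i j).
    have h2 k : decaying (fun n => complex.Re (alpha k i j n)) := proj1 (dalpha k i j).
    have <- := kernel_limit_big (index_enum 'I_p) t h1 h2 (L_rcll w j) (L_sub w j).
    have -> : (fun n => \sum_k complex.Re (alpha k i j n)) = gam i j; last by [].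
    by apply/funext => n; rewrite -cRe_sum alpha_sum.
  have sum_Im i j : \sum_k kernel_limit (fun n => complex.Im (alpha k i j n)) (fun u => L' u w j 0) t = 0.
    have h1 k : geometric_bound (fun n => complex.Im (alpha k i j n)) := cgeom_Im (galpha k i j).
    have h2 k : decaying (fun n => complex.Im (alpha k i j n)) := proj2 (dalpha k i j).
    have <- := kernel_limit_big (index_enum 'I_p) t h1 h2 (L_rcll w j) (L_sub w j).
    have -> : (fun n => \sum_k complex.Im (alpha k i j n)) = fun=> 0.
      by apply/funext => n; rewrite -cIm_sum alpha_sum.
    exact: kernel_limit_zero (L_rcll w j) (L_sub w j).
  apply/matrixP => i l; rewrite (ord1 l) summxE [RHS]mxE; apply: complex_ext.
    rewrite cRe_sum [V t w i 0]mxE [RHS]/=.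
    apply: (@etrans _ _ (\sum_k \sum_j kernel_limit (fun n => complex.Re (alpha k i j n)) (fun u => L' u w j 0) t)).
      by apply: eq_bigr => k _; rewrite mxE.
    apply: etrans; first exact: exchange_big.
    by apply: eq_bigr => j _; exact: sum_Re.
  rewrite cIm_sum [RHS]/=.
  apply: (@etrans _ _ (\sum_k \sum_j kernel_limit (fun n => complex.Im (alpha k i j n)) (fun u => L' u w j 0) t)).
    by apply: eq_bigr => k _; rewrite mxE.
  apply: etrans; first exact: exchange_big.
  by apply: big1 => j _; exact: sum_Im.
have aeYV t : {ae P, forall w, Y t w = cplx_mx (V t w)}.
  have : {ae P, forall w, forall k, Yk k t w = Z k t w}.
    apply: filter_forall => k.
    exact: levy_integral_ninfty_unique mL mL' LL' (hY k t) (hZ k t).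
  by apply: filterS => w Yw; rewrite /Y -Z_sum; apply: eq_bigr => k _; exact: Yw.
have mY t : complex_random_vector (Y t) by apply: crv_sum => k; case: (hY k t).
have aeReV t : {ae P, forall w, Re_mx (Y t w) = V t w}.
  by apply: filterS (aeYV t) => w ->; apply/matrixP => i j; rewrite !mxE.
split.
- move=> t; have hV : levy_integral_ninfty P L' (fun u => \sum_k f k t u) t
      (moving_average L' (fun i j n => (gam i j n)%:C) t).
    apply: moving_average_integral => //.
    + by move=> i j; rewrite (_ : (fun n => _) = fun n => \sum_k alpha k i j n);
        [exact: cgeom_sum|apply/funext => n; rewrite alpha_sum].
    + by move=> i j; split; [exact: dgam|exact: decaying0].
    + move=> u i j; rewrite summxE (_ : (fun n => _) = fun n => \sum_k alpha k i j n).
        by rewrite cegf_sum //; apply: eq_bigr => k _; exact: fE.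
      by apply/funext => n; rewrite alpha_sum.
  apply: (levy_integral_ninfty_ae mL' mL L'L (mY t) _ hV).
  apply: filterS (aeYV t) => w ->; apply/matrixP => i j; rewrite (ord1 j) !mxE.
  congr (_ +i* _); apply: big1 => l _; exact: kernel_limit_zero.
- move=> t; apply: filterS2 (aeYV t) (aeReV t) => w YV ReV; by rewrite ReV YV.
- move=> n t h U bU.
  have mReY t' : random_vector (fun w => Re_mx (Y t' w)) by case: (mY t').
  have mV t' : random_vector (V t') by exact: (real_average_measurable LP' L_sub ggam dgam).
  have mM (W : R -> O -> 'cV[R]_d) (t' : 'I_n -> R) : (forall t, random_vector (W t)) ->
      measurable [set w | U (\matrix_(i, j) W (t' j) w i 0)].
    move=> mW; have /measurable_matrixP : forall i j, measurable_fun setT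
      (fun w => (\matrix_(i, j) W (t' j) w i 0 : 'M[R]_(d, n)) i j); last by move=> /(_ U bU).
    move=> i j; rewrite (_ : (fun w => _) = fun w => W (t' j) w i 0).
      by have /random_vectorP := mW (t' j); apply.
    by apply/funext => w; rewrite mxE.
  have toV (t' : 'I_n -> R) : P [set w | U (\matrix_(i, j) Re_mx (Y (t' j) w) i 0)] =
      P [set w | U (\matrix_(i, j) V (t' j) w i 0)].
    apply: probability_ae_eq; [exact: (mM (fun t w => Re_mx (Y t w)) t' mReY)|exact: mM|].
    have : {ae P, forall w, forall j, Re_mx (Y (t' j) w) = V (t' j) w} by apply: filter_forall => j; exact: aeReV.
    apply: filterS => w YV /=.
    rewrite (_ : (\matrix_(i, j) Re_mx (Y (t' j) w) i 0) = \matrix_(i, j) V (t' j) w i 0) //.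
    by apply/matrixP => i j; rewrite [LHS]mxE [RHS]mxE YV.
  rewrite (toV (fun j => t j + h)) toV; exact: (real_average_stationary LP' L_sub ggam dgam).
- exists X; split; last by move=> t; apply: filterS (aeReV t) => w ->; exact: VX.
  split.
  + by move=> t; rewrite XE; exact: (real_average_measurable LP' L_sub gcoef dcoef).
  + by move=> w; apply: state_path_cadlag => //; exact: levy_cadlag LP' w.
  + apply: filterS LL' => w Lw s t st; rewrite !Lw.
    by apply: state_path_solution => //; exact: levy_cadlag LP' w.
Qed.
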